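(* Let $\mathcal{T}_n$ be the random $\Delta$-complex obtained by randomly gluing $n$ tetrahedra along their faces, and let $E$, $E_k$, $E_k^\circ$, $E_{KL}$ be the edge-counting random variables defined in the context. Below, $k,k_1,k_2,K,L$ denote functions $\mathbb{N}\to\mathbb{N}$ of $n$. (a) $\displaystyle \mathbb{E}_n[E]=\tfrac12\log(n)+O(1)$ as $n\to\infty$. (b) For all $k=o(\sqrt n)$, $$\mathbb{E}[E_k^\circ]=\frac{1}{2k}\cdot(1+o(1))$$ as $n\to\infty$. Moreover, the error is uniform in $k$. (c) For all $k=o(n)$ and $k_1\le k_2\le k$, $$\mathbb{E}[E_k]\le\frac{1}{2k}+O(n^{-1})\quad\text{and}\quad \mathbb{E}\left[\sum_{l=k_1}^{k_2}E_l\right]\le\frac12\log(k_2/k_1)+O(1)$$ as $n\to\infty$. In particular, for all $k=o(\sqrt n)$ and $k_1\le k_2\le k$, $$\mathbb{E}[E_k]=\frac{1}{2k}\cdot(1+o(1)),\qquad \mathbb{E}\left[\sum_{l=k_1}^{k_2}E_l\right]=\frac12\log(k_2/k_1)(1+o(1))$$ and $$\mathbb{E}[E_k-E_k^\circ]=o(1)$$ as $n\to\infty$. (d) For all $K,L=o(n^{1/3})$, $$\mathbb{E}[E_{KL}]=o(1)$$ as $n\to\infty$.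
   Context: Model. Take $n$ oriented tetrahedra whose $4n$ vertices carry distinct labels $1,\dots,4n$. Partition their $4n$ faces into $2n$ pairs uniformly at random. For each pair, independently, choose uniformly at random one of the three orientation-reversing simplicial identifications of the two faces (orientations of faces being induced by the outward orientation of the tetrahedra), and glue. The resulting $\Delta$-complex is $\mathcal{T}_n$. $\mathbb{E}_n=\mathbb{E}$ denotes expectation with respect to this (uniform) model. $E_k$ is the number of edges of $\mathcal{T}_n$ incident to exactly $k$ tetrahedra, counted with multiplicity (if an edge of $\mathcal{T}_n$ appears several times in the boundary of a given tetrahedron, that tetrahedron is counted each time); thus $\sum_k kE_k=6n$. This $k$ is the size of the edge. $E=\sum_{k\ge0}E_k$ is the total number of edges of $\mathcal{T}_n$. An edge is simple if it neighbours each tetrahedron at most once (i.e. at most one of the six edges of any given tetrahedron is identified to it); $E_k^\circ$ is the number of simple edges incident to exactly $k$ tetrahedra. $E_{KL}$ is the number of pairs of edges of $\mathcal{T}_n$, of size $\le K$ and $\le L$ respectively, that are incident to a common tetrahedron.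
   Formalization: In (c), the asymptotic E[sum_{l=k1}^{k2} E_l] = (1/2)log(k2/k1)(1+o(1)) is proved under the added hypothesis k2 - k1 -> infinity; as stated it fails, e.g. for k1 = k2 = 1, where the right side is 0 and the left tends to 1/2. Also k, k1 >= 1 is assumed so that 1/(2k) is defined. *)

(* Defs.v *)
From mathcomp Require Import all_boot all_fingroup all_algebra.

Set Implicit Arguments.
Unset Strict Implicit.
Unset Printing Implicit Defensive.

Import GRing.Theory.

(* The vertices of the t-th tetrahedron are the pairs (t, v) with v : 'I_4; the
   order 0 < 1 < 2 < 3 fixes its orientation.  The pair (t, i) : face n stands
   for the face of tetrahedron t opposite to its vertex i. *)
Definition face (n : nat) : finType := ('I_n * 'I_4)%type.

(* An identification of the face opposite to i with the face opposite to j is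
   stored as a permutation s of 'I_4 with s i = j: the vertex v != i of the
   first face is glued to the vertex s v of the second one.

   A permutation p with p 0 = i lists the vertices (p 1, p 2, p 3) of the face
   opposite to i; this ordering is positive for the outward orientation iff p
   is even.  The identification s turns it into the ordering p * s (first p,
   then s) of the face opposite to j.  Exactly three s satisfy both clauses. *)
Definition reversing_identification (i j : 'I_4) (s : 'S_4) : bool :=
  (s i == j) &&
  [forall p : 'S_4, (p ord0 == i) ==> (odd_perm (p * s)%g != odd_perm p)].

(* g.1 maps a face to the face it is glued to, g.2 maps a face to the
   identification with its partner. *)
Definition gluing (n : nat) : finType :=
  ({ffun face n -> face n} * {ffun face n -> 'S_4})%type.

Definition face_pairing n (m : {ffun face n -> face n}) : bool :=
  [forall f, (m f != f) && (m (m f) == f)].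

(* Every pairing of the faces extends to exactly 3 ^ (2 * n) elements of this
   set, so the uniform law on it is that of a uniform pairing followed by
   independent uniform choices of the identifications. *)
Definition gluings n : {set gluing n} :=
  [set g : gluing n | face_pairing g.1 &&
    [forall f : face n, reversing_identification f.2 (g.1 f).2 (g.2 f) &&
                        (g.2 (g.1 f) == (g.2 f)^-1)%g]].

Definition mean (R : numFieldType) n (X : gluing n -> R) : R :=
  ((\sum_(g in gluings n) X g) / #|gluings n|%:R)%R.

(* Edges of the n tetrahedra before gluing: (t, A) with A the set of the two
   end points. *)
Definition tet_edge (n : nat) : finType := ('I_n * {set 'I_4})%type.
Definition tet_edges n : {set tet_edge n} := [set a : tet_edge n | #|a.2| == 2].

Definition glued n (g : gluing n) : rel (tet_edge n) := fun a b =>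
  [exists i : 'I_4, [&& i \notin a.2, b.1 == (g.1 (a.1, i)).1
                      & b.2 == g.2 (a.1, i) @: a.2]].

(* An edge of the complex is the class of all tetrahedron edges identified to
   it; its size #|x| thus counts incident tetrahedra with multiplicity. *)
Definition edges n (g : gluing n) : {set {set tet_edge n}} :=
  equivalence_partition (connect (glued g)) (tet_edges n).

Definition incident n (x : {set tet_edge n}) (t : 'I_n) : bool :=
  [exists a in x, a.1 == t].

Definition simple_edge n (x : {set tet_edge n}) : bool :=
  [forall t : 'I_n, #|[set a in x | a.1 == t]| <= 1].

Definition nb_edges n (g : gluing n) : nat := #|edges g|.

Definition nb_edges_size n (k : nat) (g : gluing n) : nat :=
  #|[set x in edges g | #|x| == k]|.

Definition nb_simple_edges_size n (k : nat) (g : gluing n) : nat :=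
  #|[set x in edges g | simple_edge x & #|x| == k]|.

(* Ordered pairs of distinct edges. *)
Definition nb_edge_pairs n (K L : nat) (g : gluing n) : nat :=
  #|[set p : {set tet_edge n} * {set tet_edge n} |
      [&& p.1 \in edges g, p.2 \in edges g, p.1 != p.2,
          #|p.1| <= K, #|p.2| <= L
        & [exists t, incident p.1 t && incident p.2 t]]]|.

Section Expectations.
Local Open Scope ring_scope.
Variables (R : numFieldType) (n : nat).

Definition EE : R := mean (fun g : gluing n => (nb_edges g)%:R).
Definition EE_size (k : nat) : R :=
  mean (fun g : gluing n => (nb_edges_size k g)%:R).
Definition EE_simple (k : nat) : R :=
  mean (fun g : gluing n => (nb_simple_edges_size k g)%:R).
Definition EE_range (k1 k2 : nat) : R :=
  mean (fun g : gluing n => \sum_(k1 <= l < k2.+1) (nb_edges_size l g)%:R).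
Definition EE_nonsimple (k : nat) : R :=
  mean (fun g : gluing n =>
    (nb_edges_size k g)%:R - (nb_simple_edges_size k g)%:R).
Definition EE_pairs (K L : nat) : R :=
  mean (fun g : gluing n => (nb_edge_pairs K L g)%:R).

End Expectations.

(* Main.v *)
(** Reveal the gluing of a random complex one face at a time, always at one end
    of the open path of tetrahedron edges that is the explored part of an edge of
    the complex.  With M open faces this end is glued to one of 3 (M - 1) equally
    likely flags.  Exactly one of them is the other end of the path and closes
    the edge directly; hence each of the 12 n flags lies on an edge of size k
    with probability about 1 / (6 n), and since an edge of size k has 2 k flags,
    E[E_k] is about 1 / (2 k).

    The error comes from the flags that close the edge indirectly, because the
    explored path runs several times through the same open face.  They exist only
    in the states of positive "danger", which are entered with probability O(1/n)
    per step and left quickly; the potential [self_weight] turns this into an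
    upper bound 1 / (2 k) + O(1/n) valid for k up to a small multiple of n.  Lower
    bounds come from explorations that enter a new tetrahedron at each step, so
    that the edge is simple; as at most k of the n tetrahedra are forbidden, they
    lose a factor 1 - O(k^2 / n).  Two edges through a common tetrahedron are
    explored one after the other, which has probability O(m^3 / n) for sizes at
    most m.

    For (a), edges of size above a multiple of n are bounded by the total size
    6 n, and the lower bound counts an edge through the flags that are alone on
    their face, each weighted by the inverse of the number of faces met by the
    edge: this share tolerates repeated visits and costs only O(1) in total. *)

From HB Require Import structures.
Require Import Defs.
From mathcomp Require Import all_boot all_fingroup all_order all_algebra.
From mathcomp Require Import zify ring lra.

Set Implicit Arguments.
Unset Strict Implicit.
Unset Printing Implicit Defensive.

(** * Components of two involutions *)

(** Conditional laws are replaced by counts: the number of ways to complete a partial gluing depends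
    only on its number of open faces, so revealing one face is an average over the targets of one
    flag. This works because an orientation-reversing identification is an odd permutation of four
    points, determined by the image of a single flag. The obstacle to sizes linear in n is the
    number [s] of flags whose path returns to its own open face. From danger 0 the chance of a
    harmful target is of order (1 + s) / n, and the danger so created costs in turn a multiple of 1
    + s. Hence the second moment of 1 + s has to be controlled, which explains the square in
    [self_weight]. In positive danger [s] may rise at every step; the summand [96 * danger_weight]
    is there to absorb this. The crude bound of [s] by a multiple of the number of glued faces
    suffices only for pairs of edges, where sizes are much smaller. The lower bounds need no
    averaging of [s]: they follow only targets that keep the danger at 0 and do not increase [s], or
    that visit new tetrahedra. *)

Section TwoInvolutions.
Variables (T : finType) (m t : T -> T).
Hypotheses (mK : involutive m) (tK : involutive t).

Definition dihedral : rel T := fun a b => (b == m a) || (b == t a).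

Lemma dihedral_sym : symmetric dihedral.
Proof.
by move=> a b; rewrite /dihedral; congr (_ || _); apply/eqP/eqP=> ->; rewrite ?mK ?tK.
Qed.

Lemma dihedral_closed (S : {set T}) u v :
  (forall a, a \in S -> m a \in S /\ t a \in S) ->
  u \in S -> connect dihedral u v -> v \in S.
Proof.
move=> clS uS /connectP[p pth ->]; elim: p u uS pth => //= b p IH a aS.
case/andP=> ab; apply: IH; have [maS taS] := clS _ aS.
by case/orP: ab => /eqP ->.
Qed.

(* A component on which [t] has no fixed point and which contains a fixed point
   [u] of [m] is the path u, t u, m (t u), ..., which ends at the only other
   fixed point of [m]. *)
Lemma dihedral_two_fixed u :
  m u = u -> (forall v, connect dihedral u v -> t v != v) ->
  exists2 w, [/\ w != u, m w = w & connect dihedral u w] &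
    forall v, connect dihedral u v -> m v = v -> v = u \/ v = w.
Proof.
move=> mu tfree; pose a i := iter i (m \o t) u; pose b i := t (a i).
have aS i : a i.+1 = m (b i) by [].
have conn_a i : connect dihedral u (a i).
  elim: i => [|i IH]; first exact: connect0.
  apply: connect_trans IH _; apply: (@connect_trans _ _ (b i)).
    by apply: connect1; rewrite /dihedral eqxx orbT.
  by apply: connect1; rewrite /dihedral aS eqxx.
have conn_b i : connect dihedral u (b i).
  apply: connect_trans (conn_a i) _.
  by apply: connect1; rewrite /dihedral eqxx orbT.
(* The composite [m \o t] is injective, so [u] is periodic under it; just before the return, [b]
   takes the value [m u = u], a fixed point of [m]. *)
have exb : exists i, m (b i) == b i.
  have inj : injective (m \o t).
    by apply: inj_comp; apply: inv_inj.
  have ord_gt0 : 0 < fingraph.order (m \o t) u by exact: fingraph.order_gt0.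
  exists (fingraph.order (m \o t) u).-1; apply/eqP.
  have : a (fingraph.order (m \o t) u) = u by exact: fingraph.iter_order inj u.
  rewrite -(prednK ord_gt0) aS => E.
  by rewrite E -[RHS]mK E mu.
case: (ex_minnP exb) => i /eqP mbi mini.
pose S := [set v | [exists j : 'I_i.+1, (v == a j) || (v == b j)]].
have inS_a j : j <= i -> a j \in S.
  move=> ji; rewrite inE; apply/existsP.
  by exists (Ordinal (ji : j < i.+1)); rewrite eqxx.
have inS_b j : j <= i -> b j \in S.
  move=> ji; rewrite inE; apply/existsP.
  by exists (Ordinal (ji : j < i.+1)); rewrite eqxx orbT.
have clS v : v \in S -> m v \in S /\ t v \in S.
  rewrite inE => /existsP[[j ji] /= /orP[] /eqP ->]; split.
  - case: j ji => [|j] ji; first by rewrite [a 0]/= mu; apply: (inS_a 0).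
    by rewrite aS mK; apply: inS_b; lia.
  - by apply: inS_b.
  - have [ij|ij] := ltnP j i; first by rewrite -aS; apply: inS_a.
    have -> : j = i by lia.
    by rewrite mbi; apply: inS_b.
  - by rewrite /b tK; apply: inS_a.
have inS v : connect dihedral u v -> v \in S.
  by apply: dihedral_closed clS (inS_a 0 _).
exists (b i).
  split=> //; apply/negP=> /eqP bu.
  (* If the path came back to [u] it would be a palindrome, whose middle is a
     fixed point of [t], or of [m] before the first one. *)
  have pal j : j <= i -> a (i - j) = b j.
    elim: j => [|j IH] ji; first by rewrite subn0 /b [a 0]/= -bu /b tK.
    have := congr1 m (IH (ltnW ji)).
    have -> : i - j = (i - j.+1).+1 by lia.
    by rewrite (aS (i - j.+1)) mK -(aS j) => E; rewrite [RHS]/b -E /b tK.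
  have := odd_double_half i; case: (odd i) => /= E.
    have := pal i./2; have -> : i - i./2 = (i./2).+1 by lia.
    by rewrite aS => h; have := mini i./2; rewrite h ?eqxx; lia.
  have := pal i./2; have -> : i - i./2 = i./2 by lia.
  move=> h; have /eqP := tfree _ (conn_a i./2); apply.
  by rewrite -/(b _) -h //; lia.
move=> v /inS; rewrite inE => /existsP[[j ji] /= /orP[] /eqP ->] mv.
  case: j ji mv => [|j] ji mv; first by left.
  move: mv; rewrite aS mK => mv; have := mini j.
  by rewrite -mv eqxx => /(_ isT); lia.
by right; congr b; have := mini j; rewrite mv eqxx => /(_ isT); lia.
Qed.

End TwoInvolutions.

(** * Flags and partial gluings *)

Section Identifications.
Local Open Scope group_scope.

Lemma reversing_identificationE (i j : 'I_4) (s : 'S_4) :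
  reversing_identification i j s = (s i == j) && odd_perm s.
Proof.
rewrite /reversing_identification; congr (_ && _).
apply/forallP/idP => [/(_ (tperm ord0 i))|os p].
  by rewrite tpermL eqxx odd_permM /=; case: (odd_perm s) (odd_perm _) => [] [].
by apply/implyP=> _; rewrite odd_permM os; case: (odd_perm p).
Qed.

(** The quotient of the two permutations is even and fixes two of the four points; the only
    nontrivial permutation of the other two is a transposition, which is odd. *)
Lemma perm4_inj (s s' : 'S_4) i j :
  i != j -> odd_perm s = odd_perm s' -> s i = s' i -> s j = s' j -> s = s'.
Proof.
move=> ij os si sj; apply/eqP; rewrite eq_mulVg1; apply/eqP.
set p := s^-1 * s'.
have op : odd_perm p = false by rewrite /p odd_permM odd_permV os; case: odd_perm.
have fixp k : s k = s' k -> p (s k) = s k by move=> E; rewrite /p permM permK E.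
have [[pi pj] sij] : (p (s i) = s i /\ p (s j) = s j) /\ s i != s j.
  by rewrite !fixp // (inj_eq perm_inj).
move: (s i) (s j) pi pj sij => a b pa pb ab.
have [c [d [ac bc cd cov]]] : exists c d : 'I_4,
    [/\ a != c /\ a != d, b != c /\ b != d, c != d &
      forall e, [|| e == a, e == b, e == c | e == d]].
  have cB : #|~: [set a; b]| = 2 by have := cardsC [set a; b]; rewrite cards2 ab card_ord; lia.
  have /cards2P[c [d [cd E]]] : #|~: [set a; b]| == 2 by rewrite cB.
  have inE' e : (e == c) || (e == d) = ~~ ((e == a) || (e == b)).
    by have /setP/(_ e) := E; rewrite !inE => <-.
  exists c, d; split=> //.
  - have := inE' c; have := inE' d; rewrite !eqxx orbT /= => /esym + /esym.
    by rewrite !negb_or => /andP[+ _] /andP[+ _]; rewrite ![a == _]eq_sym => -> ->.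
  - have := inE' c; have := inE' d; rewrite !eqxx orbT /= => /esym + /esym.
    by rewrite !negb_or => /andP[_ +] /andP[_ +]; rewrite ![b == _]eq_sym => -> ->.
  by move=> e; rewrite orbA inE' orbN.
have pc : p c = c \/ p c = d.
  have := cov (p c); case/or4P => /eqP E; [| |by left|by right].
    by case: ac => /eqP[]; apply: (@perm_inj _ p); rewrite pa E.
  by case: bc => /eqP[]; apply: (@perm_inj _ p); rewrite pb E.
case: pc => pc.
  have pd : p d = d.
    have := cov (p d); case/or4P => /eqP E //.
    - by case: ac => _ /eqP[]; apply: (@perm_inj _ p); rewrite pa E.
    - by case: bc => _ /eqP[]; apply: (@perm_inj _ p); rewrite pb E.
    - by case/eqP: cd; apply: (@perm_inj _ p); rewrite pc E.
  by apply/permP=> e; rewrite perm1; case/or4P: (cov e) => /eqP->.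
have pd : p d = c.
  have := cov (p d); case/or4P => /eqP E //.
  - by case: ac => _ /eqP[]; apply: (@perm_inj _ p); rewrite pa E.
  - by case: bc => _ /eqP[]; apply: (@perm_inj _ p); rewrite pb E.
  - by case/eqP: cd; apply: (@perm_inj _ p); rewrite pc E.
have : p = tperm c d.
  apply/permP=> e; case/or4P: (cov e) => /eqP->; rewrite ?tpermL ?tpermR //.
    by rewrite tpermD // eq_sym; case: ac.
  by rewrite tpermD // eq_sym; case: bc.
by move=> pE; move: op; rewrite pE odd_tperm cd.
Qed.

(** A wrong parity is corrected by swapping the two points other than [j] and [j']. *)
Lemma exists_odd_perm4 (i i' j j' : 'I_4) : i' != i -> j' != j ->
  exists s : 'S_4, [/\ odd_perm s, s i = j & s i' = j'].
Proof.
move=> ii jj.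
have [s [si si']] : exists s : 'S_4, s i = j /\ s i' = j'.
  have sj : tperm i j i' != j by rewrite -{2}(tpermL i j) (inj_eq perm_inj).
  exists (tperm i j * tperm (tperm i j i') j').
  by rewrite !permM !tpermL (tpermD sj jj).
case os : (odd_perm s); first by exists s.
have : #|~: [set j; j']| == 2.
  by have := cardsC [set j; j']; rewrite cards2 eq_sym jj card_ord; lia.
case/cards2P=> c [d [cd E]].
have out e : e \in [set c; d] -> (e != j) && (e != j').
  by rewrite -E !inE negb_or.
have /andP[cj cj'] := out c (set21 c d); have /andP[dj dj'] := out d (set22 c d).
exists (s * tperm c d); rewrite !permM si si' !tpermD // odd_permM os odd_tperm.
by rewrite cd.
Qed.

Definition glue_perm (i i' j j' : 'I_4) : 'S_4 :=
  odflt 1 [pick s : 'S_4 | [&& odd_perm s, s i == j & s i' == j']].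

Lemma glue_permP (i i' j j' : 'I_4) : i' != i -> j' != j ->
  [/\ odd_perm (glue_perm i i' j j'), glue_perm i i' j j' i = j
    & glue_perm i i' j j' i' = j'].
Proof.
move=> ii jj; rewrite /glue_perm; case: pickP => [s /and3P[? /eqP ? /eqP ?] //|h].
have [s [os si si']] := exists_odd_perm4 ii jj.
by have := h s; rewrite os si si' !eqxx.
Qed.

End Identifications.

(* The flag ((t, i), i') is the edge of tetrahedron t opposite to the edge {i, i'}, seen
   in the face opposite to i; it is degenerate when i = i'. *)
Definition flag (n : nat) : finType := (face n * 'I_4)%type.

Section FlagMoves.
Variable n : nat.
Implicit Types (g : gluing n) (u : flag n) (f : face n).

Definition proper_flag u : bool := u.2 != u.1.2.
(** [turn] passes to the other face of the tetrahedron that contains the same edge, and [cross] to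
    the other side of the face. Alternating these two involutions is walking around an edge of the
    complex. *)
Definition turn u : flag n := ((u.1.1, u.2), u.1.2).
Definition cross g u : flag n := (g.1 u.1, g.2 u.1 u.2).
Definition face_flags f : {set flag n} := [set u | (u.1 == f) && proper_flag u].
Definition open g f : bool := g.1 f == f.

End FlagMoves.

(* Partial gluings are elements of [gluing n] too: the unglued ("open") faces
   are the fixed points of g.1.  The notions below are locked because comparing
   two instances of them by computation does not terminate in practice. *)
HB.lock Definition partial_gluing n (g : gluing n) : bool :=
  [forall f, [&& g.1 (g.1 f) == f, g.2 (g.1 f) == (g.2 f)^-1%g &
    if g.1 f == f then g.2 f == 1%g
    else reversing_identification f.2 (g.1 f).2 (g.2 f)]].

HB.lock Definition linked n (g : gluing n) : rel (flag n) :=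
  connect (dihedral (cross g) (@turn n)).

HB.lock Definition edge_flags n (g : gluing n) (u : flag n) : {set flag n} :=
  [set v | linked g u v].

(* The other end of the path of [u], when [u] lies on an open face. *)
HB.lock Definition partner n (g : gluing n) (u : flag n) : flag n :=
  odflt u [pick v | [&& v != u, open g v.1 & linked g u v]].

(* [x] becomes glued to [y]. *)
HB.lock Definition extend n (g : gluing n) (x y : flag n) : gluing n :=
  let s := glue_perm x.1.2 x.2 y.1.2 y.2 in
  ([ffun f => if f == x.1 then y.1 else if f == y.1 then x.1 else g.1 f],
   [ffun f => if f == x.1 then s else if f == y.1 then s^-1%g else g.2 f]).

Section Flags.
Variable n : nat.
Implicit Types (g h : gluing n) (u v w x y z : flag n) (f : face n).

Lemma card_face_flags f : #|face_flags f| = 3.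
Proof.
have -> : face_flags f = [set (f, i) | i in [set~ f.2]].
  apply/setP=> u; rewrite inE; apply/andP/imsetP => [[/eqP uf pu]|[i]].
    by exists u.2; rewrite ?inE; [move: pu; rewrite /proper_flag uf|rewrite -uf; case: (u)].
  by rewrite !inE => fi ->; rewrite /proper_flag /= eqxx.
rewrite card_imset; last by move=> i j [].
by rewrite cardsC1 card_ord.
Qed.

Lemma turnK : involutive (@turn n).
Proof. by case=> [[t i] i']. Qed.

Lemma proper_turn u : proper_flag (turn u) = proper_flag u.
Proof. by rewrite /proper_flag /= eq_sym. Qed.

Lemma turn_face u : proper_flag u -> (turn u).1 != u.1.
Proof. by case: u => [[t i] i'] /=; rewrite /proper_flag /= xpair_eqE eqxx. Qed.

Section Partial.
Variable g : gluing n.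
Hypothesis pg : partial_gluing g.

Lemma pg_faceK f : g.1 (g.1 f) = f.
Proof. by move: pg; rewrite unlock => /forallP/(_ f)/and3P[/eqP]. Qed.

Lemma pg_permV f : g.2 (g.1 f) = (g.2 f)^-1%g.
Proof. by move: pg; rewrite unlock => /forallP/(_ f)/and3P[_ /eqP]. Qed.

Lemma pg_open1 f : open g f -> g.2 f = 1%g.
Proof.
move: pg; rewrite unlock => /forallP/(_ f)/and3P[_ _].
by rewrite /open => + fo; rewrite fo => /eqP.
Qed.

Lemma pg_rev f : ~~ open g f -> reversing_identification f.2 (g.1 f).2 (g.2 f).
Proof. by move: pg; rewrite unlock /open => /forallP/(_ f)/and3P[_ _]; case: ifP. Qed.

Lemma pg_perm f : g.2 f f.2 = (g.1 f).2.
Proof.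
have [fo|fo] := boolP (open g f).
  by rewrite (pg_open1 fo) perm1 (eqP fo).
by have := pg_rev fo; rewrite reversing_identificationE => /andP[/eqP].
Qed.

Lemma crossK : involutive (cross g).
Proof. by case=> f i; rewrite /cross /= pg_faceK pg_permV permK. Qed.

Lemma proper_cross u : proper_flag (cross g u) = proper_flag u.
Proof. by rewrite /proper_flag /= -pg_perm (inj_eq perm_inj). Qed.

(** The convention [g.2 f = 1] on open faces serves this purpose: the ends of a path become the
    fixed points of one of the two involutions. *)
Lemma cross_open u : open g u.1 -> cross g u = u.
Proof.
by move=> uo; rewrite /cross (pg_open1 uo) perm1 (eqP uo) -surjective_pairing.
Qed.

Lemma cross_fixed u : proper_flag u -> (cross g u == u) = open g u.1.
Proof.
move=> pu; apply/eqP/idP => [E|/cross_open //].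
by rewrite /open -{2}E.
Qed.

End Partial.

Lemma linked_refl g u : linked g u u.
Proof. by rewrite unlock; exact: connect0. Qed.

Lemma linked_trans g : transitive (linked g).
Proof. by rewrite unlock; exact: connect_trans. Qed.

Lemma linked_turn g u : linked g u (turn u).
Proof. by rewrite unlock; apply: connect1; rewrite /dihedral eqxx orbT. Qed.

Lemma linked_cross g u : linked g u (cross g u).
Proof. by rewrite unlock; apply: connect1; rewrite /dihedral eqxx. Qed.

Lemma linked_ind g (S : {set flag n}) u v :
  (forall a, a \in S -> cross g a \in S /\ turn a \in S) ->
  u \in S -> linked g u v -> v \in S.
Proof. by rewrite [linked]unlock; apply: dihedral_closed. Qed.

Lemma mem_edge_flags g u v : (v \in edge_flags g u) = linked g u v.
Proof. by rewrite [edge_flags]unlock inE. Qed.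

Lemma linked_sym g : partial_gluing g -> symmetric (linked g).
Proof.
by move=> pg; rewrite unlock; apply: sym_connect_sym; apply: dihedral_sym; [exact: crossK|exact: turnK].
Qed.

Lemma linked_proper g u v : partial_gluing g -> linked g u v -> proper_flag v = proper_flag u.
Proof.
move=> pg uv; have [pu|npu] := boolP (proper_flag u).
  have : v \in [set w | proper_flag w].
    apply: (linked_ind _ _ uv); rewrite ?inE // => a.
    by rewrite !inE proper_cross // proper_turn.
  by rewrite inE.
have : v \in [set w | ~~ proper_flag w].
  apply: (linked_ind _ _ uv); rewrite ?inE // => a.
  by rewrite !inE proper_cross // proper_turn.
by rewrite inE => /negbTE.
Qed.

Section Partner.
Variable g : gluing n.
Hypothesis pg : partial_gluing g.

Lemma two_open_ends u : proper_flag u -> open g u.1 ->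
  exists2 w, [/\ w != u, open g w.1 & linked g u w] &
    forall v, linked g u v -> open g v.1 -> v = u \/ v = w.
Proof.
move=> pu uo.
rewrite [linked]unlock.
have tf v : connect (dihedral (cross g) (@turn n)) u v -> turn v != v.
  move=> uv; have {}uv : linked g u v by rewrite unlock.
  apply/eqP=> tv; have := linked_proper pg uv; rewrite pu => pv.
  by have := turn_face pv; rewrite tv eqxx.
have [w [wu cw uw] H] := dihedral_two_fixed (crossK pg) turnK (cross_open pg uo) tf.
exists w.
  have {}uw : linked g u w by rewrite unlock.
  by split=> //; rewrite -?(cross_fixed pg) ?cw ?(linked_proper pg uw) //; move: uw; rewrite unlock.
by move=> v uv vo; apply: H => //; apply: cross_open.
Qed.

Lemma partnerP u : proper_flag u -> open g u.1 ->
  [/\ partner g u != u, open g (partner g u).1 & linked g u (partner g u)].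
Proof.
move=> pu uo; have [w [wu wo uw] _] := two_open_ends pu uo.
rewrite [partner]unlock; case: pickP => [v /and3P[? ? ?] //|/(_ w)].
by rewrite wu wo uw.
Qed.

Lemma partner_uniq u v : proper_flag u -> open g u.1 ->
  linked g u v -> open g v.1 -> v != u -> v = partner g u.
Proof.
move=> pu uo uv vo vu; have [w _ H] := two_open_ends pu uo.
have [ptu pto upt] := partnerP pu uo.
case: (H _ uv vo) => [/eqP|->]; first by rewrite (negbTE vu).
by case: (H _ upt pto) => [/eqP|-> //]; rewrite (negbTE ptu).
Qed.

Lemma partner_proper u : proper_flag u -> open g u.1 -> proper_flag (partner g u).
Proof. by move=> pu uo; have [_ _ h] := partnerP pu uo; rewrite (linked_proper pg h). Qed.

Lemma partner_open u : proper_flag u -> open g u.1 -> open g (partner g u).1.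
Proof. by move=> pu uo; case: (partnerP pu uo). Qed.

Lemma partner_linked u : proper_flag u -> open g u.1 -> linked g u (partner g u).
Proof. by move=> pu uo; case: (partnerP pu uo). Qed.

Lemma partner_neq u : proper_flag u -> open g u.1 -> partner g u != u.
Proof. by move=> pu uo; case: (partnerP pu uo). Qed.

Lemma partnerK u : proper_flag u -> open g u.1 -> partner g (partner g u) = u.
Proof.
move=> pu uo; have [ptu pto upt] := partnerP pu uo.
by apply/esym/partner_uniq=> //; [exact: partner_proper|rewrite linked_sym|rewrite eq_sym].
Qed.

Lemma partner_inj u v : proper_flag u -> open g u.1 -> proper_flag v -> open g v.1 ->
  partner g u = partner g v -> u = v.
Proof. by move=> pu uo pv vo E; rewrite -(partnerK pu uo) E partnerK. Qed.

End Partner.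

Definition extension g h : Prop :=
  forall f, ~~ open g f -> h.1 f = g.1 f /\ h.2 f = g.2 f.

Lemma extension_cross g h u : extension g h -> ~~ open g u.1 -> cross h u = cross g u.
Proof. by move=> gh uo; have [h1 h2] := gh _ uo; rewrite /cross h1 h2. Qed.

Lemma linked_extension g h u v : partial_gluing g -> extension g h ->
  linked g u v -> linked h u v.
Proof.
move=> pg gh; rewrite [linked]unlock; apply: connect_sub => a b /orP[] /eqP ->.
  have [ao|ao] := boolP (open g a.1); first by rewrite cross_open // connect0.
  by rewrite -(extension_cross gh ao); have := linked_cross h a; rewrite unlock.
by have := linked_turn h a; rewrite unlock.
Qed.

End Flags.

Section Extensions.
Variable n : nat.
Implicit Types (g h : gluing n) (u v w x y z : flag n) (f : face n).

Lemma edge_flags_closed g h u : partial_gluing g -> extension g h ->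
  (forall v, linked g u v -> ~~ open g v.1) -> edge_flags h u = edge_flags g u.
Proof.
move=> pg gh cl; apply/setP=> v; rewrite [LHS]mem_edge_flags [RHS]mem_edge_flags.
apply/idP/idP; last exact: linked_extension.
move=> uv; have : v \in edge_flags g u.
  apply: linked_ind uv; last by rewrite mem_edge_flags linked_refl.
  move=> a; rewrite !mem_edge_flags => ua; rewrite (extension_cross gh (cl _ ua)); split.
    by apply: linked_trans ua (linked_cross _ _).
  by apply: linked_trans ua (linked_turn _ _).
by rewrite mem_edge_flags.
Qed.

Section Extend.
Variables (g : gluing n) (x y : flag n).
Hypotheses (pg : partial_gluing g) (px : proper_flag x) (py : proper_flag y).
Hypotheses (xo : open g x.1) (yo : open g y.1) (yx : y.1 != x.1).

Let s := glue_perm x.1.2 x.2 y.1.2 y.2.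

Lemma extend_partial : partial_gluing (extend g x y).
Proof.
have [os sx sx2] := glue_permP px py; rewrite -/s in os sx sx2.
have opn f : f != x.1 -> f != y.1 -> (g.1 f == x.1 = false) * (g.1 f == y.1 = false).
  move=> fx fy; split; apply/negbTE/eqP => E.
    by move: fx; rewrite -(pg_faceK pg f) E (eqP xo) eqxx.
  by move: fy; rewrite -(pg_faceK pg f) E (eqP yo) eqxx.
rewrite [partial_gluing]unlock [extend]unlock; apply/forallP=> f; rewrite /= !ffunE.
have [->|fx] := eqVneq f x.1.
  by rewrite !(eqxx, negbTE yx) /= reversing_identificationE sx eqxx os.
have [->|fy] := eqVneq f y.1.
  rewrite !(eqxx, invgK) eq_sym (negbTE yx) /= reversing_identificationE odd_permV os.
  by rewrite andbT; apply/eqP/(@perm_inj _ s); rewrite permKV sx.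
rewrite !opn //; by move: pg; rewrite unlock => /forallP; apply.
Qed.

Lemma extend_cross_x : cross (extend g x y) x = y.
Proof.
have [_ _ sx2] := glue_permP px py.
by rewrite /cross [extend]unlock /= !ffunE eqxx sx2 -surjective_pairing.
Qed.

Lemma extend_cross_y : cross (extend g x y) y = x.
Proof. by rewrite -{2}extend_cross_x (crossK extend_partial). Qed.

Lemma extend_face_x u : u.1 = x.1 -> (cross (extend g x y) u).1 = y.1.
Proof. by move=> ux; rewrite [extend]unlock /= !ffunE ux eqxx. Qed.

Lemma extend_face_y u : u.1 = y.1 -> (cross (extend g x y) u).1 = x.1.
Proof. by move=> uy; rewrite [extend]unlock /= !ffunE uy (negbTE yx) eqxx. Qed.

Lemma extend_cross_other u : u.1 != x.1 -> u.1 != y.1 -> cross (extend g x y) u = cross g u.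
Proof. by move=> ux uy; rewrite /cross [extend]unlock /= !ffunE (negbTE ux) (negbTE uy). Qed.

Lemma extend_open f : open (extend g x y) f = [&& f != x.1, f != y.1 & open g f].
Proof.
rewrite /open [extend]unlock /= ffunE; have [->|fx] := eqVneq f x.1; first by rewrite (negbTE yx).
by have [->|fy] := eqVneq f y.1; rewrite // eq_sym (negbTE yx).
Qed.

Lemma extend_extension : extension g (extend g x y).
Proof.
move=> f fo; rewrite [extend]unlock /= !ffunE.
have [fx|fx] := eqVneq f x.1; first by rewrite fx xo in fo.
by have [fy|fy] := eqVneq f y.1; first by rewrite fy yo in fo.
Qed.

End Extend.

(** Each of the three flags of the glued face, not only [x], determines the target by its image.
    Harmful targets can therefore be counted through whichever flag of the face does the harm. *)
Lemma extend_cross_inj g x y y' u : partial_gluing g ->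
  proper_flag x -> proper_flag y -> proper_flag y' -> proper_flag u -> u.1 = x.1 ->
  cross (extend g x y) u = cross (extend g x y') u -> y = y'.
Proof.
move=> pg px py py' pu ux.
have [os sx sx2] := glue_permP px py; have [os' sx' sx2'] := glue_permP px py'.
rewrite /cross [extend]unlock /= !ffunE ux eqxx => -[E1 E2].
have E3 : glue_perm x.1.2 x.2 y.1.2 y.2 = glue_perm x.1.2 x.2 y'.1.2 y'.2.
  apply: (@perm4_inj _ _ x.1.2 u.2 _ _ _ E2); rewrite ?os ?os' ?sx ?sx' ?E1 //.
  by move: pu; rewrite /proper_flag ux eq_sym.
by move: sx2; rewrite E3 sx2' => E4; case: (y) (y') E1 E4 => [a b] [c d] /= -> ->.
Qed.

End Extensions.

(** * Completions of a partial gluing *)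

HB.lock Definition nb_open n (g : gluing n) := #|[set f | open g f]|.
HB.lock Definition nb_glued n (g : gluing n) := #|[set f | ~~ open g f]|.

HB.lock Definition targets n (g : gluing n) (x : flag n) : {set flag n} :=
  [set y | [&& proper_flag y, open g y.1 & y.1 != x.1]].

HB.lock Definition completions n (g : gluing n) : {set gluing n} :=
  [set h in gluings n |
    [forall f, ~~ open g f ==> (h.1 f == g.1 f) && (h.2 f == g.2 f)]].

Section Completions.
Variable n : nat.
Implicit Types (g h : gluing n) (u v w x y z : flag n) (f : face n).

Lemma card_flags_over (S : {set face n}) :
  #|[set u : flag n | proper_flag u & u.1 \in S]| = 3 * #|S|.
Proof.
rewrite -sum1_card (partition_big (fun u : flag n => u.1) (mem S)) /=; last first.
  by move=> u; rewrite inE => /andP[].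
rewrite (eq_bigr (fun=> 3)); first by rewrite sum_nat_const mulnC.
move=> f fS; transitivity #|face_flags f|; last exact: card_face_flags.
rewrite -sum1_card; apply: eq_bigl => u.
by rewrite !inE; case: eqP => [->|]; rewrite ?fS ?andbT ?andbF.
Qed.

Lemma nb_open_glued g : nb_open g + nb_glued g = 4 * n.
Proof.
rewrite [nb_open]unlock [nb_glued]unlock.
have := cardsC [set f | open g f]; rewrite card_prod !card_ord mulnC => <-.
by congr (_ + #|pred_of_set _|); apply/setP=> f; rewrite !inE.
Qed.

Lemma targetsP g x y : reflect [/\ proper_flag y, open g y.1 & y.1 != x.1] (y \in targets g x).
Proof. by rewrite [targets]unlock inE; apply: and3P. Qed.

Lemma card_targets g x : open g x.1 -> #|targets g x| = 3 * (nb_open g).-1.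
Proof.
move=> xo; have -> : (nb_open g).-1 = #|[set f | open g f] :\ x.1|.
  by rewrite [nb_open]unlock (cardsD1 x.1) inE xo.
rewrite -card_flags_over [targets]unlock; congr #|pred_of_set _|; apply/setP=> u.
by rewrite !inE [(_ != _) && _]andbC.
Qed.

Lemma nb_open_extend g x y : open g x.1 -> y \in targets g x ->
  nb_open g = (nb_open (extend g x y)).+2.
Proof.
move=> xo /targetsP[_ yo yx]; rewrite [nb_open]unlock (cardsD1 x.1) inE xo.
rewrite (cardsD1 y.1 (_ :\ _)) !inE yo yx /= !addnA.
congr (_.+2); apply: eq_card => f; rewrite !inE extend_open //.
by rewrite andbCA.
Qed.

Lemma completionsP g h : reflect (h \in gluings n /\ extension g h) (h \in completions g).
Proof.
rewrite [completions]unlock [_ \in [set _ in _ | _]]inE; apply: (iffP andP) => -[hG H]; split=> //.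
  by move=> f fo; have /forallP/(_ f) := H; rewrite fo => /andP[/eqP ? /eqP ?].
by apply/forallP=> f; apply/implyP=> /H[-> ->]; rewrite !eqxx.
Qed.

Lemma gluingsE g : (g \in gluings n) = partial_gluing g && [forall f, ~~ open g f].
Proof.
rewrite inE; apply/andP/andP => [[/forallP fp /forallP H]|[pg /forallP cl]].
  split; last by apply/forallP=> f; have /andP[] := fp f.
  rewrite [partial_gluing]unlock; apply/forallP=> f; have /andP[/negbTE-> ->] := fp f.
  by have /andP[-> ->] := H f.
split; apply/forallP=> f; first by rewrite pg_faceK // eqxx andbT; apply: cl.
by rewrite pg_rev //= pg_permV.
Qed.

Lemma gluings_partial g : g \in gluings n -> partial_gluing g.
Proof. by rewrite gluingsE => /andP[]. Qed.

Lemma gluings_closed g f : g \in gluings n -> ~~ open g f.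
Proof. by rewrite gluingsE => /andP[_ /forallP]. Qed.

Lemma completions_full g : partial_gluing g -> nb_open g = 0 -> completions g = [set g].
Proof.
move=> pg /eqP; rewrite [nb_open]unlock cards_eq0 => /eqP/setP cl.
have ncl f : ~~ open g f by have := cl f; rewrite !inE => ->.
apply/setP=> h; rewrite in_set1; apply/completionsP/eqP => [[_ H]|->].
  case: h g H ncl {pg cl} => [h1 h2] [g1 g2] H ncl.
  by congr (_, _); apply/ffunP=> f; have /= [] := H f (ncl f).
by split=> //; rewrite gluingsE pg; apply/forallP.
Qed.

Lemma completion_target g h x : partial_gluing g -> proper_flag x -> open g x.1 ->
  h \in completions g -> cross h x \in targets g x /\ h \in completions (extend g x (cross h x)).
Proof.
move=> pg px xo /completionsP[hG gh]; have ph := gluings_partial hG.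
have yo : open g (cross h x).1.
  apply/negPn/negP=> yc; have [E _] := gh _ yc.
  have hx : h.1 x.1 = g.1 x.1 by rewrite -(pg_faceK pg (h.1 x.1)) -E /= pg_faceK.
  by have := gluings_closed x.1 hG; rewrite /open hx [_ == _]xo.
have yx : (cross h x).1 != x.1 by exact: gluings_closed.
have py : proper_flag (cross h x) by rewrite proper_cross.
split; first by apply/targetsP.
have [os sx sx2] := glue_permP px py.
have permE : h.2 x.1 = glue_perm x.1.2 x.2 (cross h x).1.2 (cross h x).2.
  apply: (@perm4_inj _ _ x.1.2 x.2); first by rewrite eq_sym.
  - rewrite os; have := pg_rev ph (gluings_closed x.1 hG).
    by rewrite reversing_identificationE => /andP[].
  - by rewrite sx pg_perm.
  by rewrite sx2.
apply/completionsP; split=> // f; rewrite extend_open // [extend]unlock /= !ffunE.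
have [->|fx] /= := eqVneq f x.1; first by move=> _; split=> //; exact: permE.
have [->|fy] /= := eqVneq f (cross h x).1; last by move=> /gh.
by move=> _; rewrite pg_faceK // pg_permV //; split=> //; congr (_^-1)%g; exact: permE.
Qed.

Lemma completions_extend g h x y : partial_gluing g -> proper_flag x -> open g x.1 ->
  y \in targets g x -> h \in completions (extend g x y) -> h \in completions g /\ cross h x = y.
Proof.
move=> pg px xo /targetsP[py yo yx] /completionsP[hG eh]; split.
  apply/completionsP; split=> // f fo.
  have [<- <-] := extend_extension xo yo fo.
  by apply: eh; rewrite extend_open // (negbTE fo) !andbF.
rewrite (extension_cross eh) ?extend_cross_x //.
by rewrite extend_open // eqxx.
Qed.

(** The law of total probability for revealing the face of [x], before normalisation. *)
Lemma sum_completions (V : nmodType) (X : gluing n -> V) g x :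
  partial_gluing g -> proper_flag x -> open g x.1 ->
  (\sum_(h in completions g) X h =
   \sum_(y in targets g x) \sum_(h in completions (extend g x y)) X h)%R.
Proof.
move=> pg px xo; rewrite (partition_big (fun h => cross h x) (mem (targets g x))) /=.
  apply: eq_bigr => y yY; apply: eq_bigl => h; apply/andP/idP.
    by case=> hC /eqP <-; case: (completion_target pg px xo hC).
  by move=> /(completions_extend pg px xo yY)[-> ->].
by move=> h /(completion_target pg px xo)[].
Qed.

(** An open face has three flags on each of the [k.+1] other open faces to choose from; an odd
    number of faces cannot be paired. *)
Fixpoint nb_completions m :=
  match m with 0 => 1 | 1 => 0 | k.+2 => 3 * k.+1 * nb_completions k end.

Lemma card_completions g : partial_gluing g -> #|completions g| = nb_completions (nb_open g).
Proof.
have [m] := ubnP (nb_open g); elim: m g => // m IH g mg pg.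
have [g0|] := eqVneq (nb_open g) 0; first by rewrite completions_full // cards1 g0.
rewrite {1}[nb_open]unlock cards_eq0 => /set0Pn[f]; rewrite inE => fo.
have : 0 < #|face_flags f| by rewrite card_face_flags.
move=> /card_gt0P[x]; rewrite inE => /andP[/eqP xf px].
have xo : open g x.1 by rewrite xf.
rewrite -sum1_card (sum_completions _ pg px xo).
case E: (nb_open g) => [|[|k]].
- by move: E; rewrite [nb_open]unlock => /card0_eq/(_ f); rewrite !inE fo.
- rewrite big_pred0 // => y; apply: (card0_eq (A := targets g x)).
  by rewrite card_targets // E.
rewrite (eq_bigr (fun=> nb_completions k)) /=.
  by rewrite sum_nat_const card_targets // E.
move=> y yY; have := nb_open_extend xo yY; rewrite E => -[kE].
have /targetsP[py yo yx] := yY.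
rewrite sum1_card IH -?kE //; last exact: extend_partial.
by move: mg; rewrite E; lia.
Qed.

Definition unglued : gluing n := ([ffun f => f], [ffun=> 1%g]).

Lemma unglued_open f : open unglued f. Proof. by rewrite /open ffunE. Qed.

Lemma unglued_partial : partial_gluing unglued.
Proof. by rewrite unlock; apply/forallP=> f; rewrite /unglued /= !ffunE !eqxx invg1 eqxx. Qed.

Lemma completions_unglued : completions unglued = gluings n.
Proof.
apply/setP=> h; apply/completionsP/idP => [[]//|hG].
by split=> // f; rewrite unglued_open.
Qed.

Lemma nb_open_unglued : nb_open unglued = 4 * n.
Proof.
rewrite -(nb_open_glued unglued) -[LHS]addn0; congr (_ + _); apply/esym/eqP.
by rewrite [nb_glued]unlock cards_eq0; apply/eqP/setP=> f; rewrite !inE unglued_open.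
Qed.

Lemma nb_completions_even_gt0 m : 0 < nb_completions m.*2.
Proof. by elim: m => // m IH; rewrite doubleS /= muln_gt0 IH andbT. Qed.

Lemma card_gluings : #|gluings n| = nb_completions (4 * n).
Proof. by rewrite -completions_unglued card_completions ?unglued_partial // nb_open_unglued. Qed.

Lemma card_gluings_gt0 : 0 < #|gluings n|.
Proof.
rewrite card_gluings (_ : 4 * n = (2 * n).*2) ?nb_completions_even_gt0 //.
by rewrite -mul2n mulnA.
Qed.

End Completions.

(** * One step of the exploration of an edge *)

(** A path with both ends on one face can send an exploration back to a face that is being glued;
    the number of such flags controls the number of harmful targets. *)
HB.lock Definition self_flags n (g : gluing n) : {set flag n} :=
  [set u | [&& proper_flag u, open g u.1 & (partner g u).1 == u.1]].

(* 2: both ends of the edge of [x] lie on the face of [x];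
   1: another flag of the face of [x] leads back to that face, or to the face
      of the other end of the edge of [x];
   0: none of this happens, so that gluing the face of [x] can close the edge
      of [x] in only one way. *)
HB.lock Definition danger n (g : gluing n) (x : flag n) : nat :=
  if (partner g x).1 == x.1 then 2
  else [exists u in face_flags x.1,
         ((partner g u).1 == x.1) || (u != x) && ((partner g u).1 == (partner g x).1)].

HB.lock Definition closed_edge n (g : gluing n) (x : flag n) : bool := [forall v, linked g x v ==> ~~ open g v.1].

Section Steps.
Variable n : nat.
Implicit Types (g h : gluing n) (u v w x y z : flag n) (f : face n).

(** Usually the other end [z] is kept and its new partner is explored next. If the face of [z] has
    just been glued too, any open flag of the edge serves; the default [x] does not occur unless the
    edge is closed. *)
Definition next_end g x y : flag n :=
  let h := extend g x y in let z := partner g x in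
  if open h z.1 then partner h z else odflt x [pick v | linked h x v && open h v.1].

Lemma self_flagsP g u :
  reflect [/\ proper_flag u, open g u.1 & (partner g u).1 = u.1] (u \in self_flags g).
Proof.
rewrite [self_flags]unlock inE; apply: (iffP and3P) => -[pu uo us]; split=> //; first exact: (eqP us).
by rewrite us.
Qed.

Lemma danger0 g x u : proper_flag x -> danger g x = 0 -> proper_flag u -> u.1 = x.1 ->
  (partner g u).1 != x.1 /\ (u != x -> (partner g u).1 != (partner g x).1).
Proof.
move=> px; rewrite [danger]unlock; case: ifP => // _ /eqP; rewrite eqb0 negb_exists => /forallP H pu ux.
have := H u; rewrite inE ux eqxx pu /= negb_or negb_and negbK => /andP[-> /orP[/eqP->|->]] //.
by split=> //; rewrite eqxx.
Qed.

Lemma danger0_intro g x : proper_flag x ->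
  (forall u, proper_flag u -> u.1 = x.1 ->
    (partner g u).1 != x.1 /\ (u != x -> (partner g u).1 != (partner g x).1)) ->
  danger g x = 0.
Proof.
move=> px H; rewrite [danger]unlock; have [/negbTE-> _] := H x px erefl.
apply/eqP; rewrite eqb0 negb_exists; apply/forallP=> u; rewrite inE.
apply/negP=> /andP[/andP[/eqP ux pu]]; have [/negbTE-> h] := H u pu ux.
by move=> /andP[/h/negbTE->].
Qed.

Lemma closed_edgeP g x :
  reflect (forall v, linked g x v -> ~~ open g v.1) (closed_edge g x).
Proof.
rewrite [closed_edge]unlock; apply: (iffP forallP) => H v; first by move=> xv; have := H v; rewrite xv.
by apply/implyP=> /H.
Qed.

Lemma not_closed_edge g x v : linked g x v -> open g v.1 -> ~~ closed_edge g x.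
Proof. by move=> xv vo; apply/closed_edgeP => /(_ v xv); rewrite vo. Qed.

Lemma danger_le2 g x : danger g x <= 2.
Proof. by rewrite [danger]unlock; case: ifP => // _; case: existsP. Qed.

Lemma danger_lt2 g x : (danger g x < 2) = ((partner g x).1 != x.1).
Proof. by rewrite [danger]unlock; case: ifP => // _; case: existsP. Qed.

Section OneStep.
Variables (g : gluing n) (x : flag n).
Hypotheses (pg : partial_gluing g) (px : proper_flag x) (xo : open g x.1).

Let z := partner g x.
Let pz : proper_flag z := partner_proper pg px xo.
Let zo : open g z.1 := partner_open pg px xo.
Let xz : linked g x z := partner_linked pg px xo.

Lemma card_cross_in u (S : {set flag n}) : proper_flag u -> u.1 = x.1 ->
  #|[set y in targets g x | cross (extend g x y) u \in S]| <= #|S|.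
Proof.
move=> pu ux; rewrite -(@card_in_imset _ _ (fun y => cross (extend g x y) u)).
  by apply/subset_leq_card/subsetP=> v /imsetP[y]; rewrite inE => /andP[_ yS] ->.
move=> y y'; rewrite 2!inE => /andP[/targetsP[py _ _] _] /andP[/targetsP[py' _ _] _].
exact: extend_cross_inj.
Qed.

Lemma card_partner_cross_in u (S : {set flag n}) : proper_flag u -> u.1 = x.1 ->
  #|[set y in targets g x | partner g (cross (extend g x y) u) \in S]| <= #|S|.
Proof.
move=> pu ux; rewrite -(@card_in_imset _ _ (fun y => partner g (cross (extend g x y) u))).
  by apply/subset_leq_card/subsetP=> v /imsetP[y]; rewrite inE => /andP[_ yS] ->.
move=> y y'; rewrite 2!inE => /andP[/targetsP[py yo yx] _] /andP[/targetsP[py' yo' yx'] _] E.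
have pE y1 : proper_flag y1 -> open g y1.1 -> y1.1 != x.1 ->
    proper_flag (cross (extend g x y1) u) /\ open g (cross (extend g x y1) u).1.
  move=> ? ? ?; rewrite proper_cross; last exact: extend_partial.
  by rewrite extend_face_x.
have [p1 o1] := pE _ py yo yx; have [p2 o2] := pE _ py' yo' yx'.
exact: extend_cross_inj (partner_inj pg p1 o1 p2 o2 E).
Qed.

Lemma card_partner_in (S : {set flag n}) :
  #|[set y in targets g x | partner g y \in S]| <= #|S|.
Proof.
rewrite -(@card_in_imset _ _ (partner g)).
  by apply/subset_leq_card/subsetP=> v /imsetP[y]; rewrite inE => /andP[_ yS] ->.
move=> y y'; rewrite 2!inE => /andP[/targetsP[py yo yx] _] /andP[/targetsP[py' yo' yx'] _].
exact: partner_inj.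
Qed.

Section Target.
Variable y : flag n.
Hypothesis yY : y \in targets g x.
Let h := extend g x y.

Let py : proper_flag y. Proof. by have [] := targetsP _ _ _ yY. Qed.
Let yo : open g y.1. Proof. by have [] := targetsP _ _ _ yY. Qed.
Let yx : y.1 != x.1. Proof. by have [] := targetsP _ _ _ yY. Qed.
Let ph : partial_gluing h := extend_partial pg px py xo yo yx.
Let gh : extension g h := extend_extension xo yo.

Lemma open_extend_sub f : open h f -> [/\ open g f, f != x.1 & f != y.1].
Proof. by rewrite /h extend_open // => /and3P[]. Qed.

Lemma cross_glued_face v : v.1 = x.1 \/ v.1 = y.1 ->
  [/\ open g (cross h v).1, cross h v != v & (cross h v).1 = x.1 \/ (cross h v).1 = y.1].
Proof.
case=> E.
  have E' : (cross h v).1 = y.1 by rewrite extend_face_x.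
  by rewrite E'; split=> //; [apply: contraNneq yx => vE; rewrite -E' vE E|right].
have E' : (cross h v).1 = x.1 by rewrite extend_face_y.
by rewrite E'; split=> //; [apply: contraNneq yx => vE; rewrite -E' vE E|left].
Qed.

Lemma partner_extend_other p : proper_flag p -> open h p.1 ->
  (partner g p).1 != x.1 -> (partner g p).1 != y.1 -> partner h p = partner g p.
Proof.
move=> pp po vx vy; have [pog px' py'] := open_extend_sub po.
apply/esym/partner_uniq => //.
- exact: linked_extension pg gh (partner_linked pg pp pog).
- by rewrite /h extend_open // vx vy partner_open.
exact: partner_neq.
Qed.

(** The path of [p] runs into a glued face, crosses it and follows the path that starts on the other
    side; the last two hypotheses exclude a second crossing. *)
Lemma partner_extend_chain p : proper_flag p -> open h p.1 ->
  (partner g p).1 = x.1 \/ (partner g p).1 = y.1 ->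
  (partner g (cross h (partner g p))).1 != x.1 ->
  (partner g (cross h (partner g p))).1 != y.1 ->
  partner h p = partner g (cross h (partner g p)).
Proof.
move=> pp po vxy; have [pog px' py'] := open_extend_sub po.
set v := partner g p in vxy *.
have [co cv cxy] := cross_glued_face vxy.
have pv : proper_flag v by exact: partner_proper.
have pc : proper_flag (cross h v) by rewrite proper_cross.
move=> wx wy; apply/esym/partner_uniq => //.
- apply: linked_trans (linked_extension pg gh (partner_linked pg pp pog)) _.
  apply: linked_trans (linked_cross h v) _.
  exact: linked_extension pg gh (partner_linked pg pc co).
- by rewrite /h extend_open // wx wy partner_open.
apply: contra_neq cv => E; apply: (partner_inj pg) => //.
  by rewrite /v partner_open.
by rewrite E /v partnerK.
Qed.

Lemma linked_y : linked h x y.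
Proof. by rewrite -(extend_cross_x g px py); apply: linked_cross. Qed.

(** The two ends of the path are joined to each other: it becomes a cycle without acquiring a
    flag. *)
Lemma close_direct : y = z -> closed_edge h x /\ edge_flags h x = edge_flags g x.
Proof.
move=> yz; have inS v : linked h x v -> v \in edge_flags g x.
  apply: linked_ind; last by rewrite mem_edge_flags linked_refl.
  move=> a; rewrite !mem_edge_flags => xa; split; last by apply: linked_trans xa (linked_turn _ _).
  have [ax|ax] := eqVneq a.1 x.1.
    have [->|nax] := eqVneq a x; first by rewrite extend_cross_x // yz.
    have := partner_uniq pg px xo xa; rewrite ax => /(_ xo nax) E.
    by move: yx; rewrite yz /z -E ax eqxx.
  have [ay|ay] := eqVneq a.1 y.1.
    have nax : a != x by apply: contraNneq yx => <-; rewrite ay.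
    have := partner_uniq pg px xo xa; rewrite ay => /(_ yo nax) ->.
    by rewrite -/z -yz extend_cross_y // linked_refl.
  by rewrite extend_cross_other //; apply: linked_trans xa (linked_cross _ _).
split.
  apply/closed_edgeP=> v xv; apply/negP=> /open_extend_sub[vo vx vy].
  have := inS _ xv; rewrite mem_edge_flags => gxv.
  have nvx : v != x by apply: contraNneq vx => ->.
  by move: vy; rewrite (partner_uniq pg px xo gxv vo nvx) yz eqxx.
apply/setP=> v; apply/idP/idP; first by rewrite mem_edge_flags => /inS.
by rewrite [v \in edge_flags g x]mem_edge_flags mem_edge_flags; apply: linked_extension.
Qed.

Lemma edge_flags_grow : y != z -> #|edge_flags g x| + 2 <= #|edge_flags h x|.
Proof.
move=> yz; have nxy : ~~ linked g x y.
  apply/negP=> xy; have nyx : y != x by apply: contraNneq yx => ->.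
  by move: yz; rewrite (partner_uniq pg px xo xy yo nyx) eqxx.
have nxt : ~~ linked g x (turn y).
  apply: contra nxy => xt; apply: linked_trans xt _.
  by rewrite -{2}(turnK y); apply: linked_turn.
have yt : turn y != y by apply: contraTneq (turn_face py) => ->; rewrite eqxx.
have <- : #|turn y |: (y |: edge_flags g x)| = #|edge_flags g x| + 2.
  by rewrite cardsU1 cardsU1 in_setU1 !mem_edge_flags negb_or yt nxt nxy /= addnA addnC.
apply/subset_leq_card/subsetP=> v; rewrite !in_setU1 !mem_edge_flags => /or3P[/eqP->|/eqP->|].
- by apply: linked_trans linked_y (linked_turn _ _).
- exact: linked_y.
exact: linked_extension.
Qed.

Lemma next_endP : ~~ closed_edge h x ->
  [/\ proper_flag (next_end g x y), open h (next_end g x y).1 & linked h x (next_end g x y)].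
Proof.
move=> ncl; rewrite /next_end -/h -/z; case: ifP => zoh.
  have xzh : linked h x z by exact: linked_extension pg gh xz.
  split; [exact: partner_proper|exact: partner_open|].
  by apply: linked_trans xzh (partner_linked ph pz zoh).
case: pickP => [w /andP[xw wo]|none]; first by split=> //; rewrite (linked_proper ph xw).
case/negP: ncl; apply/closed_edgeP=> v xv; apply/negP=> vo.
by have := none v; rewrite xv vo.
Qed.

(** If the face of [z] stays open, the path still ends there. Otherwise [y] lies on the face of [z],
    and [z] is glued to a flag of the face of [x] other than [x]; danger 0 leads the path of that
    flag to a face that remains open. *)
Lemma danger0_not_closed : danger g x = 0 -> y != z -> ~~ closed_edge h x.
Proof.
move=> d0 yz.
have [zx _] := danger0 px d0 px erefl; rewrite -/z in zx.
have xzh : linked h x z by exact: linked_extension pg gh xz.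
have [zy|zy] := eqVneq z.1 y.1; last first.
  by apply: not_closed_edge xzh _; rewrite /h extend_open // zx zy zo.
have [co cz cxy] := cross_glued_face (or_intror zy).
have cx : (cross h z).1 = x.1 by rewrite extend_face_y.
have pc : proper_flag (cross h z) by rewrite proper_cross.
have [wx] := danger0 px d0 pc cx.
have cnx : cross h z != x.
  apply: contra_neq yz => E; rewrite -[LHS](extend_cross_x g px py) -/h.
  by rewrite -E crossK.
move=> /(_ cnx); rewrite -/z zy => wy.
apply: (not_closed_edge (v := partner g (cross h z))); last first.
  by rewrite /h extend_open // wx wy partner_open.
apply: linked_trans xzh _; apply: linked_trans (linked_cross h z) _.
exact: linked_extension pg gh (partner_linked pg pc co).
Qed.

(** A new self flag has changed its partner, so its old path ended on one of the two glued faces,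
    which carry six flags. *)
Lemma self_flags_extend_sub :
  self_flags h \subset self_flags g :|: [set partner g u | u in face_flags x.1 :|: face_flags y.1].
Proof.
apply/subsetP=> p /self_flagsP[pp po ps]; rewrite inE.
have [pog px' py'] := open_extend_sub po.
have pv : proper_flag (partner g p) by exact: partner_proper.
have im : (partner g p).1 = x.1 \/ (partner g p).1 = y.1 ->
    p \in [set partner g u | u in face_flags x.1 :|: face_flags y.1].
  move=> E; apply/imsetP; exists (partner g p); last by rewrite partnerK.
  by rewrite !inE pv !andbT; apply/orP; case: E => ->; rewrite eqxx; [left|right].
have [vx|vx] := eqVneq (partner g p).1 x.1; first by rewrite im ?orbT //; left.
have [vy|vy] := eqVneq (partner g p).1 y.1; first by rewrite im ?orbT //; right.
by apply/orP; left; apply/self_flagsP; rewrite -(partner_extend_other pp po vx vy).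
Qed.

Lemma card_self_flags_extend : #|self_flags h| <= #|self_flags g| + 6.
Proof.
apply: leq_trans (subset_leq_card self_flags_extend_sub) _.
apply: leq_trans (leq_card_setU _ _) _; rewrite leq_add2l.
apply: leq_trans (leq_imset_card _ _) _; apply: leq_trans (leq_card_setU _ _) _.
by rewrite !card_face_flags.
Qed.

End Target.
End OneStep.
End Steps.

Lemma card_bigcup_le (I T : finType) (A : {set I}) (B : I -> {set T}) c :
  (forall i, i \in A -> #|B i| <= c) -> #|\bigcup_(i in A) B i| <= #|A| * c.
Proof.
move=> Bc; rewrite -sum_nat_const.
apply: (big_ind2 (fun (S : {set T}) k => #|S| <= k)); rewrite ?cards0 //.
move=> S1 k1 S2 k2 h1 h2; apply: leq_trans (leq_card_setU _ _) _; exact: leq_add.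
Qed.

(** * Counting the exceptional targets of one step *)

Section Counts.
Variable n : nat.
Implicit Types (g h : gluing n) (u v w x y z : flag n) (f : face n).

Definition busy_tets g x : {set 'I_n} :=
  [set t | [exists i, ~~ open g (t, i)]] :|: [set x.1.1; (partner g x).1.1].

Lemma turn_face_inj u v : u.1 = v.1 -> (turn u).1 = (turn v).1 -> u = v.
Proof. by case: u v => [[a b] c] [[a' b'] c'] /= [-> ->] [->]. Qed.

Lemma card_glued_tets g : #|[set t | [exists i, ~~ open g (t, i)]]| <= nb_glued g.
Proof.
rewrite [nb_glued]unlock.
apply: leq_trans (leq_imset_card (fun f : face n => f.1) [set f | ~~ open g f]).
apply/subset_leq_card/subsetP=> t; rewrite inE => /existsP[i ti].
by apply/imsetP; exists (t, i); rewrite ?inE.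
Qed.

Lemma card_flags_in_tets (T : {set 'I_n}) :
  #|[set u : flag n | proper_flag u & u.1.1 \in T]| = 12 * #|T|.
Proof.
have -> : [set u : flag n | proper_flag u & u.1.1 \in T] =
    [set u : flag n | proper_flag u & u.1 \in setX T [set: 'I_4]].
  by apply/setP=> u; rewrite !inE andbT.
by rewrite card_flags_over cardsX cardsT card_ord mulnC -mulnA mulnC.
Qed.

Lemma fresh_partner g u : partial_gluing g -> proper_flag u ->
  (forall i, open g (u.1.1, i)) -> partner g u = turn u.
Proof.
move=> pg pu uo; have o1 : open g u.1 by rewrite [u.1]surjective_pairing uo.
apply/esym/partner_uniq => //; [exact: linked_turn|exact: uo|].
by apply: contraTneq (turn_face pu) => ->; rewrite eqxx.
Qed.

(** In a tetrahedron without glued faces the partner of a flag is its turn, which lies on another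
    face. Any other tetrahedron contributes at most its 12 flags. *)
Lemma card_self_flags g : partial_gluing g -> #|self_flags g| <= 12 * nb_glued g.
Proof.
move=> pg; apply: (@leq_trans (12 * #|[set t | [exists i, ~~ open g (t, i)]]|)); last first.
  by rewrite leq_mul2l card_glued_tets orbT.
rewrite -card_flags_in_tets; apply/subset_leq_card/subsetP=> u.
move=> /self_flagsP[pu uo us]; rewrite !inE pu /=; apply: contraT.
rewrite negb_exists => /forallP fr; have := turn_face pu.
rewrite -(fresh_partner pg pu) ?us ?eqxx // => i.
by have := fr i; rewrite negbK.
Qed.

Section OneStep.
Variables (g : gluing n) (x : flag n).
Hypotheses (pg : partial_gluing g) (px : proper_flag x) (xo : open g x.1).

Let z := partner g x.
Let pz : proper_flag z := partner_proper pg px xo.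
Let zo : open g z.1 := partner_open pg px xo.
Let xz : linked g x z := partner_linked pg px xo.

Lemma card_busy_targets :
  #|[set y in targets g x | y.1.1 \in busy_tets g x]| <= 12 * (nb_glued g + 2).
Proof.
apply: (@leq_trans (12 * #|busy_tets g x|)); last first.
  rewrite leq_mul2l /=; apply: leq_trans (leq_card_setU _ _) _.
  by apply: leq_add (card_glued_tets g) _; rewrite cards2; case: eqP.
rewrite -card_flags_in_tets; apply/subset_leq_card/subsetP=> y.
by rewrite inE => /andP[/targetsP[py _ _] yb]; rewrite inE py.
Qed.

Section Fresh.
Variable y : flag n.
Hypotheses (yY : y \in targets g x) (yf : y.1.1 \notin busy_tets g x).
Let h := extend g x y.

Let py : proper_flag y. Proof. by have [] := targetsP _ _ _ yY. Qed.
Let yo : open g y.1. Proof. by have [] := targetsP _ _ _ yY. Qed.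
Let yx : y.1 != x.1. Proof. by have [] := targetsP _ _ _ yY. Qed.
Let ph : partial_gluing h := extend_partial pg px py xo yo yx.
Let gh : extension g h := extend_extension xo yo.

Lemma fresh_tet : [/\ forall i, open g (y.1.1, i), y.1.1 != x.1.1 & y.1.1 != z.1.1].
Proof.
move: yf; rewrite !inE !negb_or => /and3P[/existsPn yi -> ->]; split=> // i.
by have := yi i; rewrite negbK.
Qed.

Lemma fresh_open i : (y.1.1, i) != y.1 -> open h (y.1.1, i).
Proof.
have [fo fx _] := fresh_tet => iy; rewrite /h extend_open // iy fo !andbT.
by apply: contraNneq fx => /(congr1 fst) /= ->.
Qed.

Lemma fresh_turn_open : open h (turn y).1.
Proof. by apply: fresh_open; have := turn_face py. Qed.

Lemma fresh_open_z : z.1 != x.1 -> open h z.1.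
Proof.
have [_ _ fz] := fresh_tet => zx; rewrite /h extend_open // zx zo !andbT /=.
by apply: contraNneq fz => ->.
Qed.

Lemma fresh_partner_z : z.1 != x.1 -> partner h z = turn y.
Proof.
have [fo fx fz] := fresh_tet => zx; have zoh := fresh_open_z zx.
have E : partner g z = x by rewrite /z partnerK.
have F : partner g (cross h (partner g z)) = turn y.
  by rewrite E extend_cross_x // fresh_partner.
rewrite -F; apply: partner_extend_chain => //; rewrite ?F -/h ?F ?E; [by left| |].
  by apply: contraNneq fx => /(congr1 fst) /= ->.
exact: turn_face.
Qed.

(** The path leaves the fresh tetrahedron at [turn y]. The two other flags of that face have their
    partners on further faces of the same tetrahedron, away from the far end [z]. *)
Lemma danger_fresh0 : danger g x < 2 -> danger h (turn y) = 0.
Proof.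
rewrite danger_lt2 -/z => zx; have [fo fx fz] := fresh_tet.
have zoh := fresh_open_z zx; have pzt := fresh_partner_z zx.
have pty : proper_flag (turn y) by rewrite proper_turn.
have ptz : partner h (turn y) = z by rewrite -pzt partnerK.
apply: danger0_intro => // u pu ut; rewrite ptz.
have zt : z.1 != (turn y).1 by apply: contraNneq fz => ->.
have [->|uty] := eqVneq u (turn y); first by rewrite ptz; split=> //; rewrite eqxx.
have E : u = (((y.1.1, y.2), u.2) : flag n) by rewrite [LHS]surjective_pairing ut.
have tu : (turn u).1 = (y.1.1, u.2) by rewrite E.
have uy : (turn u).1 != y.1.
  apply: contraNneq uty; rewrite tu E => /(congr1 snd) /= ->.
  by rewrite -/(turn y).
have -> : partner h u = turn u.
  apply/esym/partner_uniq => //.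
  - by rewrite ut fresh_turn_open.
  - exact: linked_turn.
  - by rewrite tu; apply: fresh_open; rewrite -tu.
  by apply: contraTneq (turn_face pu) => ->; rewrite eqxx.
split; first by rewrite -ut turn_face.
by move=> _; apply: contraNneq fz; rewrite tu => <-.
Qed.

Lemma next_end_fresh : danger g x < 2 -> next_end g x y = turn y.
Proof.
by rewrite danger_lt2 -/z => zx; rewrite /next_end -/h -/z fresh_open_z ?fresh_partner_z.
Qed.

(** In danger 2 both ends lie on the glued face: they enter the fresh tetrahedron by two flags of
    one face and leave it by different faces. *)
Lemma danger_fresh1 : danger h (next_end g x y) < 2.
Proof.
have [d2|] := ltnP (danger g x) 2.
  by rewrite next_end_fresh // danger_fresh0.
rewrite leqNgt danger_lt2 negbK -/z => /eqP zx; have [fo fx fz] := fresh_tet.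
have xy : linked h x (turn y).
  by apply: linked_trans (linked_y px yY) (linked_turn _ _).
have tyo := fresh_turn_open.
have pty : proper_flag (turn y) by rewrite proper_turn.
pose c := cross h z.
have c1 : c.1 = y.1 by rewrite /c extend_face_x.
have cy : c != y.
  rewrite -(extend_cross_x g px py) /c -/h (inj_eq (inv_inj (crossK ph))).
  exact: partner_neq.
have pc : proper_flag c by rewrite proper_cross.
have xc : linked h x (turn c).
  apply: linked_trans (linked_extension pg gh xz) _.
  exact: linked_trans (linked_cross h z) (linked_turn _ _).
have tcE : (turn c).1 = (y.1.1, c.2) by rewrite -c1.
have tco : open h (turn c).1.
  by rewrite tcE; apply: fresh_open; rewrite -tcE -c1 turn_face.
have tcy : (turn c).1 != (turn y).1.
  by apply: contra_neq cy => /(turn_face_inj c1).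
have tE : partner h (turn y) = turn c.
  apply/esym/partner_uniq => //; last by apply: contraNneq tcy => ->.
  by apply: linked_trans xc; rewrite linked_sym.
have ncl : ~~ closed_edge h x by exact: not_closed_edge xy tyo.
have [pv vo xv] := next_endP pg px xo yY ncl.
rewrite danger_lt2; move: (next_end g x y) pv vo xv => v pv vo xv.
have [->|vy] := eqVneq v (turn y); first by rewrite tE.
have -> : v = turn c.
  rewrite -tE; apply: partner_uniq => //.
  by apply: linked_trans xv; rewrite linked_sym.
by rewrite -tE partnerK // tE eq_sym.
Qed.

End Fresh.

(** If [z] is on another face than [x], that face must be glued as well, which leaves three targets.
    If they share a face, the flag glued to [z] must lead back to a glued face: it is a self flag,
    or its partner is one of the three flags of the face of [x]. *)
Lemma card_indirect :
  #|[set y in targets g x | (y != z) && closed_edge (extend g x y) x]| <= #|self_flags g| + 3.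
Proof.
have [zx|zx] := eqVneq z.1 x.1; last first.
  apply: (@leq_trans #|face_flags z.1|); last by rewrite card_face_flags leq_addl.
  apply/subset_leq_card/subsetP=> y; rewrite inE => /andP[yY /andP[_ cl]].
  have /targetsP[py yo yx] := yY.
  have := closed_edgeP _ _ cl _ (linked_extension pg (extend_extension xo yo) xz).
  by rewrite extend_open // zx zo andbT /= negbK eq_sym inE py andbT.
pose S := self_flags g :|: [set partner g u | u in face_flags x.1].
apply: (@leq_trans #|S|); last first.
  apply: leq_trans (leq_card_setU _ _) _; rewrite leq_add2l.
  by apply: leq_trans (leq_imset_card _ _) _; rewrite card_face_flags.
apply: leq_trans (card_cross_in pg px S pz zx).
apply/subset_leq_card/subsetP=> y; rewrite inE => /andP[yY /andP[_ cl]].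
rewrite inE yY /=; have /targetsP[py yo yx] := yY.
set h := extend g x y in cl *; have gh : extension g h := extend_extension xo yo.
have ph : partial_gluing h by exact: extend_partial.
pose c := cross h z; have c1 : c.1 = y.1 by rewrite /c extend_face_x.
have pc : proper_flag c by rewrite proper_cross.
have co : open g c.1 by rewrite c1.
have xc : linked h x (partner g c).
  apply: linked_trans (linked_extension pg gh xz) _.
  apply: linked_trans (linked_cross h z) _.
  exact: linked_extension pg gh (partner_linked pg pc co).
have := closed_edgeP _ _ cl _ xc; rewrite extend_open // partner_open //.
rewrite andbT negb_and !negbK => /orP[] /eqP E.
  rewrite inE; apply/orP; right; apply/imsetP; exists (partner g c); last by rewrite partnerK.
  by rewrite inE E eqxx partner_proper.
by rewrite inE; apply/orP; left; apply/self_flagsP; rewrite -/c E c1.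
Qed.

Let near_self := \bigcup_(u in self_flags g) face_flags u.1.
Let facing (f : face n) := \bigcup_(u in face_flags f) face_flags (partner g u).1.

Lemma card_near_self : #|near_self| <= 3 * #|self_flags g|.
Proof. by rewrite mulnC; apply: card_bigcup_le => u _; rewrite card_face_flags. Qed.

Lemma card_facing f : #|facing f| <= 9.
Proof.
rewrite -[9]/(3 * 3) -{1}(card_face_flags f).
by apply: card_bigcup_le => u _; rewrite card_face_flags.
Qed.

Lemma card_danger0_step : danger g x = 0 ->
  #|[set y in targets g x | (y != z) &&
      ((danger (extend g x y) (next_end g x y) != 0)
       || (#|self_flags g| < #|self_flags (extend g x y)|)
       || ~~ open (extend g x y) z.1)]|
  <= 36 * (1 + #|self_flags g|).
Proof.
move=> d0.
(* The harmful targets. [E1]: [y] is on a face to which the face of [x] leads. [near_self]: its face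
   carries a self flag. [E3]: two paths ending on a common face are joined into a self path. [E4],
   [E5]: the new end [partner g y] is on a face that carries a self flag, or to which the face of
   [z] leads. The last set treats [y] itself on a face to which that of [z] leads. *)
pose E1 := facing x.1.
pose E3 := \bigcup_(u in face_flags x.1)
  [set y in targets g x | partner g (cross (extend g x y) u) \in face_flags (partner g u).1].
pose E4 := [set y in targets g x | partner g y \in near_self].
pose E5 := [set y in targets g x | partner g y \in facing z.1].
apply: (@leq_trans #|E1 :|: (near_self :|: (E3 :|: (E4 :|: (E5 :|: facing z.1))))|); last first.
  have c1 := card_facing x.1; have c2 := card_near_self; have c6 := card_facing z.1.
  have c3 : #|E3| <= 9.
    rewrite -[9]/(3 * 3) -{1}(card_face_flags x.1); apply: card_bigcup_le => u.
    rewrite inE => /andP[/eqP ux pu].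
    by apply: leq_trans (card_partner_cross_in pg px xo _ pu ux) _; rewrite card_face_flags.
  have c4 : #|E4| <= 3 * #|self_flags g| by apply: leq_trans c2; apply: card_partner_in.
  have c5 : #|E5| <= 9 by apply: leq_trans c6; apply: card_partner_in.
  have cU (A B : {set flag n}) a b : #|A| <= a -> #|B| <= b -> #|A :|: B| <= a + b.
    by move=> Aa Bb; apply: leq_trans (leq_card_setU _ _) (leq_add Aa Bb).
  apply: (@leq_trans (9 + (3 * #|self_flags g| + (9 + (3 * #|self_flags g| + (9 + 9)))))).
    by apply: (cU) c1 _; apply: (cU) c2 _; apply: (cU) c3 _; apply: (cU) c4 (cU _ _ _ _ c5 c6).
  by lia.
apply/subset_leq_card/subsetP=> y; rewrite inE => /andP[yY /andP[yz]].
apply: contraLR; rewrite !in_setU !negb_or => /and3P[n1 n2 /and3P[n3 n4 /andP[n5 n6]]].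
have /targetsP[py yo yx] := yY.
set h := extend g x y.
have gh : extension g h := extend_extension xo yo.
have ph : partial_gluing h by exact: extend_partial.
have Fa u : proper_flag u -> u.1 = x.1 -> (partner g u).1 != x.1 /\ (partner g u).1 != y.1.
  move=> pu ux; split; first by case: (danger0 px d0 pu ux).
  apply: contraNneq n1 => E; apply/bigcupP; exists u; rewrite inE ?ux ?pu ?eqxx //.
  by rewrite E eqxx py.
have Fb v : proper_flag v -> v.1 = y.1 -> (partner g v).1 != x.1 /\ (partner g v).1 != y.1.
  move=> pv vy; have vo : open g v.1 by rewrite vy.
  split.
    apply/eqP=> E; have [_] := Fa (partner g v) (partner_proper pg pv vo) E.
    by rewrite partnerK // vy eqxx.
  apply: contraNneq n2 => E; apply/bigcupP; exists v; first by apply/self_flagsP; rewrite E vy.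
  by rewrite inE vy eqxx py.
(* By [Fa] and [Fb] no path has both ends on the two glued faces, so every path crosses the new
   identification at most once. *)
have chain p : proper_flag p -> open h p.1 -> (partner g p).1 = x.1 \/ (partner g p).1 = y.1 ->
    partner h p = partner g (cross h (partner g p)).
  move=> pp po E; have [pog _ _] := open_extend_sub yY po.
  have pv : proper_flag (cross h (partner g p)) by rewrite proper_cross // partner_proper.
  have [Cx Cy] : (partner g (cross h (partner g p))).1 != x.1 /\
                 (partner g (cross h (partner g p))).1 != y.1.
    case: E => E; first by apply: Fb => //; rewrite extend_face_x.
    by apply: Fa => //; rewrite extend_face_y.
  exact: partner_extend_chain.
have notE3 u : proper_flag u -> u.1 = x.1 -> (partner g (cross h u)).1 != (partner g u).1.
  move=> pu ux; apply: contraNneq n3 => E; apply/bigcupP; exists u; first by rewrite inE ux pu eqxx.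
  rewrite inE yY /= -/h inE E eqxx /=; apply: partner_proper => //.
    by rewrite proper_cross.
  by rewrite extend_face_x.
have sub : self_flags h \subset self_flags g.
  apply/subsetP=> p /self_flagsP[pp po ps]; apply/self_flagsP.
  have [pog px' py'] := open_extend_sub yY po; split=> //.
  have pv : proper_flag (partner g p) by exact: partner_proper.
  have [vx|vx] := eqVneq (partner g p).1 x.1.
    have := notE3 _ pv vx; rewrite -chain //; last by left.
    by rewrite partnerK // ps eqxx.
  have [vy|vy] := eqVneq (partner g p).1 y.1.
    have ux : (cross h (partner g p)).1 = x.1 by rewrite extend_face_y.
    have pu : proper_flag (cross h (partner g p)) by rewrite proper_cross.
    have := notE3 _ pu ux; rewrite -chain //; last by right.
    by rewrite crossK // partnerK // ps eqxx.
  by rewrite -(partner_extend_other pg px xo yY pp po vx vy) ps.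
have [zx zy] := Fa x px erefl; rewrite -/z in zx zy.
have zoh : open h z.1 by rewrite /h extend_open // zx zy zo.
have x'E : next_end g x y = partner h z by rewrite /next_end -/h -/z zoh.
have zg : partner g z = x by rewrite /z partnerK.
have x'y : partner h z = partner g y.
  by rewrite chain // zg; [rewrite /h extend_cross_x|left].
have x'o : open h (partner h z).1 by exact: partner_open.
have px' : proper_flag (partner h z) by exact: partner_proper.
rewrite zoh -leqNgt subset_leq_card // !andbT negbK x'E; apply/eqP.
apply: danger0_intro => // u pu ux'; rewrite partnerK //.
have uo : open h u.1 by rewrite ux'.
split.
  apply: contraNneq n4 => E; have /(subsetP sub) us : u \in self_flags h.
    by apply/self_flagsP; rewrite E ux'.
  rewrite inE yY; apply/bigcupP; exists u => //.
  by rewrite -x'y inE ux' eqxx.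
move=> nux'; apply/eqP=> wz; set w := partner h u in wz.
have pw : proper_flag w by exact: partner_proper.
have wo : open h w.1 by exact: partner_open.
have [wog _ _] := open_extend_sub yY wo.
have uw : u = partner h w by rewrite /w partnerK.
have wF : w \in face_flags z.1 by rewrite inE wz pw eqxx.
have [vy|vy] := eqVneq (partner g w).1 y.1.
  by move/negP: n6; apply; apply/bigcupP; exists w => //; rewrite inE vy py eqxx.
have [vx|vx] := eqVneq (partner g w).1 x.1.
  have pv : proper_flag (partner g w) by exact: partner_proper.
  have [_] := danger0 px d0 pv vx; rewrite partnerK // -/z wz eqxx => vnx.
  have vE : partner g w = x by apply/eqP; apply: contraT => /vnx.
  by move: nux'; rewrite uw /z -vE partnerK // eqxx.
move/negP: n5; apply; rewrite inE yY; apply/bigcupP; exists w => //.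
by rewrite -(partner_extend_other pg px xo yY pw wo vx vy) -/h -uw -x'y inE ux' eqxx.
Qed.

End OneStep.
End Counts.

Import Order.TTheory GRing.Theory Num.Theory.

Lemma leq_sum_exceptions (I : finType) (T : {set I}) (P B : pred I) (F : I -> nat) a b :
  (forall y, y \in T -> P y -> F y <= a + b * B y) ->
  \sum_(y in T | P y) F y <= #|T| * a + #|[set y in T | B y]| * b.
Proof.
move=> FP; apply: (@leq_trans (\sum_(y in T) (a + b * B y))).
  rewrite [X in _ <= X](bigID P) /=; apply: leq_trans (leq_addr _ _).
  by apply: leq_sum => y /andP[]; apply: FP.
rewrite big_split /= sum_nat_const leq_add2l -big_distrr /= mulnC leq_mul2r.
apply/orP; right; rewrite -sum1_card (big_mkcond (fun y => y \in [set _ in _ | _])) /= big_mkcond.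
by apply: leq_sum => y _; rewrite inE; case: (y \in T); case: (B y).
Qed.

(* From a positive danger the mean of [danger_weight] over one step of the
   exploration drops by at least (1 + s) / 2, which pays for the indirect ways
   of closing the edge; the mean of [self_weight] grows by a factor of at most
   1 + O(1/n). *)
Definition danger_weight d s := (1 + s) * (if d is d'.+1 then if d' is 0 then 1 else 16 else 0).
Definition self_weight d s := (1 + s) ^ 2 + 96 * danger_weight d s.

(** * Mean weights over one step *)

Section StepSums.
Variable n : nat.
Variables (g : gluing n) (x : flag n).
Hypotheses (pg : partial_gluing g) (px : proper_flag x) (xo : open g x.1).

Let N := #|targets g x|.
Let s := #|self_flags g|.
Let d := danger g x.
Let going y := (y != partner g x) && ~~ closed_edge (extend g x y) x.
Let s' y := #|self_flags (extend g x y)|.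
Let d' y := danger (extend g x y) (next_end g x y).
Let Th y := danger_weight (d' y) (s' y).

Definition indirect_targets : {set flag n} :=
  [set y in targets g x | (y != partner g x) && closed_edge (extend g x y) x].

Let s'_le y : y \in targets g x -> s' y <= s + 6.
Proof. exact: card_self_flags_extend. Qed.

Let Th_le y : y \in targets g x -> Th y <= 112 * (1 + s).
Proof.
move=> /s'_le; rewrite /Th /danger_weight; move: (s' y) => s1 h.
by case: (d' y) => [|[|_]] //=; lia.
Qed.

(** Only the [36 * (1 + s)] harmful targets create danger, each of weight at most
    [16 * 7 * (1 + s)], as [s] grows by at most 6; this gives 4032. They raise the squares by at
    most [48 * (1 + s)] each, and [400 * 1000] rounds up [36 * 48 + 96 * 4032]. *)
Lemma danger0_sums : danger g x = 0 ->
  [/\ indirect_targets = set0,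
      \sum_(y in targets g x | going y) Th y <= 4032 * (1 + s) ^ 2 &
      \sum_(y in targets g x | going y) self_weight (d' y) (s' y) <=
        (N + 400 * 1000) * self_weight d s].
Proof.
move=> d0.
have I0 : indirect_targets = set0.
  apply/setP=> y; rewrite !inE; apply/negbTE/negP => /andP[yY /andP[yz]].
  by apply/negP; apply: (danger0_not_closed pg px xo).
pose B y := (y != partner g x) &&
  ((d' y != 0) || (s < s' y) || ~~ open (extend g x y) (partner g x).1).
have cB : #|[set y in targets g x | B y]| <= 36 * (1 + s) := card_danger0_step pg px xo d0.
have good y : y \in targets g x -> going y -> ~~ B y -> d' y = 0 /\ s' y <= s.
  by move=> yY /andP[yz _]; rewrite /B yz /= !negb_or negbK -leqNgt => /andP[/andP[/eqP]].
have SumT : \sum_(y in targets g x | going y) Th y <= 4032 * (1 + s) ^ 2.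
  apply: leq_trans (leq_sum_exceptions (B := B) (a := 0) (b := 112 * (1 + s)) _) _.
    move=> y yY gy; case By: (B y); first by rewrite add0n muln1 Th_le.
    by have [] := good _ yY gy (negbT By); rewrite /Th => -> _; rewrite /danger_weight muln0.
  rewrite muln0 add0n; apply: leq_trans (leq_mul cB (leqnn _)) _; rewrite -mulnn; lia.
split=> //; rewrite big_split /= -big_distrr /=.
have : \sum_(y in targets g x | going y) (1 + s' y) ^ 2 <= N * (1 + s) ^ 2 + 36 * (1 + s) * (48 * (1 + s)).
  apply: leq_trans (leq_sum_exceptions (B := B) (a := (1 + s) ^ 2) (b := 48 * (1 + s)) _) _.
    move=> y yY gy; case By: (B y); first by have := s'_le yY; nia.
    by have [_] := good _ yY gy (negbT By); nia.
  by rewrite leq_add2l; apply: leq_mul cB (leqnn _).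
have w0 : self_weight d s = (1 + s) ^ 2.
  by rewrite /d d0 /self_weight /danger_weight !muln0 addn0.
move: SumT; rewrite /Th w0 mulnDl.
have -> : 36 * (1 + s) * (48 * (1 + s)) = 1728 * (1 + s) ^ 2 by rewrite -mulnn; lia.
by move: (\sum_(_ in _ | _) danger_weight _ _) (\sum_(_ in _ | _) _ ^ 2) ((1 + s) ^ 2) => a b W; move: (N * W) => NW; lia.
Qed.

(** A fresh tetrahedron turns danger 1 into 0, and danger 2 into at most 1, where the weight is at
    most [7 * (1 + s)], well below [16 * (1 + s)]. Busy targets have weight at most [112 * (1 + s)];
    the factor [224 = 2 * 112] keeps their total below [N * (1 + s) / 2]. The coefficient 96 of
    [self_weight] is chosen so that half of it, 48, covers the growth of the square. *)
Lemma danger_pos_sums : 0 < danger g x -> 12 * (nb_glued g + 2) * 224 <= N ->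
  [/\ #|indirect_targets| <= 3 * (1 + s),
      2 * (\sum_(y in targets g x | going y) Th y) + N * (1 + s) <= 2 * N * danger_weight d s &
      \sum_(y in targets g x | going y) self_weight (d' y) (s' y) <= N * self_weight d s].
Proof.
move=> d0 small.
have cI : #|indirect_targets| <= 3 * (1 + s).
  by apply: leq_trans (card_indirect pg px xo) _; rewrite -/s; lia.
pose B (y : flag n) := y.1.1 \in busy_tets g x.
pose c := #|[set y in targets g x | B y]|.
have cB : c <= 12 * (nb_glued g + 2) := card_busy_targets g x.
have {small}cN : 224 * c * (1 + s) <= N * (1 + s).
  by rewrite leq_mul2r; apply/orP; right; apply: leq_trans small; rewrite mulnC leq_mul2r cB orbT.
have SumT : 2 * (\sum_(y in targets g x | going y) Th y) + N * (1 + s) <= 2 * N * danger_weight d s.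
  have [d2|] := ltnP (danger g x) 2.
    have d1 : d = 1 by rewrite /d; lia.
    have := @leq_sum_exceptions _ (targets g x) going B Th 0 (112 * (1 + s)).
    rewrite d1 /danger_weight -/c => H.
    have {}/H : forall y, y \in targets g x -> going y -> Th y <= 0 + 112 * (1 + s) * B y.
      move=> y yY gy; case By: (B y); first by rewrite add0n muln1 Th_le.
      by rewrite /Th /d' next_end_fresh ?danger_fresh0 // -?/(B y) ?By // /danger_weight muln0.
    rewrite -/N muln0 add0n !muln1; move: (\sum_(_ in _ | _) _) => a; lia.
  move=> d2; have {}d2 : d = 2 by have := danger_le2 g x; rewrite /d; lia.
  have := @leq_sum_exceptions _ (targets g x) going B Th (7 * (1 + s)) (112 * (1 + s)).
  rewrite d2 /danger_weight -/c => H.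
  have {}/H : forall y, y \in targets g x -> going y -> Th y <= 7 * (1 + s) + 112 * (1 + s) * B y.
    move=> y yY gy; case By: (B y); first by have := Th_le yY; lia.
    have := danger_fresh1 pg px xo yY (negbT By).
    rewrite /Th /danger_weight -/(d' y); have := s'_le yY.
    by case: (d' y) => [|[|]] //=; lia.
  rewrite -/N; move: (\sum_(_ in _ | _) _) => a.
  have -> : N * (7 * (1 + s)) = 7 * (N * (1 + s)) by rewrite mulnCA.
  have -> : 2 * N * ((1 + s) * 16) = 32 * (N * (1 + s)) by rewrite [_ * 16]mulnC mulnCA !mulnA.
  move: cN; rewrite -mulnA; have -> : c * (112 * (1 + s)) = 112 * (c * (1 + s)) by rewrite mulnCA.
  by move: (N * _) (c * _) => b e; lia.
split=> //; rewrite big_split /= -big_distrr /=.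
have : \sum_(y in targets g x | going y) (1 + s' y) ^ 2 <= N * ((1 + s) ^ 2 + 48 * (1 + s)).
  apply: leq_trans (leq_sum_exceptions (B := xpred0) (a := (1 + s) ^ 2 + 48 * (1 + s)) (b := 0) _) _.
    by move=> y yY gy; have := s'_le yY; nia.
  by rewrite muln0 addn0.
move: SumT; rewrite /self_weight /Th.
move: (1 + s) (danger_weight d s) => k w.
rewrite (mulnDr N (k ^ 2) (48 * k)) (mulnDr N (k ^ 2) (96 * w)) (mulnCA N 96) (mulnCA N 48) -mulnA.
move: (\sum_(_ in _ | _) danger_weight _ _) (\sum_(_ in _ | _) _ ^ 2) => a b.
by move: (N * _ ^ 2) (N * w) (N * k) => e f l; lia.
Qed.

End StepSums.

(** * Upper bound on the size of an edge *)

Lemma leq_addM2S a b c r : b + 2 <= c -> a <= b + 2 * r.+1 -> a <= c + 2 * r.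
Proof. lia. Qed.

Lemma addM2S_leq a m r : a + 2 * r.+1 <= m.+2 -> a + 2 * r <= m.
Proof. lia. Qed.

Section Common.
Variables (R : realFieldType) (n : nat).
Implicit Types (g h : gluing n) (x y : flag n).
Local Open Scope ring_scope.

Definition weight g : R := (nb_completions (nb_open g))%:R.

Lemma weight_ge0 g : 0 <= weight g. Proof. exact: ler0n. Qed.

Lemma weight_extend g x y : open g x.1 -> y \in targets g x ->
  weight g = #|targets g x|%:R * weight (extend g x y).
Proof.
move=> xo yY; rewrite /weight card_targets // (nb_open_extend xo yY) /=.
by rewrite natrM.
Qed.

Lemma sum_completions_le (X : gluing n -> R) (F : flag n -> R) (c : R) g x :
  partial_gluing g -> proper_flag x -> open g x.1 ->
  (forall y, y \in targets g x ->
     \sum_(h in completions (extend g x y)) X h <= F y * weight (extend g x y)) ->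
  \sum_(y in targets g x) F y <= c * #|targets g x|%:R ->
  \sum_(h in completions g) X h <= c * weight g.
Proof.
move=> pg px xo XF Fc; rewrite (sum_completions _ pg px xo).
have [T0|[y0 y0T]] := set_0Vmem (targets g x).
  rewrite T0 !big_set0 in Fc *.
  suff -> : weight g = 0 by rewrite mulr0.
  have := card_targets xo; rewrite T0 cards0 /weight.
  have : (0 < nb_open g)%N.
    by rewrite [nb_open]unlock; apply/card_gt0P; exists x.1; rewrite inE.
  by case: (nb_open g) => [|[|k]].
pose w := weight (extend g x y0).
have wE y : y \in targets g x -> weight (extend g x y) = w.
  move=> yT; rewrite /w /weight; have := nb_open_extend xo yT.
  by rewrite (nb_open_extend xo y0T) => -[->].
apply: le_trans (ler_sum _ XF) _.
rewrite (eq_bigr (fun y => F y * w)); last by move=> y yT; rewrite wE.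
rewrite -mulr_suml (weight_extend xo y0T) mulrA ler_wpM2r //; exact: weight_ge0.
Qed.

Lemma sum_completions_ge (X : gluing n -> R) (F : flag n -> R) (c : R) g x :
  partial_gluing g -> proper_flag x -> open g x.1 ->
  (forall y, y \in targets g x ->
     F y * weight (extend g x y) <= \sum_(h in completions (extend g x y)) X h) ->
  c * #|targets g x|%:R <= \sum_(y in targets g x) F y ->
  c * weight g <= \sum_(h in completions g) X h.
Proof.
move=> pg px xo XF Fc; rewrite -lerN2 -sumrN -mulNr.
apply: (sum_completions_le (x := x) (F := fun y => - F y)) => //.
  by move=> y yT; rewrite mulNr sumrN lerN2; apply: XF.
by rewrite sumrN mulNr lerN2.
Qed.

Lemma sum_completions1 g : partial_gluing g -> \sum_(h in completions g) 1 = weight g.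
Proof. by move=> pg; rewrite sumr_const card_completions. Qed.

Lemma edge_flags_completion g h x : partial_gluing g -> h \in completions g ->
  edge_flags g x \subset edge_flags h x.
Proof.
move=> pg /completionsP[_ gh]; apply/subsetP=> v; rewrite mem_edge_flags => xv.
by rewrite mem_edge_flags; apply: linked_extension xv.
Qed.

Lemma edge_flags_completion_closed g h x : partial_gluing g -> h \in completions g ->
  closed_edge g x -> edge_flags h x = edge_flags g x.
Proof.
move=> pg /completionsP[_ gh] /closed_edgeP cl; exact: edge_flags_closed.
Qed.

Lemma edge_flags_linked g x y : partial_gluing g -> linked g x y ->
  edge_flags g x = edge_flags g y.
Proof.
move=> pg xy; apply/setP=> v; rewrite [LHS]mem_edge_flags [RHS]mem_edge_flags.
apply/idP/idP; apply: linked_trans => //; by rewrite linked_sym.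
Qed.

End Common.

Section UpperBound.
Variables (R : realFieldType) (n : nat) (A : pred nat) (Lim M0 : nat).
Hypothesis ALim : forall a, A a -> a < Lim.
Let nu := 3 * M0.+1.
Hypothesis small : 12 * (4 * n - M0 + 2) * 224 <= nu.
Implicit Types (g h : gluing n) (x y : flag n).
Local Open Scope ring_scope.

Definition nb_sizes l : nat := (\sum_(l <= a < Lim) A a)%N.

Definition growth : R := 1 + (400 * 1000)%:R / nu%:R.

(** First summand: each size still possible is reached by direct closing with probability at most
    [1 / nu]. Second: indirect closing out of the present danger. Third: danger that arises during
    the [r] remaining steps. *)
Definition size_bound r l d s : R :=
  (nb_sizes l)%:R / nu%:R + 12 * (danger_weight d s)%:R / nu%:R
  + 12 * 4032 / nu%:R ^+ 2 * (r%:R * growth ^+ r) * (self_weight d s)%:R.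

Let nu_gt0 : 0 < nu%:R :> R. Proof. by rewrite ltr0n. Qed.

Lemma growth_ge1 : 1 <= growth.
Proof. by rewrite lerDl divr_ge0 ?ler0n. Qed.

Lemma size_bound_ge0 r l d s : 0 <= size_bound r l d s.
Proof.
have g0 : 0 <= growth by apply: le_trans growth_ge1; rewrite ler01.
by rewrite /size_bound !addr_ge0 // ?mulr_ge0 ?invr_ge0 ?exprn_ge0 ?ler0n.
Qed.

Lemma nb_sizes_le l l' : (l <= l')%N -> (nb_sizes l' <= nb_sizes l)%N.
Proof.
move=> ll; have [lL|Ll] := leqP l' Lim; last by rewrite /nb_sizes big_geq // ltnW.
by rewrite /nb_sizes (big_cat_nat ll lL) leq_addl.
Qed.

Lemma nb_sizes_ltn l : (A l + nb_sizes l.+1 <= nb_sizes l)%N.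
Proof.
have [lL|Ll] := ltnP l Lim; first by rewrite /nb_sizes [X in (_ <= X)%N]big_ltn.
case Al : (A l); last by rewrite add0n nb_sizes_le.
by have := ALim Al; rewrite ltnNge Ll.
Qed.

(** The induction step in real numbers. The first alternative is danger 0; in the second one the
    middle summand drops by at least [6 * k], which pays for the [3 * k] indirect targets. *)
Let bound_step (a I N c0 c1 T ST SV V k v K C q G : R) :
  0 < v -> v <= N -> 0 <= K -> 0 <= q -> 1 <= G -> 0 <= V -> 0 <= k ->
  0 <= C -> 0 <= a -> a + c1 <= c0 -> 0 <= c0 ->
  (I <= 0 /\ 12 * ST <= K * V /\ SV <= (N + C) * V /\ 0 <= T) \/
  (I <= 3 * k /\ 2 * ST + N * k <= 2 * N * T /\ SV <= N * V) ->
  a + I + N * (c1 / v) + 12 / v * ST + K / v ^+ 2 * (q * G) * SV <=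
  (c0 / v + 12 * T / v + K / v ^+ 2 * ((q + 1) * (G * (1 + C / v))) * V) * N.
Proof.
move=> v0 vN K0 q0 G1 V0 k0 C0 a0 ac c00 H.
have [i [i0 iE]] : exists i, 0 < i /\ i = v^-1 by exists v^-1; rewrite invr_gt0.
have vi : v * i = 1 by rewrite iE mulfV // gt_eqF.
have -> : v ^+ 2 = v * v by rewrite expr2.
rewrite !invfM -iE.
have N0 : 0 <= N by apply: le_trans vN; apply: ltW.
have {}i0 : 0 <= i by apply: ltW.
have G0 : 0 <= G by apply: le_trans G1; apply: ler01.
have Ni : 1 <= N * i by rewrite -vi ler_wpM2r //.
have main : a + N * (c1 * i) <= c0 * i * N.
  apply: (@le_trans _ _ (N * i * (a + c1))).
    have : a <= N * i * a by rewrite ler_peMl.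
    by rewrite mulrDr [N * (c1 * i)]mulrCA [c1 * _]mulrC; lra.
  have -> : c0 * i * N = N * i * c0 by ring.
  by rewrite ler_wpM2l // mulr_ge0 //.
have KV0 : 0 <= K * (i * i) by rewrite !mulr_ge0 //.
have [[I0 [ST0 [SV0 T0]]]|[I0 [ST0 SV0]]] := H.
  have e1 : 12 * i * ST <= K * (i * i) * V * N.
    apply: (@le_trans _ _ (i * (K * V))); first by rewrite mulrAC mulrC ler_wpM2l //.
    have -> : K * (i * i) * V * N = (i * (K * V)) * (N * i) by ring.
    by rewrite ler_peMr // !mulr_ge0 //.
  have e2 : K * (i * i) * (q * G) * SV <= K * (i * i) * (q * G) * V * (N * (1 + C * i)).
    rewrite -[leRHS]mulrA ler_wpM2l //; first by rewrite !mulr_ge0 //.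
    apply: le_trans SV0 _; rewrite mulrC ler_wpM2l //.
    rewrite mulrDr mulr1 lerD2l [C * i]mulrC mulrA ler_peMl //.
  have e3 : K * (i * i) * V * N <= K * (i * i) * V * N * (G * (1 + C * i)).
    rewrite ler_peMr ?mulr_ge0 // mulr_ege1 // lerDl mulr_ge0 //.
  have T1 : 0 <= 12 * T * i * N by rewrite !mulr_ge0 //.
  have E : K * (i * i) * ((q + 1) * (G * (1 + C * i))) * V * N =
     K * (i * i) * (q * G) * V * (N * (1 + C * i)) + K * (i * i) * V * N * (G * (1 + C * i)).
    by ring.
  rewrite !(mulrDl _ _ N) E; move: main e1 e2 e3 T1 I0.
  move: (K * (i * i) * (q * G) * V * (N * (1 + C * i))) (K * (i * i) * V * N * (G * (1 + C * i))).
  move=> t1 t2; lra.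
have e1 : I + 12 * i * ST <= 12 * T * i * N.
  have s1 : 12 * i * (2 * ST + N * k) <= 12 * i * (2 * N * T).
    by rewrite ler_wpM2l // mulr_ge0 //.
  have s2 : 3 * k <= 3 * k * (N * i) by rewrite ler_peMr // mulr_ge0.
  have s3 : 0 <= k * (N * i) by rewrite !mulr_ge0 //.
  nra.
have e2 : K * (i * i) * (q * G) * SV <= K * (i * i) * ((q + 1) * (G * (1 + C * i))) * V * N.
  apply: (@le_trans _ _ (K * (i * i) * (q * G) * (N * V))).
    by rewrite ler_wpM2l // !mulr_ge0 //.
  have -> : K * (i * i) * ((q + 1) * (G * (1 + C * i))) * V * N =
    K * (i * i) * ((q + 1) * (G * (1 + C * i))) * (N * V) by ring.
  rewrite ler_wpM2r ?mulr_ge0 // ler_wpM2l //.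
  rewrite ler_pM // ?lerDl // ler_peMr // lerDl mulr_ge0 //.
rewrite !(mulrDl _ _ N); move: main e1 e2; lra.
Qed.

Lemma size_upper r g x :
  partial_gluing g -> proper_flag x -> open g x.1 ->
  (M0 + 2 * r <= nb_open g)%N -> (Lim <= #|edge_flags g x| + 2 * r)%N ->
  \sum_(h in completions g) (A #|edge_flags h x|)%:R <=
    size_bound r #|edge_flags g x| (danger g x) #|self_flags g| * weight R g.
Proof.
elim: r g x => [|r IH] g x pg px xo Mg Lg.
  (* With no step left the path already has [Lim] flags, more than any size in [A]. *)
  rewrite big1 ?mulr_ge0 ?size_bound_ge0 ?weight_ge0 // => h hC.
  case Ah : (A _) => //; have := ALim Ah; rewrite ltnNge.
  rewrite (leq_trans Lg) // muln0 addn0; apply: subset_leq_card.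
  exact: edge_flags_completion.
set l := #|edge_flags g x|; set d := danger g x; set s := #|self_flags g|.
pose T := targets g x; pose z := partner g x.
pose going y := (y != z) && ~~ closed_edge (extend g x y) x.
pose s' y := #|self_flags (extend g x y)|.
pose d' y := danger (extend g x y) (next_end g x y).
pose sb y := size_bound r l.+1 (d' y) (s' y).
(* A direct closing counts only if the present size is in [A]; an indirect one is charged 1 whatever
   the size reached. *)
pose F y : R := (A l && (y == z))%:R + (y \in indirect_targets g x)%:R
                + (if going y then sb y else 0).
apply: (sum_completions_le (x := x) (F := F)) => // [y yT|].
  have /targetsP[py yo yx] := yT.
  have ph := extend_partial pg px py xo yo yx; set h0 := extend g x y in ph *.
  have sb0 : 0 <= sb y := size_bound_ge0 _ _ _ _.
  have [yz|yz] := eqVneq y z.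
    have [cl fl] := close_direct pg px xo yT yz.
    rewrite (eq_bigr (fun=> (A l)%:R)) => [|h hC]; last first.
      by rewrite (edge_flags_completion_closed ph hC cl) fl.
    rewrite sumr_const -[_ *+ _]mulr_natr card_completions // ler_wpM2r ?weight_ge0 //.
    by rewrite /F yz eqxx andbT -addrA lerDl addr_ge0 ?ler0n //; case: ifP; rewrite -?yz.
  have [cl|ncl] := boolP (closed_edge h0 x).
    apply: (@le_trans _ _ (\sum_(h in completions h0) 1)).
      by apply: ler_sum => h _; rewrite lern1 leq_b1.
    rewrite sum_completions1 // ler_peMl ?weight_ge0 //.
    rewrite /F inE yT yz cl /= addrAC lerDr addr_ge0 ?ler0n //.
    by case: ifP.
  have [px' xo' xx'] := next_endP pg px xo yT ncl.
  have xh h : h \in completions h0 -> edge_flags h x = edge_flags h (next_end g x y).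
    move=> /completionsP[hG eh]; apply: edge_flags_linked; first exact: gluings_partial.
    exact: linked_extension xx'.
  rewrite (eq_bigr (fun h => (A #|edge_flags h (next_end g x y)|)%:R)); last first.
    by move=> h /xh ->.
  have lE : #|edge_flags h0 (next_end g x y)| = #|edge_flags h0 x|.
    by rewrite (edge_flags_linked ph xx').
  have grow := edge_flags_grow pg px xo yT yz.
  apply: le_trans (IH _ _ ph px' xo' _ _) _.
  - by apply: addM2S_leq; rewrite -(nb_open_extend xo yT).
  - by rewrite lE; apply: leq_addM2S grow Lg.
  rewrite ler_wpM2r ?weight_ge0 // /F /going yz ncl /=.
  apply: (@le_trans _ _ (sb y)); last by rewrite lerDr addr_ge0 ?ler0n.
  rewrite /sb /size_bound lE !lerD2r ler_wpM2r ?invr_ge0 ?ler0n // ler_nat nb_sizes_le //.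
  by apply: leq_trans grow; rewrite addn2 leqnSn.
rewrite !big_split /=.
have nuN : (nu <= #|T|)%N.
  rewrite /T card_targets // leq_mul2l /= ltn_predRL; apply: leq_trans Mg.
  by rewrite -[M0.+2]addn2 leq_add2l mulnS leq_addr.
have v0 := nu_gt0.
have sumz : \sum_(y in T) (A l && (y == z))%:R <= (A l)%:R :> R.
  rewrite -natr_sum ler_nat; case: (A l) => /=; last by rewrite big1.
  apply: (@leq_trans (\sum_(y | y == z) 1)).
    rewrite big_mkcond [leqRHS]big_mkcond; apply: leq_sum => y _.
    by case: (_ \in _); case: (_ == _).
  by rewrite big_pred1_eq.
have sumI : \sum_(y in T) (y \in indirect_targets g x)%:R <= #|indirect_targets g x|%:R :> R.
  rewrite -natr_sum ler_nat -sum1_card [leqRHS]big_mkcond [leqLHS]big_mkcond /=.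
  by apply: leq_sum => y _; case: (_ \in T); case: (_ \in _).
pose K : R := 12 * 4032.
pose q : R := r%:R; pose G := growth ^+ r.
pose ST := (\sum_(y in T | going y) danger_weight (d' y) (s' y))%N.
pose SV := (\sum_(y in T | going y) self_weight (d' y) (s' y))%N.
have sumS : \sum_(y in T) (if going y then sb y else 0) <=
    #|T|%:R * ((nb_sizes l.+1)%:R / nu%:R) + 12 / nu%:R * ST%:R + K / nu%:R ^+ 2 * (q * G) * SV%:R.
  rewrite -big_mkcondr /= /sb /size_bound !big_split /=.
  have -> : ST%:R = \sum_(y in T | going y) (danger_weight (d' y) (s' y))%:R :> R.
    by rewrite natr_sum.
  have -> : SV%:R = \sum_(y in T | going y) (self_weight (d' y) (s' y))%:R :> R.
    by rewrite natr_sum.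
  rewrite !mulr_sumr; apply: lerD; [apply: lerD|].
  - apply: (@le_trans _ _ (\sum_(y in T) (nb_sizes l.+1)%:R / nu%:R)).
      rewrite [leRHS](bigID going) /= lerDl sumr_ge0 // => y _.
      by rewrite divr_ge0 ?ler0n.
    by rewrite sumr_const -[_ *+ _]mulr_natl.
  - by apply: ler_sum => y _; rewrite mulrAC.
  by apply: ler_sum => y _.
apply: le_trans (lerD (lerD sumz sumI) sumS) _.
rewrite !addrA /size_bound (exprSr growth r).
have -> : r.+1%:R = q + 1 :> R by rewrite -addn1 natrD.
rewrite -/G /growth.
apply: (@bound_step (A l)%:R #|indirect_targets g x|%:R #|T|%:R (nb_sizes l)%:R
  (nb_sizes l.+1)%:R (danger_weight d s)%:R ST%:R SV%:R (self_weight d s)%:R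
  (1 + s)%:R nu%:R K (400 * 1000)%:R q G); rewrite ?ler0n // ?mulr_ge0 ?ler0n //.
- by rewrite ler_nat.
- by apply: exprn_ege1; apply: growth_ge1.
- by rewrite -natrD ler_nat nb_sizes_ltn.
have [d0|d0] := eqVneq d 0%N.
  left; have [I0 hT hV] := danger0_sums pg px xo d0.
  split; first by rewrite I0 cards0.
  split; last split; rewrite ?ler0n //.
    rewrite /K -mulrA ler_wpM2l // -natrM ler_nat.
    apply: leq_trans hT _; rewrite leq_mul2l /self_weight leq_addr orbT //.
  by rewrite -natrD -natrM ler_nat.
have small' : (12 * (nb_glued g + 2) * 224 <= #|targets g x|)%N.
  apply: leq_trans nuN; apply: leq_trans small; rewrite !leq_mul2r orbC.
  rewrite leq_mul2l /= leq_add2r -(nb_open_glued g) leq_subRL.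
    by rewrite leq_add2r (leq_trans _ Mg) ?leq_addr.
  by rewrite (leq_trans _ (leq_addr _ _)) // (leq_trans _ Mg) ?leq_addr.
have dpos : (0 < danger g x)%N by rewrite lt0n.
have [hI hT hV] := danger_pos_sums pg px xo dpos small'.
right; split; first by rewrite -natrM ler_nat.
by split; rewrite -!natrM -?natrD ler_nat.
Qed.

End UpperBound.

(** * Pairs of edges *)

Section Start.
Variable n : nat.
Implicit Types (g h : gluing n) (x y z : flag n).

Lemma partner_unglued x : proper_flag x -> partner (@unglued n) x = turn x.
Proof.
by move=> px; apply: fresh_partner => // [|i]; [exact: unglued_partial|exact: unglued_open].
Qed.

Lemma danger_unglued x : proper_flag x -> danger (@unglued n) x = 0.
Proof.
move=> px; apply: danger0_intro => // u pu ux; rewrite !partner_unglued //.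
split; first by rewrite -ux turn_face.
by move=> nux; apply: contra_neq nux => /(turn_face_inj ux).
Qed.

Lemma nb_glued_unglued : nb_glued (@unglued n) = 0.
Proof. by have := nb_open_glued (@unglued n); rewrite nb_open_unglued; lia. Qed.

Lemma self_flags_unglued : #|self_flags (@unglued n)| = 0.
Proof.
by have := card_self_flags (unglued_partial n); rewrite nb_glued_unglued muln0 leqn0 => /eqP.
Qed.

Lemma edge_flags_unglued x : proper_flag x -> 2 <= #|edge_flags (@unglued n) x|.
Proof.
move=> px; have xt : x != turn x.
  by apply: contraTneq (turn_face px) => <-; rewrite eqxx.
rewrite -[2]/(true.+1) -xt -cards2; apply/subset_leq_card/subsetP=> v.
by rewrite mem_edge_flags => /set2P[] ->; [exact: linked_refl|exact: linked_turn].
Qed.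

Lemma nb_glued_extend g x y : open g x.1 -> y \in targets g x ->
  nb_glued (extend g x y) = (nb_glued g).+2.
Proof.
move=> xo yT; have := nb_open_extend xo yT.
by have := nb_open_glued g; have := nb_open_glued (extend g x y); lia.
Qed.

Lemma card_targets_glued g x : open g x.1 -> #|targets g x| = 3 * (4 * n - nb_glued g).-1.
Proof. by move=> xo; rewrite card_targets // -(nb_open_glued g) addnK. Qed.

End Start.

Lemma leq_sub_glued a b c : a + 2 <= b -> b <= c -> (c - b).+1 <= (c - a).-1.
Proof. lia. Qed.

Section Pairs.
Variables (R : realFieldType) (n m : nat) (q : R).
Local Open Scope ring_scope.
Implicit Types (g h : gluing n) (x y z b : flag n).

Let small_edge h x := (#|edge_flags h x| <= 2 * m)%N.

Hypothesis m_le : (2 * m <= 4 * n)%N.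
Hypothesis q_ge0 : 0 <= q.
Hypothesis small_le : forall g x, partial_gluing g -> proper_flag x -> open g x.1 ->
  (nb_glued g <= 2 * m)%N ->
  \sum_(h in completions g) (small_edge h x)%:R <= q * weight R g.

Let nu := (3 * (4 * n - 2 * m).+1)%N.
(** One target closes the first edge and at most [12 * (2 * m + 2)] are busy; in either case one
    small edge remains to be completed, which has probability at most [q]. *)
Definition pair_rate : R := q * (1 + 12 * (2 * m + 2)%:R) / nu%:R.

Lemma pair_rate_ge0 : 0 <= pair_rate.
Proof. by rewrite mulr_ge0 ?invr_ge0 ?ler0n // mulr_ge0 // addr_ge0 // mulr_ge0 ?ler0n. Qed.

(* The edge of [z] is explored from its other end [x]; as long as this end runs
   into fresh tetrahedra, the face of [b] stays open. *)
Lemma small_pair_le r g z b : partial_gluing g ->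
  proper_flag z -> open g z.1 -> proper_flag b -> open g b.1 ->
  b.1.1 = z.1.1 -> b.1 != z.1 -> b.1 != (partner g z).1 ->
  danger g (partner g z) = 0%N ->
  (nb_glued g + 2 * r <= 2 * m)%N -> (2 * m < #|edge_flags g z| + 2 * r)%N ->
  \sum_(h in completions g) [&& small_edge h z, small_edge h b & ~~ linked h z b]%:R
    <= r%:R * pair_rate * weight R g.
Proof.
elim: r g => [|r IH] g pg pz zo pb bo bt bz bx d0 Gm Lg.
  rewrite big1 ?mul0r ?mul0r // => h hC; rewrite /small_edge leqNgt.
  rewrite (leq_trans Lg) // muln0 addn0 subset_leq_card //.
  exact: edge_flags_completion.
set x := partner g z in bx d0.
have px : proper_flag x by exact: partner_proper.
have xo : open g x.1 by exact: partner_open.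
have zE : partner g x = z by rewrite /x partnerK.
have [xz _] := danger0 px d0 px erefl; rewrite zE in xz.
have Gle : (nb_glued g <= 2 * m)%N by apply: leq_trans Gm; rewrite leq_addr.
have Glt : (nb_glued g + 2 <= 2 * m)%N by apply: leq_trans Gm; rewrite leq_add2l mulnS leq_addr.
pose busy y := (y == z) || (y.1.1 \in busy_tets g x).
pose F y : R := (y == z)%:R * q + (y.1.1 \in busy_tets g x)%:R * q + r%:R * pair_rate.
have p0 := pair_rate_ge0.
apply: (sum_completions_le (x := x) (F := F)) => // [y yT|].
  have /targetsP[py yo yx] := yT.
  have ph := extend_partial pg px py xo yo yx; set h0 := extend g x y in ph *.
  have Gh : nb_glued h0 = (nb_glued g).+2 by exact: nb_glued_extend.
  have Gh' : (nb_glued h0 <= 2 * m)%N by rewrite Gh -addn2.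
  have gh : extension g h0 := extend_extension xo yo.
  have xzh : linked h0 x z.
    by apply: (linked_extension pg gh); rewrite linked_sym //; exact: partner_linked.
  have rest : 0 <= r%:R * pair_rate by rewrite mulr_ge0 ?ler0n.
  (* The first edge closes while the face of [b] is still open, so [small_le] applies to the edge of
     [b]. *)
  have [yz|yz] := eqVneq y z.
    have boh : open h0 b.1 by rewrite /h0 extend_open // bx yz bz bo.
    apply: (@le_trans _ _ (\sum_(h in completions h0) (small_edge h b)%:R)).
      by apply: ler_sum => h _; rewrite ler_nat; case: (small_edge h z) (small_edge h b) (linked _ _ _) => [] [] [].
    apply: le_trans (small_le ph pb boh Gh') _.
    rewrite ler_wpM2r ?weight_ge0 // /F yz eqxx mul1r -addrA lerDl addr_ge0 // mulr_ge0 ?ler0n //.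
  (* By danger 0 the first edge is not closed; the condition on [b] is dropped and [small_le] is
     applied to the first edge. *)
  have [yb|yf] := boolP (y.1.1 \in busy_tets g x).
    have yz' : y != partner g x by rewrite zE.
    have ncl := danger0_not_closed pg px xo yT d0 yz'.
    have [px' xo' xx'] := next_endP pg px xo yT ncl.
    apply: (@le_trans _ _ (\sum_(h in completions h0) (small_edge h (next_end g x y))%:R)).
      apply: ler_sum => h /completionsP[hG eh].
      have -> : small_edge h (next_end g x y) = small_edge h z.
        rewrite /small_edge.
        rewrite -(edge_flags_linked (gluings_partial hG) (linked_extension ph eh xx')).
        by rewrite (edge_flags_linked (gluings_partial hG) (linked_extension ph eh xzh)).
      by rewrite ler_nat; case: (small_edge h z) (small_edge h b) (linked _ _ _) => [] [] [].
    apply: le_trans (small_le ph px' xo' Gh') _.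
    rewrite ler_wpM2r ?weight_ge0 // /F yb (negbTE yz) mul0r add0r mul1r lerDl //.
  (* A fresh target restores danger 0 and leaves the face of [b] open, because the tetrahedron of
     [z] is busy. *)
  have zx' : (partner g x).1 != x.1 by rewrite zE.
  have [fo fx] := fresh_tet yf; rewrite zE => fz.
  have d1 : (danger g x < 2)%N by rewrite d0.
  have zoh := fresh_open_z pg px xo yT yf zx'; rewrite zE in zoh.
  have pzh := fresh_partner_z pg px xo yT yf zx'; rewrite zE in pzh.
  have boh : open h0 b.1.
    rewrite /h0 extend_open // bx bo andbT /=.
    by apply: contraNneq fz => <-; rewrite bt.
  have := IH h0 ph pz zoh pb boh bt bz; rewrite pzh danger_fresh0 // Gh.
  move=> H; rewrite /F (negbTE yz) (negbTE yf) !mul0r !add0r; apply: H => //.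
  - by apply: contraNneq fz; rewrite -bt => ->.
  - by apply: leq_trans Gm; rewrite mulnS -addn2 -addnA.
  apply: leq_trans Lg _; rewrite mulnS addnA leq_add2r.
  have zx2 : linked g z x by exact: partner_linked.
  rewrite (edge_flags_linked pg zx2) -(edge_flags_linked ph xzh).
  by apply: edge_flags_grow; rewrite ?zE.
rewrite /F !big_split /= -!mulr_suml sumr_const -mulr_natr.
have nuN : nu%:R <= #|targets g x|%:R :> R.
  by rewrite ler_nat card_targets_glued // leq_mul2l /= leq_sub_glued.
have s1 : \sum_(y in targets g x) (y == z)%:R <= 1 :> R.
  rewrite -natr_sum lern1; apply: (@leq_trans (\sum_(y | y == z) 1)).
    rewrite big_mkcond [leqRHS]big_mkcond; apply: leq_sum => y _.
    by case: (_ \in _); case: (_ == _).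
  by rewrite big_pred1_eq.
have s2 : \sum_(y in targets g x) (y.1.1 \in busy_tets g x)%:R <= (12 * (2 * m + 2))%:R :> R.
  rewrite -natr_sum ler_nat; apply: (@leq_trans (12 * (nb_glued g + 2))); last first.
    by rewrite leq_mul2l leq_add2r Gle orbT.
  apply: leq_trans (card_busy_targets g x); rewrite -sum1_card [leqRHS]big_mkcond [leqLHS]big_mkcond.
  by apply: leq_sum => y _; rewrite inE; case: (_ \in targets _ _); case: (_ \in _).
have nu0 : 0 < nu%:R :> R by rewrite ltr0n.
have e1 : q * (1 + 12 * (2 * m + 2)%:R) <= pair_rate * #|targets g x|%:R.
  rewrite /pair_rate -mulrA; apply: ler_peMr.
    by rewrite mulr_ge0 // addr_ge0 // mulr_ge0 ?ler0n.
  by rewrite mulrC ler_pdivlMr // mul1r.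
rewrite -natr1 !mulrDl mul1r; move: s1 s2 e1; rewrite natrM.
move: (\sum_(y in _) _) (\sum_(y in _) _) (2 * m + 2)%:R => a c e s1 s2 e1.
have := ler_wpM2r q_ge0 s1; have := ler_wpM2r q_ge0 s2.
move: e1; rewrite mulrDr mulr1 mul1r [q * (12 * e)]mulrC; lra.
Qed.

End Pairs.

(** * Lower bound on the number of edges *)

Section Lower.
Variables (R : realFieldType) (n : nat).
Local Open Scope ring_scope.
Implicit Types (g h : gluing n) (u v x y z : flag n).

Definition touched_faces h z : {set face n} := [set v.1 | v in edge_flags h z].

Definition lone h z : bool := [forall v in edge_flags h z, (v.1 == z.1) ==> (v == z)].

(* The lone flags of an edge lie on distinct faces, so its shares add up to at
   most 1. *)
Definition share h z : R := (lone h z)%:R / #|touched_faces h z|%:R.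

Lemma share_ge0 h z : 0 <= share h z.
Proof. by rewrite divr_ge0 ?ler0n. Qed.

Lemma touched_faces_gt0 h z : (0 < #|touched_faces h z|)%N.
Proof.
apply/card_gt0P; exists z.1; apply: imset_f; rewrite mem_edge_flags; exact: linked_refl.
Qed.

(** Only the two ends of the path lie on open faces, and here these faces differ, so [y] is lone.
    All faces met by the closed edge are glued, which bounds their number. *)
Lemma share_closed g x y h : partial_gluing g -> proper_flag x -> open g x.1 ->
  y \in targets g x -> y = partner g x -> h \in completions (extend g x y) ->
  (nb_glued g + 2)%:R^-1 <= share h y.
Proof.
move=> pg px xo yT yz hC; have /targetsP[py yo yx] := yT.
have ph := extend_partial pg px py xo yo yx; set h0 := extend g x y in ph hC *.
have [cl fl] := close_direct pg px xo yT yz.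
have xyh := linked_y px yT.
have cly : closed_edge h0 y.
  apply/closed_edgeP=> v yv; apply: (closed_edgeP _ _ cl).
  exact: linked_trans xyh yv.
have E : edge_flags h y = edge_flags h0 y by exact: edge_flags_completion_closed.
have xyg : linked g x y by rewrite yz; exact: partner_linked.
have Eg : edge_flags h0 y = edge_flags g y.
  by rewrite -(edge_flags_linked ph xyh) fl (edge_flags_linked pg xyg).
have lo : lone h y.
  apply/forallP=> v; apply/implyP; rewrite E Eg mem_edge_flags => yv.
  apply/implyP=> /eqP vy; apply/negPn/negP=> nvy.
  have := partner_uniq pg py yo yv; rewrite vy => /(_ yo nvy) vp.
  by move: yx; rewrite -vy vp yz partnerK // eqxx.
have ct : (#|touched_faces h y| <= nb_glued g + 2)%N.
  rewrite addn2 -(nb_glued_extend xo yT) [nb_glued]unlock; apply/subset_leq_card/subsetP=> f.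
  case/imsetP=> v; rewrite E mem_edge_flags => yv ->; rewrite inE.
  exact: (closed_edgeP _ _ cly).
rewrite /share lo mul1r lef_pV2 ?ler_nat // posrE ltr0n ?touched_faces_gt0 // addn2 //.
Qed.

Variable m : nat.
Hypothesis m_le : (2 * m <= 4 * n)%N.

Let nu := (3 * (4 * n - 2 * m).+1)%N.

(** Closing with [t + 1] steps left results in [2 * (m - t)] glued faces, hence a share of at least
    the inverse of this number; the closing target has probability at least [1 / (12 * n)]. *)
Definition gain r : R := \sum_(t < r) (24 * n%:R * (m - t)%:R)^-1.
(** Per unit of [1 + s], at most 37 targets forfeit the gain of the remaining steps: the closing one
    and 36 harmful ones. *)
Definition loss r : R := \sum_(t < r) 37 * gain t / nu%:R.

Lemma gain_ge0 r : 0 <= gain r.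
Proof. by apply: sumr_ge0 => t _; rewrite invr_ge0 !mulr_ge0 ?ler0n. Qed.

Lemma loss_ge0 r : 0 <= loss r.
Proof. by apply: sumr_ge0 => t _; rewrite divr_ge0 ?ler0n // mulr_ge0 ?gain_ge0 ?ler0n. Qed.

Let lower_step (t u N good b L Q k v X : R) :
  0 < v -> v <= N -> 0 <= L -> 0 <= Q -> 1 <= k -> X = L - Q * k ->
  N * u <= t -> good <= N -> N <= good + 1 + b -> b <= 36 * k -> 0 <= good ->
  (L + u - (Q + 37 * L / v) * k) * N <= t + good * X.
Proof.
move=> v0 vN L0 Q0 k1 XE Nu gN Ng bk g0.
have k0 : 0 <= k by apply: le_trans k1; apply: ler01.
have e1 : 37 * L * k <= 37 * L / v * k * N.
  have -> : 37 * L / v * k * N = 37 * L * k * (N / v) by rewrite -!mulrA; congr (_ * (_ * _)); ring.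
  by rewrite ler_peMr ?mulr_ge0 // ler_pdivlMr // mul1r.
have E : (L + u - (Q + 37 * L / v) * k) * N = N * u + N * X - 37 * L / v * k * N.
  by rewrite XE; ring.
rewrite E; have [X0|X0] := leP 0 X.
  have XL : X <= L by rewrite XE lerBlDr lerDl mulr_ge0.
  have s1 : N * X <= (good + 1 + b) * X by rewrite ler_wpM2r.
  have s2 : b * X <= 36 * k * L.
    apply: (@le_trans _ _ (36 * k * X)); first by rewrite ler_wpM2r.
    by rewrite ler_wpM2l // mulr_ge0.
  have s3 : X <= k * L by apply: le_trans XL _; rewrite ler_peMl.
  nra.
have s1 : N * X <= good * X by rewrite ler_wnM2r // ltW.
have s2 : 0 <= 37 * L / v * k * N by apply: le_trans e1; rewrite !mulr_ge0.
lra.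
Qed.

Let face_share (N a b : R) : 0 <= a -> 0 < b -> N <= 12 * a -> N * (24 * a * b)^-1 <= (2 * b)^-1.
Proof.
move=> a0 b0 Na; have [aE|an] := eqVneq a 0.
  by rewrite aE mulr0 mul0r invr0 mulr0 invr_ge0 mulr_ge0 // ltW.
have {a0 an}a0 : 0 < a by rewrite lt_neqAle eq_sym an.
rewrite ler_pdivrMr ?mulr_gt0 // mulrC.
have -> : 24 * a * b * (2 * b)^-1 = 12 * a by field; rewrite gt_eqF.
by [].
Qed.

(** Targets that are not harmful keep danger 0 and do not increase the number of self flags, so the
    correction [1 + s] remains valid at the next step. Harmful targets contribute at least 0. *)
Lemma share_lower r g z : (r <= m)%N -> partial_gluing g -> proper_flag z -> open g z.1 ->
  danger g (partner g z) = 0%N -> (nb_glued g + 2 * r = 2 * m)%N ->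
  (gain r - loss r * (1 + #|self_flags g|)%:R) * weight R g
    <= \sum_(h in completions g) share h z.
Proof.
elim: r g => [|r IH] g rm pg pz zo d0 Gm.
  rewrite /gain /loss !big_ord0 mul0r subrr mul0r; apply: sumr_ge0 => h _; exact: share_ge0.
set x := partner g z in d0.
have px : proper_flag x by exact: partner_proper.
have xo : open g x.1 by exact: partner_open.
have zE : partner g x = z by rewrite /x partnerK.
have [xz _] := danger0 px d0 px erefl; rewrite zE in xz.
set s := #|self_flags g|.
pose B y := (y != partner g x) &&
  ((danger (extend g x y) (next_end g x y) != 0)
   || (s < #|self_flags (extend g x y)|) || ~~ open (extend g x y) (partner g x).1)%N.
have cB : (#|[set y in targets g x | B y]| <= 36 * (1 + s))%N := card_danger0_step pg px xo d0.
have zT : z \in targets g x by apply/targetsP.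
pose X : R := gain r - loss r * (1 + s)%:R.
pose t : R := (2 * (m - r))%:R^-1.
pose F y : R := if y == z then t else if B y then 0 else X.
apply: (sum_completions_ge (x := x) (F := F)) => // [y yT|].
  have /targetsP[py yo yx] := yT.
  have ph := extend_partial pg px py xo yo yx; set h0 := extend g x y in ph *.
  rewrite /F; have [yz|yz] := eqVneq y z.
    rewrite -sum_completions1 // mulr_sumr; apply: ler_sum => h hC.
    rewrite mulr1 -[X in share _ X]yz; apply: le_trans (share_closed pg px xo yT _ hC); last by rewrite zE.
    rewrite /t (_ : 2 * (m - r) = nb_glued g + 2)%N //.
    by move: Gm; rewrite mulnS mulnBr => <-; rewrite addnA addnK.
  case By: (B y); first by rewrite mul0r; apply: sumr_ge0 => h _; exact: share_ge0.
  move: By; rewrite /B zE yz /= => /negbT; rewrite !negb_or !negbK -leqNgt => /andP[/andP[dn sn] zoh].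
  rewrite -/h0 in dn sn zoh.
  have nE : next_end g x y = partner h0 z by rewrite /next_end zE -/h0 zoh.
  have Gh : nb_glued h0 = (nb_glued g).+2 by exact: nb_glued_extend.
  have := IH h0 (ltnW rm) ph pz zoh; rewrite -nE => /(_ (eqP dn)) H.
  apply: le_trans (H _); last by rewrite Gh -Gm mulnS -addn2 addnA.
  rewrite ler_wpM2r ?weight_ge0 // /X lerD2l lerN2 ler_wpM2l ?loss_ge0 // ler_nat leq_add2l //.
rewrite /gain /loss !big_ord_recr /= -/(gain r) -/(loss r).
rewrite (bigD1 z) //= {1}/F eqxx.
pose good : R := #|[set y in targets g x | (y != z) && ~~ B y]|%:R.
have -> : \sum_(i in targets g x | i != z) F i = good * X.
  rewrite (bigID B) /= big1 ?add0r; last by move=> y /andP[/andP[_ /negbTE yz] By]; rewrite /F yz By.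
  rewrite (eq_bigr (fun=> X)); last first.
    by move=> y /andP[/andP[_ /negbTE yz] /negbTE By]; rewrite /F yz By.
  rewrite sumr_const -mulr_natl; congr (_%:R * _); apply: eq_card => y.
  by rewrite !inE andbA.
have splitT : (#|targets g x| = 1 + #|[set y in targets g x | B y]| +
    #|[set y in targets g x | (y != z) && ~~ B y]|)%N.
  rewrite (cardD1 z) zT -addnA; congr (_ + _)%N.
  rewrite -(cardID B [predD1 targets g x & z]); congr (_ + _)%N; apply: eq_card => y; rewrite !inE.
    by rewrite unfold_in /B zE; case: (y == z); rewrite /= ?andbF.
  by rewrite unfold_in; case: (y == z); rewrite /= ?andbF // andbC.
have nuN : nu%:R <= #|targets g x|%:R :> R.
  rewrite ler_nat card_targets_glued // leq_mul2l /= leq_sub_glued //.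
  by rewrite -Gm leq_add2l mulnS leq_addr.
have N12 : (#|targets g x| <= 12 * n)%N.
  rewrite card_targets_glued // -[12%N]/(3 * 4)%N -mulnA leq_mul2l /=.
  by rewrite (leq_trans (leq_pred _)) // leq_subr.
have mr : (0 < m - r)%N by rewrite subn_gt0.
apply: (@lower_step t _ _ good #|[set y in targets g x | B y]|%:R (gain r) (loss r)
  (1 + s)%:R nu%:R X); rewrite ?gain_ge0 ?loss_ge0 ?ler0n ?ltr0n //.
- by rewrite ler1n.
- rewrite /t natrM; apply: face_share; rewrite ?ler0n ?ltr0n //.
  by rewrite -natrM ler_nat.
- by rewrite ler_nat splitT leq_addl.
- by rewrite splitT !natrD addrC addrA; lra.
by rewrite -natrM ler_nat.
Qed.

End Lower.

(** * Simple edges *)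

Section SimpleLower.
Variables (R : realFieldType) (n : nat).
Implicit Types (g h : gluing n) (u v x y z : flag n).

Definition simple_flags h z : bool :=
  [forall u in edge_flags h z, forall v in edge_flags h z,
     (u.1.1 == v.1.1) ==> (u == v) || (u == turn v)].

Definition visited_tets h z : {set 'I_n} := [set v.1.1 | v in edge_flags h z].

Lemma simple_flagsP h z : reflect
  (forall u v, linked h z u -> linked h z v -> u.1.1 = v.1.1 -> u = v \/ u = turn v)
  (simple_flags h z).
Proof.
apply: (iffP forallP) => H u; last first.
  apply/implyP; rewrite mem_edge_flags => zu; apply/forallP=> v; apply/implyP.
  rewrite mem_edge_flags => zv; apply/implyP=> /eqP uv.
  by apply/orP; case: (H u v zu zv uv) => ->; rewrite eqxx; [left|right].
move=> v zu zv uv; have := H u; rewrite mem_edge_flags zu => /forallP/(_ v).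
by rewrite mem_edge_flags zv uv eqxx => /orP[] /eqP ->; [left|right].
Qed.

Lemma visited_tetsP h z v : linked h z v -> v.1.1 \in visited_tets h z.
Proof. by move=> zv; apply: (imset_f (fun v => v.1.1)); rewrite mem_edge_flags. Qed.

Section FreshStep.
Variables (g : gluing n) (z y : flag n).
Hypotheses (pg : partial_gluing g) (pz : proper_flag z) (zo : open g z.1).
Hypothesis sg : simple_flags g z.
Hypothesis visited : forall f, ~~ open g f -> f.1 \in visited_tets g z.
Let x := partner g z.
Hypotheses (py : proper_flag y) (yv : y.1.1 \notin visited_tets g z).
Let h := extend g x y.

Let px : proper_flag x. Proof. exact: partner_proper. Qed.
Let xo : open g x.1. Proof. exact: partner_open. Qed.
Let zx : linked g z x. Proof. exact: partner_linked. Qed.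

Lemma partner_other_face : z.1 != x.1.
Proof.
apply/eqP=> E; have := simple_flagsP _ _ sg z x (linked_refl _ _) zx.
rewrite E => /(_ erefl)[zE|zE]; first by have := partner_neq pg pz zo; rewrite -/x -zE eqxx.
by have := turn_face px; rewrite -zE E eqxx.
Qed.

Let old_face v : linked g z v -> v.1 != y.1.
Proof.
by move=> /visited_tetsP vv; apply: contraNneq yv => <-.
Qed.

Lemma fresh_target : y \in targets g x.
Proof.
apply/targetsP; split=> //; last by rewrite eq_sym; exact: old_face.
by apply: contraNT yv => /visited.
Qed.

Let yo : open g y.1. Proof. by have /targetsP[] := fresh_target. Qed.
Let yx : y.1 != x.1. Proof. by have /targetsP[] := fresh_target. Qed.
Let ph : partial_gluing h := extend_partial pg px py xo yo yx.
Let gh : extension g h := extend_extension xo yo.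

(** The tetrahedron of [y] has no glued face, so the path stops at [turn y]. Of the old flags only
    [x] lies on the glued faces. *)
Lemma fresh_edge_sub v : linked h z v -> v = y \/ v = turn y \/ linked g z v.
Proof.
have inS a : (a \in turn y |: (y |: edge_flags g z)) = [|| a == turn y, a == y | linked g z a].
  by rewrite !in_setU1 mem_edge_flags.
have tyo : open h (turn y).1.
  rewrite /h extend_open // turn_face // andbC /=.
  apply/andP; split; first by apply: contraNT yv => /visited.
  apply: contraNneq yv => E; have -> : y.1.1 = x.1.1 by rewrite -E.
  exact: visited_tetsP zx.
move=> zv; have : v \in turn y |: (y |: edge_flags g z).
  apply: linked_ind zv; last by rewrite inS linked_refl !orbT.
  move=> a; rewrite !inS => /or3P[/eqP->|/eqP->|za].
  - by rewrite turnK eqxx orbT cross_open // eqxx.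
  - by rewrite extend_cross_y // zx eqxx !orbT.
  split; last by rewrite (linked_trans za (linked_turn _ _)) !orbT.
  have [ax|ax] := eqVneq a.1 x.1; last first.
    by rewrite extend_cross_other ?old_face // (linked_trans za (linked_cross _ _)) !orbT.
  have [->|nax] := eqVneq a x; first by rewrite extend_cross_x // eqxx orbT.
  have naz : a != z by apply: contraNneq partner_other_face => <-; rewrite ax.
  have := partner_uniq pg pz zo za; rewrite ax => /(_ xo naz) aE.
  by rewrite aE eqxx in nax.
by rewrite inS => /or3P[/eqP|/eqP|]; auto.
Qed.

Lemma fresh_z_open : open h z.1.
Proof. by rewrite /h extend_open // partner_other_face old_face // linked_refl. Qed.

Lemma fresh_edge_card : #|edge_flags h z| = #|edge_flags g z| + 2.
Proof.
apply/eqP; rewrite eqn_leq; apply/andP; split.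
  apply: (@leq_trans #|turn y |: (y |: edge_flags g z)|).
    apply/subset_leq_card/subsetP=> v; rewrite mem_edge_flags => /fresh_edge_sub H.
    rewrite !in_setU1 mem_edge_flags.
    by case: H => [->|[->|->]]; rewrite ?eqxx ?orbT.
  by rewrite !cardsU1 addnA addnC leq_add2l; case: (_ \notin _); case: (_ \notin _).
have xz : partner g x = z by rewrite /x partnerK.
have yz : y != partner g x by rewrite xz; apply: contraNneq (old_face (linked_refl g z)) => ->.
rewrite (edge_flags_linked pg zx) (edge_flags_linked ph (linked_extension pg gh zx)).
exact: edge_flags_grow fresh_target yz.
Qed.

Lemma fresh_simple : simple_flags h z.
Proof.
have new v : linked g z v -> v.1.1 != y.1.1.
  by move=> /visited_tetsP vv; apply: contraNneq yv => <-.
have tt : (turn y).1.1 = y.1.1 by [].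
apply/simple_flagsP=> u v /fresh_edge_sub[->|[->|zu]] /fresh_edge_sub[->|[->|zv]] E;
  rewrite ?turnK; auto.
- by have := new _ zv; rewrite -E eqxx.
- by have := new _ zv; rewrite -E eqxx.
- by have := new _ zu; rewrite E eqxx.
- by have := new _ zu; rewrite E eqxx.
exact: (simple_flagsP _ _ sg).
Qed.

Lemma fresh_visited_card : #|visited_tets h z| <= #|visited_tets g z| + 1.
Proof.
apply: (@leq_trans #|y.1.1 |: visited_tets g z|); last first.
  by rewrite cardsU1 yv addnC.
apply/subset_leq_card/subsetP=> t /imsetP[v]; rewrite mem_edge_flags.
move=> /fresh_edge_sub[->|[->|zv]] ->; rewrite in_setU1 ?eqxx //.
by rewrite visited_tetsP ?orbT.
Qed.

Lemma fresh_visited f : ~~ open h f -> f.1 \in visited_tets h z.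
Proof.
have zxh : linked h z x := linked_extension pg gh zx.
rewrite /h (extend_open g yx).
have [->|fx] := eqVneq f x.1; first by move=> _; apply: visited_tetsP zxh.
have [->|fy /= fo] := eqVneq f y.1.
  by move=> _; apply: visited_tetsP; apply: linked_trans zxh _; apply: linked_y fresh_target.
have /imsetP[v] := visited fo; rewrite mem_edge_flags => zv ->.
by apply: visited_tetsP; exact: linked_extension zv.
Qed.

End FreshStep.

Local Open Scope ring_scope.

Definition simple_of_size k h z : bool := (#|edge_flags h z| == 2 * k)%N && simple_flags h z.

(** With [t + 1] new tetrahedra still to enter, at most [k - t.+1] have been visited and all 12
    flags of every other one are admissible; the first factor is the closing step. *)
Definition simple_rate k r : R :=
  (12 * n%:R)^-1 * \prod_(t < r) ((n - (k - t.+1))%:R / n%:R).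

Lemma card_targets_le g x : open g x.1 -> (#|targets g x| <= 12 * n)%N.
Proof.
move=> xo; rewrite card_targets_glued // -[12%N]/(3 * 4)%N -mulnA leq_mul2l /=.
by rewrite (leq_trans (leq_pred _)) // leq_subr.
Qed.

Lemma simple_lower k r g z : (r < k)%N -> partial_gluing g -> proper_flag z -> open g z.1 ->
  #|edge_flags g z| = (2 * (k - r))%N -> simple_flags g z ->
  (#|visited_tets g z| <= k - r)%N -> (forall f, ~~ open g f -> f.1 \in visited_tets g z) ->
  simple_rate k r * weight R g <= \sum_(h in completions g) (simple_of_size k h z)%:R.
Proof.
elim: r g => [|r IH] g rk pg pz zo ez sg vz vis; set x := partner g z.
all: have px : proper_flag x by exact: partner_proper.
all: have xo : open g x.1 by exact: partner_open.
all: have zx : linked g z x by exact: partner_linked.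
all: have n0 : 0 < n%:R :> R by rewrite ltr0n; case: (n) z.1.1 => [[]|].
all: have xz : z.1 != x.1 by exact: partner_other_face.
  have zT : z \in targets g x by apply/targetsP.
  pose F y : R := (y == z)%:R.
  apply: (sum_completions_ge (x := x) (F := F)) => // [y yT|].
    rewrite /F; have [->|yz] := eqVneq y z; last first.
      by rewrite mul0r sumr_ge0 // => h _; rewrite ler0n.
    have pe := extend_partial pg px pz xo zo xz.
    have [cl fl] := close_direct pg px xo zT (esym (partnerK pg pz zo)).
    have ezx : edge_flags (extend g x z) z = edge_flags (extend g x z) x.
      by rewrite -(edge_flags_linked pe (linked_y px zT)).
    rewrite mul1r -sum_completions1 //; apply: ler_sum => h hC.
    have hG : partial_gluing h by apply: gluings_partial; have /completionsP[] := hC.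
    have eh : edge_flags h z = edge_flags g z.
      have /completionsP[_ gh] := hC.
      rewrite -(edge_flags_linked hG (linked_extension pe gh (linked_y px zT))).
      by rewrite (edge_flags_completion_closed pe hC cl) fl -(edge_flags_linked pg zx).
    by rewrite /simple_of_size /simple_flags eh ez subn0 eqxx /= -/(simple_flags g z) sg.
  rewrite (bigD1 z) //= {1}/F eqxx big1 ?addr0; last by move=> y /andP[_ /negbTE yz]; rewrite /F yz.
  rewrite /simple_rate big_ord0 mulr1 mulrC ler_pdivrMr ?mulr_gt0 // mul1r -natrM ler_nat.
  exact: card_targets_le.
pose F y : R := if y.1.1 \in visited_tets g z then 0 else simple_rate k r.
have kr : (k - r = (k - r.+1).+1)%N by rewrite subnSK // ltnW.
apply: (sum_completions_ge (x := x) (F := F)) => // [y yT|].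
  rewrite /F; case: ifPn => yv; first by rewrite mul0r sumr_ge0 // => h _; rewrite ler0n.
  have /targetsP[py yo yx] := yT.
  apply: IH => //.
  - exact: ltnW.
  - exact: extend_partial.
  - exact: fresh_z_open.
  - by rewrite fresh_edge_card // ez kr mulnS addnC.
  - exact: fresh_simple.
  - by rewrite kr -addn1; apply: leq_trans (fresh_visited_card _ _ _ _ _ _ _) _; rewrite // leq_add2r.
  exact: fresh_visited.
rewrite (bigID (fun y => y.1.1 \in visited_tets g z)) /= big1 ?add0r; last first.
  by move=> y /andP[_ yv]; rewrite /F yv.
rewrite (eq_bigr (fun=> simple_rate k r)); last by move=> y /andP[_ /negbTE yv]; rewrite /F yv.
rewrite sumr_const -[leRHS]mulr_natr /simple_rate big_ord_recr /=.
have [w wE] : exists w : R, (n - (k - r.+1))%:R / n%:R = w by eexists.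
rewrite wE -!mulrA ler_wpM2l //.
  by rewrite invr_ge0 mulr_ge0 ?ler0n // ltW.
rewrite ler_wpM2l //; first by rewrite prodr_ge0 // => t _; rewrite divr_ge0 ?ler0n.
apply: (@le_trans _ _ (12 * (n - (k - r.+1)))%:R).
  rewrite -wE mulrAC ler_pdivrMr // -!natrM ler_nat mulnC.
  rewrite -mulnA [((n - _) * n)%N]mulnC mulnA leq_mul2r; apply/orP; right.
  exact: card_targets_le.
rewrite ler_nat; apply: (@leq_trans (12 * #|~: visited_tets g z|)).
  rewrite leq_mul2l /=; have := cardsC (visited_tets g z); rewrite card_ord => E.
  by rewrite leq_subLR -{1}E leq_add2r.
rewrite -card_flags_in_tets; apply/subset_leq_card/subsetP=> y; rewrite !inE => /andP[py yv].
by rewrite unfold_in /= fresh_target.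
Qed.

(** All factors lie in [0, 1] and are at least [1 - k / n]; the product is at least 1 minus the sum
    of the defects. *)
Lemma simple_rate_ge k r : (r <= k)%N ->
  (12 * n%:R)^-1 * (1 - (r * k)%:R / n%:R) <= simple_rate k r.
Proof.
case: (posnP n) => [n0|n0] rk; first by rewrite /simple_rate n0 mulr0 invr0 !mul0r.
have n0' : 0 < n%:R :> R by rewrite ltr0n.
rewrite /simple_rate ler_wpM2l ?invr_ge0 ?mulr_ge0 ?ler0n //.
elim: r rk => [|r IH] rk; first by rewrite big_ord0 mul0n mul0r subr0.
rewrite big_ord_recr /=; set P := \prod_(t < r) _.
have P0 : 0 <= P by apply: prodr_ge0 => t _; rewrite divr_ge0 ?ler0n.
have {}IH := IH (ltnW rk); rewrite -/P in IH.
set w : R := (n - (k - r.+1))%:R / n%:R.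
have w0 : 0 <= w by rewrite divr_ge0 ?ler0n.
have w1 : 1 - k%:R / n%:R <= w.
  rewrite /w -[X in X - _](@mulfV _ n%:R) ?gt_eqF // -mulrBl ler_wpM2r ?invr_ge0 ?ler0n //.
  rewrite lerBlDr -natrD ler_nat; apply: leq_trans (_ : n <= n - (k - r.+1) + (k - r.+1))%N _.
    by rewrite addnC -leq_subLR.
  by rewrite leq_add2l leq_subr.
have wle : w <= 1 by rewrite ler_pdivrMr // mul1r ler_nat leq_subr.
rewrite mulSn natrD mulrDl; set a := k%:R / n%:R in w1 *; set b := (r * k)%:R / n%:R in IH *.
have a0 : 0 <= a by rewrite divr_ge0 ?ler0n.
have b0 : 0 <= b by rewrite divr_ge0 ?ler0n.
have [P1|P1] := leP (1 - b) 0; first by apply: (@le_trans _ _ 0); [lra|rewrite mulr_ge0].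
have [A1|A1] := leP (1 - a) 0; first by apply: (@le_trans _ _ 0); [lra|rewrite mulr_ge0].
apply: (@le_trans _ _ ((1 - b) * (1 - a))); first nra.
by apply: ler_pM => //; apply: ltW.
Qed.

End SimpleLower.

(** * Edges as classes of flags *)

Section Classes.
Variable n : nat.
Implicit Types (g h : gluing n) (u v w x y z : flag n) (a b : tet_edge n).

Definition flag_edge u : tet_edge n := (u.1.1, ~: [set u.1.2; u.2]).

Lemma flag_edge_turn u : flag_edge (turn u) = flag_edge u.
Proof. by rewrite /flag_edge /= setUC. Qed.

Lemma flag_edge_tet_edge u : proper_flag u -> flag_edge u \in tet_edges n.
Proof.
move=> pu; rewrite inE /=; have := cardsC [set u.1.2; u.2].
by rewrite cards2 (eq_sym u.1.2) -/(proper_flag u) pu card_ord => /eqP; rewrite -[4]/(2 + 2) eqn_add2l.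
Qed.

Lemma tet_edge_flag a : a \in tet_edges n -> exists2 u, proper_flag u & a = flag_edge u.
Proof.
case: a => t A; rewrite inE /= => cA.
have : #|~: A| == 2.
  by have := cardsC A; rewrite (eqP cA) card_ord => /eqP; rewrite -[4]/(2 + 2) eqn_add2l.
case/cards2P=> i [i' [ii E]]; exists ((t, i), i'); first by rewrite /proper_flag /= eq_sym.
by rewrite /flag_edge /= -E setCK.
Qed.

(** A tetrahedron edge lies in exactly two faces: proper flags cover tetrahedron edges twice, with
    [turn] exchanging the sheets. *)
Lemma flag_edge_inj u v : proper_flag u -> flag_edge u = flag_edge v -> u = v \/ u = turn v.
Proof.
case: u v => [[t i] j] [[t' i'] j'] pu [<- /setC_inj/setP E]; rewrite /turn /=.
move: pu; rewrite /proper_flag /= => ji.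
have := E i; have := E j; rewrite !inE !eqxx orbT.
move=> /esym/orP[] /eqP jE /esym/orP[] /eqP iE; rewrite ?iE ?jE; auto.
- by move: ji; rewrite jE iE eqxx.
- by move: ji; rewrite jE iE eqxx.
Qed.

Section Partial.
Variable h : gluing n.
Hypothesis ph : partial_gluing h.

Lemma glued_flag a b : glued h a b -> a \in tet_edges n ->
  exists2 u, proper_flag u & a = flag_edge u /\ b = flag_edge (cross h u).
Proof.
move=> /existsP[i /and3P[ia /eqP b1 /eqP b2]] aE.
have [u0 pu0 aE'] := tet_edge_flag aE.
have [u [pu ui ae]] : exists u, [/\ proper_flag u, u.1.2 = i & a = flag_edge u].
  move: ia; rewrite {1}aE' inE negbK => /set2P[] ->; first by exists u0.
  by exists (turn u0); rewrite proper_turn flag_edge_turn.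
exists u => //; split=> //; rewrite [b]surjective_pairing b1 b2 ae -ui.
rewrite /flag_edge /cross /= -surjective_pairing -(pg_perm ph); congr (_, _).
apply/setP=> j; rewrite -{1}[j](permKV (h.2 u.1)) mem_imset; last exact: perm_inj.
by rewrite !inE !(can2_eq (permKV _) (permK _)).
Qed.

Lemma flag_glued u : proper_flag u -> glued h (flag_edge u) (flag_edge (cross h u)).
Proof.
move=> pu; apply/existsP; exists u.1.2; rewrite inE negbK set21 /= -surjective_pairing eqxx /=.
apply/eqP; rewrite -(pg_perm ph); apply/setP=> j.
rewrite -{2}[j](permKV (h.2 u.1)) mem_imset; last exact: perm_inj.
by rewrite !inE !(can2_eq (permKV _) (permK _)).
Qed.

Definition edge_class u : {set tet_edge n} := [set flag_edge v | v in edge_flags h u].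

(** [glued] is [cross] seen on tetrahedron edges, where [turn] becomes invisible; the classes are
    thus the images of the components of flags. *)
Lemma connect_glued u b : proper_flag u ->
  connect (glued h) (flag_edge u) b = (b \in edge_class u).
Proof.
move=> pu; apply/idP/idP.
  have : flag_edge u \in edge_class u by apply: imset_f; rewrite mem_edge_flags linked_refl.
  move: (flag_edge u) => a aS /connectP[p pth ->].
  elim: p a aS pth => //= c p IH a aS /andP[ac]; apply: IH.
  case/imsetP: aS => v; rewrite mem_edge_flags => uv aE.
  have pv : proper_flag v by rewrite (linked_proper ph uv).
  have [w pw [aw ->]] : exists2 w, proper_flag w & a = flag_edge w /\ c = flag_edge (cross h w).
    by apply: glued_flag ac _; rewrite aE; exact: flag_edge_tet_edge.
  apply: imset_f; rewrite mem_edge_flags; apply: linked_trans (linked_cross h w).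
  have [->|->] := flag_edge_inj pw (etrans (esym aw) aE) => //.
  exact: linked_trans uv (linked_turn _ _).
case/imsetP=> v; rewrite mem_edge_flags => uv ->.
have : v \in [set v | proper_flag v && connect (glued h) (flag_edge u) (flag_edge v)].
  apply: linked_ind uv; last by rewrite inE pu connect0.
  move=> c; rewrite !inE => /andP[pc uc]; rewrite proper_turn proper_cross // pc flag_edge_turn.
  by split=> //; apply: connect_trans uc (connect1 (flag_glued pc)).
by rewrite inE => /andP[].
Qed.

Lemma edge_class_linked u v : linked h u v -> edge_class u = edge_class v.
Proof. by move=> uv; rewrite /edge_class (edge_flags_linked ph uv). Qed.

Lemma edge_class_eq u v : proper_flag u -> proper_flag v ->
  (edge_class u == edge_class v) = linked h v u.
Proof.
move=> pu pv; apply/eqP/idP => [E|vu]; last by rewrite (edge_class_linked vu).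
have : flag_edge u \in edge_class v.
  by rewrite -E; apply: imset_f; rewrite mem_edge_flags linked_refl.
case/imsetP=> w; rewrite mem_edge_flags => vw /(flag_edge_inj pu)[->|->] //.
exact: linked_trans vw (linked_turn _ _).
Qed.

Lemma edgesE : edges h = [set edge_class u | u in [set u | proper_flag u]].
Proof.
apply/setP=> X; apply/imsetP/imsetP => [[a aE ->]|[u]].
  have [u pu ->] := tet_edge_flag aE; exists u; first by rewrite inE.
  apply/setP=> b; rewrite inE connect_glued //.
  apply: andb_idl => /imsetP[v]; rewrite mem_edge_flags => uv ->.
  by rewrite flag_edge_tet_edge // (linked_proper ph uv).
rewrite inE => pu ->; exists (flag_edge u); first exact: flag_edge_tet_edge.
apply/setP=> b; rewrite inE connect_glued //; apply/esym/andb_idl.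
move=> /imsetP[v]; rewrite mem_edge_flags => uv ->.
by rewrite flag_edge_tet_edge // (linked_proper ph uv).
Qed.

Lemma card_edge_flags u : proper_flag u -> #|edge_flags h u| = 2 * #|edge_class u|.
Proof.
move=> pu; rewrite -sum1_card (partition_big_imset flag_edge) /= -/(edge_class u).
rewrite mulnC -sum_nat_const; apply: eq_bigr => b /imsetP[v]; rewrite mem_edge_flags => uv ->.
have pv : proper_flag v by rewrite (linked_proper ph uv).
have vt : v != turn v by apply: contraTneq (turn_face pv) => <-; rewrite eqxx.
rewrite sum1_card; transitivity #|[set v; turn v]|; last by rewrite cards2 vt.
apply: eq_card => w; rewrite !inE.
rewrite unfold_in mem_edge_flags; apply/andP/orP.
  case=> uw /eqP; have pw : proper_flag w by rewrite (linked_proper ph uw).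
  by move=> /(flag_edge_inj pw)[->|->]; rewrite eqxx; [left|right].
case=> /eqP ->; rewrite ?flag_edge_turn eqxx; split=> //.
exact: linked_trans uv (linked_turn _ _).
Qed.

Lemma edge_class_simple u : simple_flags h u -> simple_edge (edge_class u).
Proof.
move=> /simple_flagsP su; apply/forallP=> t; apply/card_le1_eqP => a b.
rewrite !inE => /andP[/imsetP[v + ->] /eqP vt] /andP[/imsetP[w + ->] /eqP wt].
rewrite !mem_edge_flags => uv uw.
have vw : v.1.1 = w.1.1 by move: vt wt; rewrite /flag_edge /= => -> ->.
by case: (su _ _ uv uw vw) => ->; rewrite ?flag_edge_turn.
Qed.

(** Every edge is distributed equally over its flags, which turns sums over edges into sums over
    possible starting points. *)
Lemma sum_edges (R : realFieldType) (phi : {set tet_edge n} -> R) :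
  (\sum_(X in edges h) phi X =
   \sum_(u | proper_flag u) phi (edge_class u) / #|edge_flags h u|%:R)%R.
Proof.
rewrite [RHS](partition_big edge_class (mem (edges h))) /=; last first.
  by move=> u pu; rewrite edgesE imset_f // inE.
apply: eq_bigr => X; rewrite edgesE => /imsetP[u0]; rewrite inE => pu0 ->.
rewrite (eq_bigl (mem (edge_flags h u0))) => [|u].
  rewrite (eq_bigr (fun=> phi (edge_class u0) / #|edge_flags h u0|%:R)%R); last first.
    move=> u; rewrite inE mem_edge_flags => u0u.
    by rewrite (edge_class_linked u0u) (edge_flags_linked ph u0u).
  rewrite sumr_const -[RHS]mulr_natr divfK // pnatr_eq0 -lt0n.
  by apply/card_gt0P; exists u0; rewrite mem_edge_flags linked_refl.
rewrite inE mem_edge_flags; apply/andP/idP => [[pu]|u0u]; first by rewrite edge_class_eq.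
have pu : proper_flag u by rewrite (linked_proper ph u0u).
by rewrite pu edge_class_eq.
Qed.

End Partial.
End Classes.

(** * Expectations *)

Section Expectations.
Variables (R : realFieldType) (n : nat).
Implicit Types (g h : gluing n) (u v w x y z : flag n).
Local Open Scope ring_scope.

Let G0 : 0 < #|gluings n|%:R :> R.
Proof. by rewrite ltr0n card_gluings_gt0. Qed.

Let weight_unglued : weight R (unglued n) = #|gluings n|%:R.
Proof. by rewrite /weight -card_completions ?unglued_partial // completions_unglued. Qed.

Lemma mean_le (X Y : gluing n -> R) :
  (forall h, h \in gluings n -> X h <= Y h) -> mean X <= mean Y.
Proof. by move=> XY; rewrite /mean ler_wpM2r ?invr_ge0 ?ler0n // ler_sum. Qed.

Lemma eq_mean (X Y : gluing n -> R) :
  (forall h, h \in gluings n -> X h = Y h) -> mean X = mean Y.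
Proof. by move=> XY; rewrite /mean (eq_bigr _ XY). Qed.

Lemma meanD (X Y : gluing n -> R) : mean (fun h => X h + Y h) = mean X + mean Y.
Proof. by rewrite /mean big_split mulrDl. Qed.

Lemma mean_const (c : R) : mean (fun _ : gluing n => c) = c.
Proof. by rewrite /mean sumr_const -[_ *+ _]mulr_natr mulfK // gt_eqF. Qed.

Lemma mean_sum (I : Type) (r : seq I) (P : pred I) (X : I -> gluing n -> R) :
  mean (fun h => \sum_(i <- r | P i) X i h) = \sum_(i <- r | P i) mean (X i).
Proof. by rewrite /mean exchange_big mulr_suml. Qed.

Lemma meanZ (c : R) (X : gluing n -> R) : mean (fun h => c * X h) = c * mean X.
Proof. by rewrite /mean -mulr_sumr mulrA. Qed.

Lemma mean_ler (X : gluing n -> R) c :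
  \sum_(h in gluings n) X h <= c * #|gluings n|%:R -> mean X <= c.
Proof. by rewrite /mean ler_pdivrMr. Qed.

Lemma mean_ger (X : gluing n -> R) c :
  c * #|gluings n|%:R <= \sum_(h in gluings n) X h -> c <= mean X.
Proof. by rewrite /mean ler_pdivlMr. Qed.

Lemma card_proper_flags : #|[set u : flag n | proper_flag u]| = (12 * n)%N.
Proof.
have := card_flags_in_tets [set: 'I_n]; rewrite cardsT card_ord => <-.
by apply: eq_card => u; rewrite !inE andbT.
Qed.

Lemma sum_proper_flags (c : R) : \sum_(u : flag n | proper_flag u) c = 12 * n%:R * c.
Proof.
rewrite (eq_bigl (mem [set u : flag n | proper_flag u])); last by move=> u; rewrite /= inE.
by rewrite sumr_const card_proper_flags -[_ *+ _]mulr_natl natrM.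
Qed.

Lemma card_set_pred (T : finType) (A : {set T}) (P : pred T) :
  #|[set X in A | P X]|%:R = \sum_(X in A) (P X)%:R :> R.
Proof.
rewrite -sum1_card natr_sum [LHS]big_mkcond [RHS]big_mkcond.
by apply: eq_bigr => X _; rewrite inE; case: (X \in A); case: (P X).
Qed.

Lemma edge_sizeP h u k : partial_gluing h -> proper_flag u ->
  (#|edge_class h u| == k) = (#|edge_flags h u| == 2 * k)%N.
Proof. by move=> ph pu; rewrite card_edge_flags // eqn_pmul2l. Qed.

Lemma EE_sizeE k : EE_size R n k =
  \sum_(u : flag n | proper_flag u)
    (2 * k%:R)^-1 * mean (fun h => (#|edge_flags h u| == 2 * k)%N%:R).
Proof.
rewrite /EE_size -(eq_bigr _ (fun u _ => meanZ _ _)) -mean_sum; apply: eq_mean => h hG.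
have ph := gluings_partial hG.
rewrite /nb_edges_size card_set_pred sum_edges //; apply: eq_bigr => u pu.
rewrite edge_sizeP //; case: eqP => [->|_]; last by rewrite mul0r mulr0.
by rewrite mul1r mulr1 natrM.
Qed.

(** [size_upper] from the unglued state, for the single size [2 * k] in flags. With
    [M0 = 4 * n - 2 * k] there is room for [k] steps, and [12 * n] flags of share [1 / (2 * k)] give
    the factor in front. *)
Lemma EE_size_le k (nu : R) : (0 < k)%N -> (2 * k <= 4 * n)%N ->
  (12 * (4 * n - (4 * n - 2 * k) + 2) * 224 <= 3 * (4 * n - 2 * k).+1)%N ->
  nu = (3 * (4 * n - 2 * k).+1)%:R ->
  EE_size R n k <= 6 * n%:R / k%:R *
    (nu^-1 + 12 * 4032 / nu ^+ 2 * (k%:R * growth R (4 * n - 2 * k) ^+ k)).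
Proof.
move=> k0 kn small nuE; rewrite EE_sizeE; set B := (nu^-1 + _).
have main u : proper_flag u -> mean (fun h => (#|edge_flags h u| == 2 * k)%N%:R) <= B.
  move=> pu; apply: mean_ler; rewrite -weight_unglued -completions_unglued.
  have ALim a : (a == 2 * k)%N -> (a < (2 * k).+1)%N by move=> /eqP->.
  apply: le_trans (size_upper R ALim small (r := k) (unglued_partial n) pu (unglued_open _) _ _) _.
  - by rewrite nb_open_unglued subnK.
  - by have := edge_flags_unglued pu; rewrite -(ltn_add2r (2 * k)); apply: leq_trans; rewrite ltnS leq_addl.
  rewrite ler_wpM2r ?weight_ge0 // danger_unglued // self_flags_unglued.
  rewrite /size_bound /danger_weight /self_weight !muln0 mulr0 mul0r addr0 addn0 exp1n mulr1.
  rewrite /B nuE lerD2r // -[leRHS]mul1r ler_wpM2r ?invr_ge0 ?ler0n //.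
  rewrite lern1 /nb_sizes; case: (leqP #|edge_flags (unglued n) u| (2 * k)%N) => [lk|kl].
    rewrite big_nat_recr //= eqxx big_nat big1 // => a /andP[_ ak].
    by rewrite (ltn_eqF ak).
  by rewrite big_geq.
apply: (@le_trans _ _ (\sum_(u : flag n | proper_flag u) (2 * k%:R)^-1 * B)).
  by apply: ler_sum => u pu; rewrite ler_wpM2l ?main // invr_ge0 mulr_ge0 ?ler0n.
rewrite sum_proper_flags mulrA ler_wpM2r //.
  have g0 : 0 <= growth R (4 * n - 2 * k) by apply: le_trans (growth_ge1 _ _); rewrite ler01.
  by rewrite /B nuE addr_ge0 ?mulr_ge0 ?invr_ge0 ?exprn_ge0 ?ler0n.
rewrite invfM mulrACA (_ : 12 / 2 = 6) //; first by rewrite mulrA.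
by lra.
Qed.

Lemma EE_simple_le k : EE_simple R n k <= EE_size R n k.
Proof.
apply: mean_le => h _; rewrite ler_nat; apply/subset_leq_card/subsetP=> X.
by rewrite !inE => /and3P[-> _ ->].
Qed.

Lemma EE_nonsimpleE k : EE_nonsimple R n k = EE_size R n k - EE_simple R n k.
Proof.
rewrite /EE_nonsimple /mean -mulrBl; congr (_ / _).
by rewrite sumrB.
Qed.

Lemma EE_rangeE k1 k2 : EE_range R n k1 k2 = \sum_(k1 <= l < k2.+1) EE_size R n l.
Proof. by rewrite /EE_range mean_sum. Qed.

Lemma EE_simple_ge k : (0 < k)%N -> (0 < n)%N ->
  (2 * k%:R)^-1 * (1 - (k ^ 2)%:R / n%:R) <= EE_simple R n k.
Proof.
move=> k0 n0; have n0' : 0 < n%:R :> R by rewrite ltr0n.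
pose S u := mean (fun h : gluing n => (simple_of_size k h u)%:R : R).
apply: (@le_trans _ _ (\sum_(u : flag n | proper_flag u) (2 * k%:R)^-1 * S u)); last first.
  rewrite -(eq_bigr _ (fun u _ => meanZ _ _)) -mean_sum; apply: mean_le => h hG.
  have ph := gluings_partial hG.
  rewrite /nb_simple_edges_size card_set_pred sum_edges //; apply: ler_sum => u pu.
  rewrite /simple_of_size; case: eqP => [ek|_] /=; last by rewrite mulr0 divr_ge0 ?ler0n.
  case sf : (simple_flags h u); last by rewrite mulr0 divr_ge0 ?ler0n.
  by rewrite (edge_class_simple sf) edge_sizeP // ek eqxx mulr1 mul1r natrM.
have main u : proper_flag u -> (12 * n%:R)^-1 * (1 - (k ^ 2)%:R / n%:R) <= S u.
  move=> pu; apply: (@le_trans _ _ (simple_rate R n k k.-1)).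
    apply: le_trans (simple_rate_ge R n (leq_pred k)).
    rewrite ler_wpM2l ?invr_ge0 ?mulr_ge0 ?ler0n // lerD2l lerN2 ler_wpM2r ?invr_ge0 ?ler0n //.
    by rewrite ler_nat -mulnn leq_mul2r leq_pred orbT.
  apply: mean_ger; rewrite -weight_unglued -completions_unglued.
  have ck v : linked (unglued n) u v -> v = u \/ v = turn u.
    move=> uv; have : v \in [set u; turn u].
      apply: linked_ind uv; last exact: set21.
      move=> a /set2P[] ->; rewrite cross_open ?unglued_open ?unglued_partial //.
        by rewrite set21 set22.
      by rewrite turnK set21 set22.
    by move=> /set2P.
  have k1 : (k - k.-1 = 1)%N by rewrite -{1}(prednK k0) subSnn.
  apply: simple_lower; rewrite ?unglued_partial ?unglued_open ?prednK ?k1 //.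
  - apply/eqP; rewrite eqn_leq edge_flags_unglued // andbT.
    apply: (@leq_trans #|[set u; turn u]|); last by rewrite cards2; case: (_ != _).
    apply/subset_leq_card/subsetP=> v; rewrite mem_edge_flags => /ck[]->; rewrite ?set21 ?set22 //.
  - apply/simple_flagsP=> v w /ck[]-> /ck[]-> _; rewrite ?turnK; auto.
  - apply: (@leq_trans #|[set u.1.1]|); last by rewrite cards1.
    apply/subset_leq_card/subsetP=> t /imsetP[v]; rewrite mem_edge_flags => /ck[] -> ->;
      by rewrite inE.
  by move=> f; rewrite unglued_open.
apply: (@le_trans _ _ (\sum_(u : flag n | proper_flag u)
    (2 * k%:R)^-1 * ((12 * n%:R)^-1 * (1 - (k ^ 2)%:R / n%:R)))); last first.
  by apply: ler_sum => u pu; rewrite ler_wpM2l ?main // invr_ge0 mulr_ge0 ?ler0n.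
rewrite sum_proper_flags mulrCA [12 * _ * (_ * _)]mulrA mulfV ?mul1r // mulf_neq0 ?gt_eqF //.
Qed.

Lemma EE_ge : (0 < n)%N -> 12 * n%:R * (gain R n n n - loss R n n n) <= EE R n.
Proof.
move=> n0; apply: (@le_trans _ _ (\sum_(u : flag n | proper_flag u)
    mean (fun h : gluing n => share R h u))).
  rewrite -sum_proper_flags; apply: ler_sum => u pu; apply: mean_ger.
  rewrite -weight_unglued -completions_unglued.
  have pt : partner (unglued n) u = turn u by exact: partner_unglued.
  have m_le : (2 * n <= 4 * n)%N by rewrite leq_mul2r orbT.
  have := @share_lower R n n m_le n (unglued n) u.
  rewrite pt danger_unglued ?proper_turn // nb_glued_unglued self_flags_unglued addn0 mulr1.
  by apply; rewrite ?unglued_partial ?unglued_open.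
rewrite -mean_sum; apply: mean_le => h hG; have ph := gluings_partial hG.
rewrite /nb_edges -sum1_card natr_sum.
rewrite (partition_big (edge_class h) (mem (edges h))) /=; last first.
  by move=> u pu; rewrite edgesE // imset_f // inE.
apply: ler_sum => X; rewrite edgesE // => /imsetP[u0]; rewrite inE => pu0 ->.
have E u : proper_flag u -> edge_class h u == edge_class h u0 -> edge_flags h u = edge_flags h u0.
  by move=> pu; rewrite edge_class_eq // => H; rewrite (edge_flags_linked ph H).
apply: (@le_trans _ _ (\sum_(u in edge_flags h u0) share R h u)).
  rewrite [leLHS]big_mkcond [leRHS]big_mkcond; apply: ler_sum => u _; case: ifP => [/andP[pu eu]|_].
    by rewrite -(E u pu eu) mem_edge_flags linked_refl.
  by case: ifP => _ //; rewrite share_ge0.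
have c0 := touched_faces_gt0 h u0.
apply: (@le_trans _ _ (\sum_(u in [set u in edge_flags h u0 | lone h u])
    #|touched_faces h u0|%:R^-1)).
  rewrite [leRHS]big_mkcond [leLHS]big_mkcond; apply: ler_sum => u _; rewrite inE.
  case: ifP => //= uE; rewrite /share /touched_faces.
  have -> : edge_flags h u = edge_flags h u0.
    by rewrite -(edge_flags_linked ph (x := u0)) // -mem_edge_flags.
  by case: (lone h u); rewrite ?mul1r ?mul0r.
rewrite sumr_const -[_ *+ _]mulr_natl ler_pdivrMr ?ltr0n // mul1r ler_nat.
rewrite -(card_in_imset (f := fun u : flag n => u.1)).
  apply/subset_leq_card/subsetP=> f /imsetP[u]; rewrite inE => /andP[uE _] ->.
  exact: imset_f.
move=> u v; rewrite !inE !mem_edge_flags => /andP[u0u _] /andP[u0v /forallP/(_ u) H] uv.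
move: H; rewrite mem_edge_flags (linked_trans _ u0u) /= ?uv ?eqxx; last by rewrite linked_sym.
by move=> /eqP.
Qed.

Lemma EE_le m : EE R n <= \sum_(1 <= k < m.+1) EE_size R n k + 6 * n%:R / m.+1%:R.
Proof.
rewrite -mean_sum -(mean_const (6 * n%:R / _)) -meanD; apply: mean_le => h hG.
have ph := gluings_partial hG.
have tot : \sum_(X in edges h) #|X|%:R / m.+1%:R = 6 * n%:R / m.+1%:R :> R.
  rewrite -mulr_suml (sum_edges ph (fun X => #|X|%:R)); congr (_ / _).
  rewrite (eq_bigr (fun=> 2^-1)) => [|u pu].
    by rewrite sum_proper_flags; lra.
  have c0 : #|edge_class h u|%:R != 0 :> R.
    rewrite pnatr_eq0 -lt0n; apply/card_gt0P; exists (flag_edge u); apply: imset_f.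
    by rewrite mem_edge_flags linked_refl.
  by rewrite card_edge_flags // natrM invfM mulrCA mulfV // mulr1.
rewrite -tot /nb_edges -sum1_card natr_sum.
rewrite (eq_bigr (fun k => \sum_(X in edges h) (#|X| == k)%:R)); last first.
  by move=> k _; rewrite card_set_pred.
rewrite exchange_big -big_split /=; apply: ler_sum => X XE.
have X0 : (0 < #|X|)%N.
  move: XE; rewrite edgesE // => /imsetP[u pu ->]; apply/card_gt0P.
  by exists (flag_edge u); apply: imset_f; rewrite mem_edge_flags linked_refl.
have s0 : 0 <= \sum_(1 <= i < m.+1) (#|X| == i)%:R :> R.
  by apply: sumr_ge0 => i _; rewrite ler0n.
have [mX|Xm] := ltnP m #|X|.
  rewrite -[leLHS]add0r lerD // ler_pdivlMr ?ltr0n // mul1r ler_nat //.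
rewrite -[leLHS]addr0 lerD ?divr_ge0 ?ler0n //.
rewrite (bigD1_seq #|X|) ?iota_uniq //=; last by rewrite mem_index_iota X0 ltnS.
by rewrite eqxx lerDl sumr_ge0 // => i _; rewrite ler0n.
Qed.

End Expectations.

(** * Expected number of adjacent small pairs *)

Section PairExpectation.
Variables (R : realFieldType) (n : nat).
Implicit Types (g h : gluing n) (u v w x y z b : flag n).
Local Open Scope ring_scope.

(** [small_pair_le] requires [b] off the faces of both ends of the first path, which are [u] and
    [turn u] at the start. *)
Definition transverse u : {set flag n} :=
  [set b | [&& proper_flag b, b.1.1 == u.1.1, b.1 != u.1 & b.1 != (turn u).1]].

Lemma card_transverse u : (#|transverse u| <= 12)%N.
Proof.
apply: (@leq_trans (12 * #|[set u.1.1]|)); last by rewrite cards1.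
rewrite -card_flags_in_tets; apply/subset_leq_card/subsetP=> b.
by rewrite !inE => /and4P[-> -> _ _].
Qed.

(** Two faces of a tetrahedron share a single edge, so if both faces at the edge of [w] are those of
    [u], the two edges coincide. *)
Lemma transverse_or_linked u w : proper_flag w -> w.1.1 = u.1.1 ->
  [\/ w \in transverse u, turn w \in transverse u, w = u | w = turn u].
Proof.
move=> pw wu; have twu : (turn w).1.1 = u.1.1 by [].
rewrite !inE proper_turn pw wu twu eqxx !andTb.
have [wu1|wu1] := eqVneq w.1 u.1.
  have [tw|tw] := eqVneq (turn w).1 (turn u).1.
    by constructor 3; apply: turn_face_inj.
  by constructor 2; rewrite -wu1 turn_face.
have [wt1|wt1] := eqVneq w.1 (turn u).1; last by constructor 1.
have [tw|tw] := eqVneq (turn w).1 u.1.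
  by constructor 4; apply: turn_face_inj; rewrite ?turnK.
by constructor 2; rewrite -wt1 turn_face.
Qed.

Lemma nb_edge_pairs_le h K L m : partial_gluing h -> (K <= m)%N -> (L <= m)%N ->
  (nb_edge_pairs K L h)%:R <= \sum_(u : flag n | proper_flag u) \sum_(b in transverse u)
    [&& #|edge_flags h u| <= 2 * m, #|edge_flags h b| <= 2 * m & ~~ linked h u b]%N%:R :> R.
Proof.
move=> ph Km Lm; rewrite pair_big_dep /= -natr_sum ler_nat.
pose S := [set p : flag n * flag n | [&& proper_flag p.1, p.2 \in transverse p.1,
  #|edge_flags h p.1| <= 2 * m, #|edge_flags h p.2| <= 2 * m & ~~ linked h p.1 p.2]%N].
apply: (@leq_trans #|S|); last first.
  rewrite -sum1_card [leqRHS]big_mkcond [leqLHS]big_mkcond; apply: leq_sum => -[u b] _.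
  by rewrite inE /=; case: (proper_flag u) => //=; case: (_ \in transverse _).
rewrite /nb_edge_pairs.
apply: leq_trans (leq_imset_card (fun p => (edge_class h p.1, edge_class h p.2)) S).
apply/subset_leq_card/subsetP=> -[X Y]; rewrite inE /=.
case/and5P=> XE YE XY XK /andP[YL] /existsP[t /andP[/existsP[a /andP[aX /eqP at_]] /existsP[c /andP[cY /eqP ct]]]].
have cls Z d : Z \in edges h -> d \in Z -> exists v, [/\ proper_flag v, Z = edge_class h v & d = flag_edge v].
  rewrite edgesE // => /imsetP[u]; rewrite inE => pu -> /imsetP[v]; rewrite mem_edge_flags => uv ->.
  by exists v; rewrite (linked_proper ph uv) (edge_class_linked ph uv).
have [u [pu XEu aE]] := cls _ _ XE aX; have [w [pw YEw cE]] := cls _ _ YE cY.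
have wu : w.1.1 = u.1.1 by move: at_ ct; rewrite aE cE /flag_edge /= => -> ->.
have neq b : linked h w b -> ~~ linked h u b.
  move=> wb; apply: contra XY => ub.
  by rewrite XEu YEw (edge_class_linked ph ub) (edge_class_linked ph wb).
have fin b : linked h w b -> b \in transverse u -> (X, Y) \in
    [set (edge_class h p.1, edge_class h p.2) | p in S].
  move=> wb bt; apply/imsetP; exists (u, b); last by rewrite /= XEu YEw (edge_class_linked ph wb).
  rewrite inE /= pu bt neq // andbT /=.
  rewrite -(edge_flags_linked ph wb) !card_edge_flags // !leq_mul2l /= -XEu -YEw.
  by rewrite (leq_trans XK Km) (leq_trans YL Lm).
case: (transverse_or_linked pw wu) => [wt|wt|E|E].
- exact: fin (linked_refl h w) wt.
- exact: fin (linked_turn h w) wt.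
- by have := neq w (linked_refl h w); rewrite E linked_refl.
by have := neq w (linked_refl h w); rewrite E linked_turn.
Qed.

Lemma EE_pairs_le K L m q : (K <= m)%N -> (L <= m)%N -> (2 * m <= 4 * n)%N -> 0 <= q ->
  (forall g x, partial_gluing g -> proper_flag x -> open g x.1 -> (nb_glued g <= 2 * m)%N ->
    \sum_(h in completions g) (#|edge_flags h x| <= 2 * m)%N%:R <= q * weight R g) ->
  EE_pairs R n K L <= 144 * n%:R * (m%:R * pair_rate n m q).
Proof.
move=> Km Lm mn q0 Hq; set B := m%:R * _.
have B0 : 0 <= B by rewrite mulr_ge0 ?ler0n // pair_rate_ge0.
apply: (@le_trans _ _ (\sum_(u : flag n | proper_flag u) \sum_(b in transverse u)
    mean (fun h => [&& #|edge_flags h u| <= 2 * m, #|edge_flags h b| <= 2 * m & ~~ linked h u b]%N%:R))).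
  under eq_bigr do rewrite -mean_sum.
  rewrite -mean_sum; apply: mean_le => h hG; apply: nb_edge_pairs_le => //.
  exact: gluings_partial.
apply: (@le_trans _ _ (\sum_(u : flag n | proper_flag u) 12 * B)); last first.
  by rewrite sum_proper_flags; lra.
apply: ler_sum => u pu.
apply: (@le_trans _ _ (\sum_(b in transverse u) B)); last first.
  by rewrite sumr_const -[_ *+ _]mulr_natl ler_wpM2r // ler_nat card_transverse.
apply: ler_sum => b; rewrite inE => /and4P[pb /eqP bt bu btu].
apply: mean_ler; rewrite -[#|gluings n|%:R]/(#|gluings n|%:R) -completions_unglued.
rewrite card_completions ?unglued_partial // -/(weight R (unglued n)).
have pE : partner (unglued n) u = turn u by exact: partner_unglued.
apply: (small_pair_le mn q0 Hq (r := m) (unglued_partial n) pu _ pb _ bt bu).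
- exact: unglued_open.
- exact: unglued_open.
- by rewrite pE.
- by rewrite pE danger_unglued ?proper_turn.
- by rewrite nb_glued_unglued.
have := edge_flags_unglued pu; rewrite -(leq_add2r (2 * m)); apply: leq_trans.
by rewrite -addn1 addnC leq_add2r.
Qed.

End PairExpectation.

(** * Bounds with explicit constants *)

Section CleanBounds.
Variable R : realFieldType.
Local Open Scope ring_scope.

Lemma expr1D_le2 (a : R) k : 0 <= a -> k%:R * a <= 2^-1 -> (1 + a) ^+ k <= 2.
Proof.
move=> a0 ka.
(* The induction rests on [(1 + a) * (1 - (j + 1) * a) <= 1 - j * a]. *)
have H j : (1 + a) ^+ j * (1 - j%:R * a) <= 1.
  elim: j => [|j IH]; first by rewrite expr0 mul0r subr0 mulr1.
  apply: le_trans IH; rewrite exprS mulrC mulrA mulrC ler_wpM2l ?exprn_ge0 ?addr_ge0 //.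
  have j0 : 0 <= j%:R :> R by rewrite ler0n.
  have q1 : 0 <= a * a by rewrite mulr_ge0.
  have q2 : 0 <= j%:R * (a * a) by rewrite mulr_ge0.
  by rewrite -natr1; move: (j%:R) q2 => b q2; lra.
have E0 : 0 <= (1 + a) ^+ k by rewrite exprn_ge0 // addr_ge0.
have := H k; move: E0 ka; move: (_ ^+ k) (k%:R * a) => E b E0 b2; nra.
Qed.

Lemma growth_le2 M0 k : (2 * (400 * 1000) * k <= 3 * M0.+1)%N -> growth R M0 ^+ k <= 2.
Proof.
move=> H; apply: expr1D_le2; first by rewrite divr_ge0 ?ler0n.
rewrite mulrA ler_pdivrMr ?ltr0n // [2^-1 * _]mulrC ler_pdivlMr ?ltr0n //.
by rewrite -!natrM ler_nat mulnC [(k * _)%N]mulnC mulnA.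
Qed.

(** The factor [1000 * 1000] keeps [growth] to the power [k] below 2 and ensures the smallness
    condition. Replacing [nu] by [12 * n] costs at most [1 / n], and the third summand of
    [size_bound] yields [4 * 4032 / n]. *)
Lemma EE_size_upper n k : (0 < k)%N -> (1000 * 1000 * k <= n)%N ->
  EE_size R n k <= (2 * k%:R)^-1 + (20 * 1000) / n%:R.
Proof.
move=> k0 kn; have k0' : 1 <= k%:R :> R by rewrite ler1n.
have n0 : (0 < n)%N by lia.
have n0' : 0 < n%:R :> R by rewrite ltr0n.
have kn' : 4 * k%:R <= n%:R :> R by rewrite -natrM ler_nat; lia.
set nu : R := (3 * (4 * n - 2 * k).+1)%:R.
have nuE : nu = 3 * (4 * n%:R - 2 * k%:R + 1).
  rewrite /nu natrM; congr (_ * _); rewrite -natr1; congr (_ + 1).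
  by rewrite natrB ?natrM //; lia.
have nu6 : 6 * n%:R <= nu by rewrite nuE; lra.
have k4 : (2 * k <= 4 * n)%N by lia.
have small : (12 * (4 * n - (4 * n - 2 * k) + 2) * 224 <= 3 * (4 * n - 2 * k).+1)%N by lia.
apply: le_trans (@EE_size_le R n k nu k0 k4 small erefl) _.
have gk : growth R (4 * n - 2 * k) ^+ k <= 2 by apply: growth_le2; lia.
have g0 : 0 <= growth R (4 * n - 2 * k) ^+ k.
  by rewrite exprn_ge0 // (le_trans _ (growth_ge1 _ _)) ?ler01.
have nu0 : 0 < nu by apply: lt_le_trans nu6; rewrite mulr_gt0.
rewrite mulrDr; have -> : 20 * 1000 / n%:R = n%:R^-1 + (20 * 1000 - 1) / n%:R :> R by lra.
rewrite addrA lerD //.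
  rewrite ler_pdivrMr // (mulrDl _ _ nu).
  have -> : (2 * k%:R)^-1 * nu = 6 * n%:R / k%:R - 3 + 3 / (2 * k%:R).
    by rewrite nuE; field; rewrite gt_eqF // (lt_le_trans _ k0').
  have : 3 <= n%:R^-1 * nu by rewrite mulrC ler_pdivlMr //; lra.
  have : 0 <= 3 / (2 * k%:R) :> R by rewrite divr_ge0 // mulr_ge0 // (le_trans _ k0').
  lra.
apply: (@le_trans _ _ (6 * n%:R / k%:R * (12 * 4032 / (6 * n%:R) ^+ 2 * (k%:R * 2)))).
  rewrite ler_wpM2l ?mulr_ge0 ?invr_ge0 ?ler0n //.
  have e1 : 12 * 4032 / nu ^+ 2 <= 12 * 4032 / (6 * n%:R) ^+ 2.
    rewrite ler_wpM2l ?mulr_ge0 // lef_pV2 ?posrE ?exprn_gt0 ?mulr_gt0 //.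
    by rewrite ler_pXn2r ?nnegrE ?mulr_ge0 // ltW.
  have e2 : k%:R * growth R (4 * n - 2 * k) ^+ k <= k%:R * 2 by rewrite ler_wpM2l // ler0n.
  apply: ler_pM e1 e2; last by rewrite mulr_ge0 ?ler0n.
  by rewrite mulr_ge0 ?mulr_ge0 // invr_ge0 exprn_ge0 // ltW.
have -> : 6 * n%:R / k%:R * (12 * 4032 / (6 * n%:R) ^+ 2 * (k%:R * 2)) = 4 * 4032 / n%:R :> R.
  by field; rewrite !gt_eqF // (lt_le_trans _ k0').
by rewrite ler_wpM2r ?invr_ge0 ?ler0n //; lra.
Qed.

(** The exploration starts in an arbitrary state, where only [s <= 24 * m] is known. The third
    summand of [size_bound] is then of order m^3 / n^2, and [m * m <= n] reduces it to m / n. *)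
Lemma small_edge_le n m (C : R) : C = 12 * 4032 * 2 * (625 + 96 * 16 * 25) ->
  (0 < m)%N -> (1000 * 1000 * m <= n)%N -> (m * m <= n)%N ->
  forall (g : gluing n) x, partial_gluing g -> proper_flag x -> open g x.1 ->
  (nb_glued g <= 2 * m)%N ->
  \sum_(h in completions g) (#|edge_flags h x| <= 2 * m)%N%:R <=
    (C * (m%:R / n%:R)) * weight R g.
Proof.
move=> CE m0 mn mm g x pg px xo Gm; move: CE mm.
have Go := nb_open_glued g.
pose M0 := (4 * n - 4 * m)%N.
have n0 : (0 < n)%N by lia.
have small : (12 * (4 * n - M0 + 2) * 224 <= 3 * M0.+1)%N by rewrite /M0; lia.
have Mg : (M0 + 2 * m <= nb_open g)%N by move: Gm Go; rewrite /M0; lia.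
have nu6n : (6 * n <= 3 * M0.+1)%N by rewrite /M0; lia.
have gk_le : (2 * (400 * 1000) * m <= 3 * M0.+1)%N by rewrite /M0; lia.
have s_le : (#|self_flags g| <= 24 * m)%N by apply: leq_trans (card_self_flags pg) _; lia.
have dw : (danger_weight (danger g x) #|self_flags g| <= 400 * m)%N.
  rewrite /danger_weight; move: s_le; move: #|self_flags g| => s.
  by case: (danger g x) => [|[|d]]; lia.
have sw : (self_weight (danger g x) #|self_flags g| <= (25 * m) ^ 2 + 96 * (400 * m))%N.
  rewrite /self_weight leq_add //; first by rewrite leq_exp2r //; lia.
  by rewrite leq_mul2l dw orbT.
have e2 : (2 <= #|edge_flags g x|)%N.
  have xt : x != turn x by apply: contraTneq (turn_face px) => <-; rewrite eqxx.
  apply: (@leq_trans #|[set x; turn x]|); first by rewrite cards2 xt.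
  apply/subset_leq_card/subsetP=> v; rewrite mem_edge_flags.
  by move=> /set2P[] ->; [exact: linked_refl|exact: linked_turn].
have Lg : ((2 * m).+1 <= #|edge_flags g x| + 2 * m)%N by move: e2; move: #|edge_flags g x| => e; lia.
have ns : (nb_sizes (fun a => a <= 2 * m) (2 * m).+1 #|edge_flags g x| <= 3 * m)%N.
  rewrite /nb_sizes; apply: (@leq_trans (\sum_(#|edge_flags g x| <= a < (2 * m).+1) 1)).
    by apply: leq_sum => a _; exact: leq_b1.
  by rewrite sum_nat_const_nat muln1; move: #|edge_flags g x| => e; lia.
move=> CE mm.
have m0' : 1 <= m%:R :> R by rewrite ler1n.
have n0' : 0 < n%:R :> R by rewrite ltr0n.
have mm' : m%:R * m%:R <= n%:R :> R by rewrite -natrM ler_nat.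
have ALim a : (a <= 2 * m)%N -> (a < (2 * m).+1)%N by [].
apply: le_trans (size_upper R ALim small (r := m) pg px xo Mg Lg) _.
rewrite ler_wpM2r ?weight_ge0 //.
set nu : R := (3 * M0.+1)%:R; rewrite /size_bound -/nu.
have nu6 : 6 * n%:R <= nu by rewrite /nu -natrM ler_nat.
have nu0 : 0 < nu by apply: lt_le_trans nu6; rewrite mulr_gt0.
have {}sw : (self_weight (danger g x) #|self_flags g|)%:R <=
    (625 + 96 * 16 * 25) * (m%:R * m%:R) :> R.
  move: sw; rewrite -(ler_nat R) => /le_trans; apply.
  rewrite natrD natrX !natrM expr2.
  have : m%:R <= m%:R * m%:R :> R by rewrite ler_peMr // (le_trans _ m0').
  by move: (m%:R) => a; nra.
have gk : growth R M0 ^+ m <= 2 by exact: growth_le2.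
have g0 : 0 <= growth R M0 ^+ m.
  by rewrite exprn_ge0 // (le_trans _ (growth_ge1 _ _)) ?ler01.
have inu : nu^-1 <= (6 * n%:R)^-1 by rewrite lef_pV2 ?posrE ?mulr_gt0.
have inu0 : 0 <= nu^-1 by rewrite invr_ge0 ltW.
have {}ns : (nb_sizes (fun a => a <= 2 * m) (2 * m).+1 #|edge_flags g x|)%N%:R <= 3 * m%:R :> R.
  by rewrite -natrM ler_nat.
have t1 : (nb_sizes (fun a => a <= 2 * m) (2 * m).+1 #|edge_flags g x|)%N%:R / nu <= m%:R / n%:R.
  apply: (@le_trans _ _ (3 * m%:R * (6 * n%:R)^-1)).
    by apply: ler_pM; rewrite ?ler0n.
  have -> : 3 * m%:R * (6 * n%:R)^-1 = 2^-1 * (m%:R / n%:R) :> R by field; rewrite gt_eqF.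
  have : 0 <= m%:R / n%:R :> R by rewrite divr_ge0 ?ler0n.
  lra.
have t2 : 12 * (danger_weight (danger g x) #|self_flags g|)%:R / nu <= 800 * (m%:R / n%:R).
  apply: (@le_trans _ _ (12 * (400 * m%:R) * (6 * n%:R)^-1)).
    by apply: ler_pM; rewrite ?mulr_ge0 ?ler0n // ler_wpM2l // -natrM ler_nat.
  have -> : 12 * (400 * m%:R) * (6 * n%:R)^-1 = 800 * (m%:R / n%:R) :> R by field; rewrite gt_eqF.
  by [].
have t3 : 12 * 4032 / nu ^+ 2 * (m%:R * growth R M0 ^+ m) *
    (self_weight (danger g x) #|self_flags g|)%:R <=
    12 * 4032 / 18 * (625 + 96 * 16 * 25) * (m%:R / n%:R).
  apply: (@le_trans _ _ (12 * 4032 * (6 * n%:R)^-1 ^+ 2 * (m%:R * 2) *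
      ((625 + 96 * 16 * 25) * (m%:R * m%:R)))).
    have e1 : 12 * 4032 / nu ^+ 2 <= 12 * 4032 * (6 * n%:R)^-1 ^+ 2.
      by rewrite -exprVn ler_wpM2l ?mulr_ge0 // ler_pXn2r ?nnegrE // invr_ge0 mulr_ge0 ?ler0n.
    have e3 : m%:R * growth R M0 ^+ m <= m%:R * 2 by rewrite ler_wpM2l // ler0n.
    have p1 : 0 <= 12 * 4032 / nu ^+ 2 by rewrite -exprVn mulr_ge0 ?exprn_ge0 ?mulr_ge0.
    have p2 : 0 <= m%:R * growth R M0 ^+ m by rewrite mulr_ge0 ?ler0n.
    by apply: ler_pM sw; [exact: mulr_ge0|exact: ler0n|exact: ler_pM].
  have -> : 12 * 4032 * (6 * n%:R)^-1 ^+ 2 * (m%:R * 2) * ((625 + 96 * 16 * 25) * (m%:R * m%:R)) =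
    12 * 4032 / 18 * (625 + 96 * 16 * 25) * (m%:R / n%:R) * (m%:R * m%:R / n%:R) :> R.
    by field; rewrite gt_eqF.
  apply: ler_piMr; last by rewrite ler_pdivrMr // mul1r.
  by apply: mulr_ge0; [lra|rewrite divr_ge0 ?ler0n].
have a0 : 0 <= m%:R / n%:R :> R by rewrite divr_ge0 ?ler0n.
apply: le_trans (lerD (lerD t1 t2) t3) _; rewrite CE.
by move: (m%:R / n%:R) a0 => a a0; lra.
Qed.

Lemma EE_pairs_upper n m K L (C : R) : C = 12 * 4032 * 2 * (625 + 96 * 16 * 25) ->
  (0 < m)%N -> (1000 * 1000 * m <= n)%N -> (m * m <= n)%N -> (K <= m)%N -> (L <= m)%N ->
  EE_pairs R n K L <= 1200 * C * (m%:R ^+ 3 / n%:R).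
Proof.
move=> CE m0 mn mm Km Lm; have Hq := small_edge_le CE m0 mn mm; move: CE {mm} Hq.
have n0 : (0 < n)%N by lia.
have m4 : (2 * m <= 4 * n)%N by lia.
set nu := (3 * (4 * n - 2 * m).+1)%N.
have nu6n : (6 * n <= nu)%N by rewrite /nu; lia.
move=> CE Hq.
have m0' : 1 <= m%:R :> R by rewrite ler1n.
have n0' : 0 < n%:R :> R by rewrite ltr0n.
have C0 : 0 <= C by rewrite CE; lra.
have a0 : 0 <= m%:R / n%:R :> R by rewrite divr_ge0 ?ler0n.
apply: le_trans (EE_pairs_le Km Lm m4 _ Hq) _; first by rewrite mulr_ge0.
rewrite /pair_rate -/nu.
have nu6 : 6 * n%:R <= nu%:R :> R by rewrite -natrM ler_nat.
have inu : nu%:R^-1 <= (6 * n%:R)^-1 :> R.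
  by rewrite lef_pV2 ?posrE ?mulr_gt0 // (lt_le_trans _ nu6) // mulr_gt0.
have e1 : 1 + 12 * (2 * m + 2)%:R <= 49 * m%:R :> R by rewrite natrD natrM; lra.
apply: (@le_trans _ _ (144 * n%:R * (m%:R * (C * (m%:R / n%:R) * (49 * m%:R) / (6 * n%:R))))).
  rewrite ler_wpM2l ?mulr_ge0 ?ler0n // ler_wpM2l ?ler0n //.
  apply: ler_pM; rewrite ?mulr_ge0 ?invr_ge0 ?addr_ge0 ?mulr_ge0 ?ler0n //.
  by rewrite ler_wpM2l // mulr_ge0.
have -> : 144 * n%:R * (m%:R * (C * (m%:R / n%:R) * (49 * m%:R) / (6 * n%:R))) =
  1176 * C * (m%:R ^+ 3 / n%:R) by field; rewrite gt_eqF.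
rewrite ler_wpM2r ?divr_ge0 ?exprn_ge0 ?ler0n //; lra.
Qed.

End CleanBounds.

From mathcomp Require Import all_classical all_reals all_analysis.
Import numFieldNormedType.Exports.
Local Open Scope ring_scope.

(** * Asymptotics *)

Section Harmonic.
Variable R : realType.

Definition harmonic_sum a b : R := \sum_(a <= l < b.+1) l%:R^-1.

Lemma ln_succ_le b : (0 < b)%N -> ln (b.+1%:R / b%:R : R) <= b%:R^-1.
Proof.
move=> b0; have b0' : 0 < b%:R :> R by rewrite ltr0n.
have -> : b.+1%:R / b%:R = 1 + b%:R^-1 :> R by rewrite -natr1 mulrDl mulfV ?gt_eqF // mul1r.
by apply: le_ln1Dx; rewrite (lt_trans _ (_ : 0 < _)) ?invr_gt0 // ltrN10.
Qed.

Lemma ln_succ_ge b : (0 < b)%N -> b.+1%:R^-1 <= ln (b.+1%:R / b%:R : R).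
Proof.
move=> b0; have b0' : 0 < b%:R :> R by rewrite ltr0n.
have b1' : 0 < b.+1%:R :> R by rewrite ltr0n.
rewrite -[_ / _]invrK lnV ?posrE ?invr_gt0 ?divr_gt0 // lerNr invf_div.
have -> : b%:R / b.+1%:R = 1 + - b.+1%:R^-1 :> R.
  by rewrite -[X in X / _](addrK 1) natr1 mulrBl mulfV ?gt_eqF // mul1r.
by apply: le_ln1Dx; rewrite ltrN2 invf_lt1 // ltr1n ltnS.
Qed.

Lemma ln_ratio_recr (a b : nat) : (0 < a <= b)%N ->
  ln (b.+1%:R / a%:R : R) = ln (b%:R / a%:R) + ln (b.+1%:R / b%:R).
Proof.
move=> /andP[a0 ab]; have b0 : (0 < b)%N by apply: leq_trans ab.
have a0' : 0 < a%:R :> R by rewrite ltr0n.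
have b0' : 0 < b%:R :> R by rewrite ltr0n.
rewrite -lnM ?posrE ?divr_gt0 ?ltr0n //; congr ln.
by field; rewrite !gt_eqF.
Qed.

Lemma harmonic_le (a b : nat) : (0 < a <= b)%N ->
  harmonic_sum a b <= a%:R^-1 + ln (b%:R / a%:R).
Proof.
move=> /andP[a0]; elim: b => [|b IH]; first by case: a a0.
rewrite leq_eqVlt => /orP[/eqP <-|].
  by rewrite /harmonic_sum big_nat1 divff ?ln1 ?addr0 // pnatr_eq0 -lt0n.
rewrite ltnS => ab; rewrite /harmonic_sum big_nat_recr /=; last exact: leqW.
rewrite ln_ratio_recr ?a0 // addrA lerD ?IH //.
by apply: ln_succ_ge; apply: leq_trans ab.
Qed.

Lemma harmonic_ge_succ (a b : nat) : (0 < a <= b)%N ->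
  ln (b.+1%:R / a%:R) <= harmonic_sum a b.
Proof.
move=> /andP[a0]; elim: b => [|b IH]; first by case: a a0.
rewrite leq_eqVlt => /orP[/eqP <-|].
  by rewrite /harmonic_sum big_nat1 ln_succ_le.
rewrite ltnS => ab; rewrite /harmonic_sum big_nat_recr /=; last exact: leqW.
by rewrite ln_ratio_recr ?a0 ?(leqW ab) // lerD ?IH // ln_succ_le.
Qed.

Lemma harmonic_ge (a b : nat) : (0 < a <= b)%N -> ln (b%:R / a%:R) <= harmonic_sum a b.
Proof.
move=> ab; apply: le_trans (harmonic_ge_succ ab); have /andP[a0 ab'] := ab.
have a0' : 0 < a%:R :> R by rewrite ltr0n.
have b0 : 0 < b%:R :> R by rewrite ltr0n (leq_trans a0).
rewrite ler_ln ?posrE ?divr_gt0 // ler_wpM2r ?invr_ge0 ?ler_nat // ltW //.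
Qed.

(* Bernoulli: (1 + d / a)^a >= 1 + d. *)
Lemma ln_ratio_ge (a b : nat) : (0 < a <= b)%N ->
  ln (b - a).+1%:R <= a%:R * ln (b%:R / a%:R) :> R.
Proof.
move=> /andP[a0 ab]; have a0' : 0 < a%:R :> R by rewrite ltr0n.
have bn : (0 < b)%N by apply: leq_trans ab.
have b0 : 0 < b%:R :> R by rewrite ltr0n.
have -> : a%:R * ln (b%:R / a%:R) = ln ((b%:R / a%:R) ^+ a) :> R.
  by rewrite lnXn ?divr_gt0 // mulr_natl.
rewrite ler_ln ?posrE ?exprn_gt0 ?divr_gt0 ?ltr0n //.
have -> : b%:R / a%:R = 1 + (b - a)%:R / a%:R :> R.
  by rewrite natrB // mulrBl mulfV ?gt_eqF // addrC subrK.
set x := _ / _; have x0 : 0 <= x by rewrite divr_ge0 ?ler0n.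
have H j : 1 + j%:R * x <= (1 + x) ^+ j.
  elim: j => [|j IH]; first by rewrite mul0r addr0.
  have j0 : 0 <= j%:R * (x * x) by rewrite !mulr_ge0.
  rewrite exprS -natr1; apply: (@le_trans _ _ ((1 + x) * (1 + j%:R * x))); first by move: j0; move: (j%:R) => c; lra.
  by rewrite ler_wpM2l // addr_ge0.
apply: le_trans (H a); rewrite /x mulrCA mulfV ?gt_eqF // mulr1 -natr1; lra.
Qed.

Lemma gainE n : gain R n n n = (24 * n%:R)^-1 * harmonic_sum 1 n.
Proof.
rewrite /gain /harmonic_sum mulr_sumr big_add1 big_mkord (reindex_inj rev_ord_inj) /=.
apply: eq_bigr => t _; rewrite invfM; congr (_ * _^-1); congr (_%:R).
by rewrite subKn.
Qed.

Lemma loss_le n : (0 < n)%N -> loss R n n n <= 37 / 144 / n%:R.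
Proof.
move=> n0; have n0' : 0 < n%:R :> R by rewrite ltr0n.
(* Summation by parts: the summand of index [t] of [gain] occurs in [n - t - 1] of the sums, which
   compensates its denominator [n - t]. *)
have H r : (r <= n)%N -> \sum_(t < r) gain R n n t + (n - r)%:R * gain R n n r <= r%:R / (24 * n%:R).
  elim: r => [|r IH] rn; first by rewrite big_ord0 /gain big_ord0 mulr0 addr0 mul0r.
  have rn' : 0 < (n - r)%:R :> R by rewrite ltr0n subn_gt0.
  have nr : (n - r)%:R = (n - r.+1)%:R + 1 :> R by rewrite natr1 subnSK.
  have gS : gain R n n r.+1 = gain R n n r + (24 * n%:R * (n - r)%:R)^-1.
    by rewrite /gain big_ord_recr.
  rewrite big_ord_recr /= gS.
  have e : (n - r.+1)%:R * (24 * n%:R * (n - r)%:R)^-1 <= (24 * n%:R)^-1 :> R.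
    rewrite ler_pdivrMr ?mulr_gt0 // mulrA mulVf ?mul1r ?nr ?lerDl //.
    by rewrite mulf_neq0 // gt_eqF.
  have := IH (ltnW rn); rewrite nr -[r.+1%:R]natr1; move: e; rewrite nr.
  move: ((24 * n%:R * _)^-1) ((24 * n%:R)^-1) => q c.
  move: (gain R n n r) ((n - r.+1)%:R) (r%:R) (\sum_(t < r) _) => a p b S; lra.
have := H n (leqnn n); rewrite subnn mul0r addr0 => S1.
have g0 : 0 <= \sum_(t < n) gain R n n t by apply: sumr_ge0 => t _; exact: gain_ge0.
have -> : loss R n n n = 37 / (3 * (4 * n - 2 * n).+1)%:R * \sum_(t < n) gain R n n t.
  by rewrite /loss mulr_sumr; apply: eq_bigr => t _; rewrite mulrAC.
have nu : 6 * n%:R <= (3 * (4 * n - 2 * n).+1)%:R :> R by rewrite -natrM ler_nat; lia.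
apply: (@le_trans _ _ (37 / (6 * n%:R) * (n%:R / (24 * n%:R)))).
  have e1 : 37 / (3 * (4 * n - 2 * n).+1)%:R <= 37 / (6 * n%:R) :> R.
    have p : 0 < 6 * n%:R :> R by rewrite mulr_gt0.
    by rewrite ler_wpM2l // lef_pV2 ?posrE // (lt_le_trans p nu).
  by apply: (ler_pM _ g0 e1 S1); rewrite divr_ge0 ?ler0n.
have -> : 37 / (6 * n%:R) * (n%:R / (24 * n%:R)) = 37 / 144 / n%:R :> R by field; rewrite gt_eqF.
by [].
Qed.

Lemma EE_lower n : (0 < n)%N -> 2^-1 * ln n%:R - 4 <= EE R n.
Proof.
move=> n0; have n0' : 0 < n%:R :> R by rewrite ltr0n.
apply: le_trans (EE_ge R n0); rewrite mulrBr gainE mulrA.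
have -> : 12 * n%:R * (24 * n%:R)^-1 = 2^-1 :> R by field; rewrite gt_eqF.
have h : ln n%:R <= harmonic_sum 1 n.
  by have := @harmonic_ge 1 n; rewrite divr1; apply; rewrite n0.
have : 12 * n%:R * loss R n n n <= 12 * n%:R * (37 / 144 / n%:R).
  by rewrite ler_wpM2l ?loss_le // mulr_ge0 ?ler0n.
have -> : 12 * n%:R * (37 / 144 / n%:R) = 37 / 12 :> R by field; rewrite gt_eqF.
move: (12 * n%:R * loss _ _ _ _) (harmonic_sum _ _) (ln _) h => a b c h; lra.
Qed.

(** At most [n] sizes occur, so the errors [20 * 1000 / n] add up to a constant. *)
Lemma EE_range_upper n a b : (0 < a <= b)%N -> (1000 * 1000 * b <= n)%N ->
  EE_range R n a b <= 2^-1 * harmonic_sum a b + 20 * 1000.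
Proof.
move=> /andP[a0 ab] bn; have b0 : (0 < b)%N by apply: leq_trans ab.
have bn' : (b <= n)%N by apply: leq_trans bn; rewrite leq_pmull.
have n0 : (0 < n)%N by apply: leq_trans bn'.
have abn : (b.+1 - a <= n)%N by case: a a0 {ab} => // a _; rewrite subSS (leq_trans (leq_subr _ _)).
have n0' : 0 < n%:R :> R by rewrite ltr0n.
rewrite EE_rangeE.
apply: (@le_trans _ _ (\sum_(a <= l < b.+1) (2^-1 * l%:R^-1 + 20 * 1000 / n%:R))).
  rewrite !big_nat; apply: ler_sum => l /andP[al lb].
  rewrite -invfM; apply: EE_size_upper; first exact: leq_trans al.
  by apply: leq_trans bn; rewrite leq_mul2l -ltnS lb orbT.
rewrite big_split /= -mulr_sumr lerD2l sumr_const_nat -[_ *+ _]mulr_natr.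
have c0 : 0 <= 20 * 1000 :> R by rewrite mulr_ge0 ?ler0n.
have abn' : (b.+1 - a)%:R <= n%:R :> R by rewrite ler_nat.
by rewrite mulrAC ler_pdivrMr //; apply: (ler_wpM2l c0 abn').
Qed.

(** The lower bound on [m] limits the number of edges of size above [m] to
    [6 * n / (m + 1) <= 12 * 1000 * 1000]. *)
Lemma EE_upper n m : (0 < m)%N -> (1000 * 1000 * m <= n)%N -> (n <= 2 * (1000 * 1000 * m))%N ->
  EE R n <= 2^-1 * ln n%:R + (20 * 1000 + 1 + 12 * 1000 * 1000).
Proof.
move=> m0 mn nm; have mn1 : (m <= n)%N by apply: leq_trans mn; rewrite leq_pmull.
have n0 : (0 < n)%N by apply: leq_trans mn1.
have m0' : 0 < m%:R :> R by rewrite ltr0n.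
have n0' : 0 < n%:R :> R by rewrite ltr0n.
have mn' : m%:R <= n%:R :> R by rewrite ler_nat.
have nm' : n%:R <= 2 * (1000 * 1000 * m%:R) :> R by rewrite -!natrM ler_nat.
apply: le_trans (EE_le R n m) _.
have := @EE_range_upper n 1 m; rewrite EE_rangeE => /(_ _ mn) H.
have {}H := H (introT andP (conj isT m0)).
have h := @harmonic_le 1 m; rewrite divr1 invr1 in h.
have {}h := h (introT andP (conj isT m0)).
have l : ln m%:R <= ln n%:R :> R by rewrite ler_ln ?posrE.
have e : 6 * n%:R / m.+1%:R <= 12 * 1000 * 1000 :> R.
  rewrite ler_pdivrMr ?ltr0n // -natr1; lra.
move: H h l e; move: (\sum_(1 <= k < _) _) (harmonic_sum _ _) (ln m%:R) (ln n%:R) (_ / _) => a b c d f; lra.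
Qed.

End Harmonic.

Local Open Scope classical_set_scope.
Local Open Scope ring_scope.

Section Asymptotics.
Variable R : realType.

Lemma littleo_near (k : nat -> nat) (e : nat -> R) (eps : R) :
  (fun n => (k n)%:R : R) =o_\oo e -> 0 < eps ->
  \forall n \near \oo, (k n)%:R <= eps * `|e n|.
Proof.
move=> /eqoP ko eps0; apply: filterS (ko _ eps0) => n; exact: le_trans (ler_norm _).
Qed.

Lemma exists_le1 (eps : R) : 0 < eps -> exists e : R, [/\ 0 < e, e <= 1 & e <= eps].
Proof.
move=> eps0; exists (Num.min eps 1).
by rewrite lt_min eps0 ltr01 !ge_min !lexx orbT.
Qed.

Lemma exists_scaled (M e : R) : 0 < M -> 0 < e -> exists2 c : R, 0 < c & M * c = e.
Proof.
by move=> M0 e0; exists (e / M); rewrite ?divr_gt0 // mulrC divfK // gt_eqF.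
Qed.

Lemma million_gt0 : 0 < 1000 * 1000 :> R.
Proof. by rewrite mulr_gt0 ?ltr0n. Qed.

(** A single condition on [k] bounds both relative errors by [e] for all [l <= k]: [l^2 / n] below
    and [40 * 1000 * l / n] above. *)
Lemma EE_window n k l (e : R) : 0 < e <= 1 -> (0 < l <= k)%N ->
  1000 * 1000 * k%:R ^+ 2 <= e * n%:R ->
  (2 * l%:R)^-1 * (1 - e) <= EE_simple R n l /\
  EE_size R n l <= (2 * l%:R)^-1 * (1 + e).
Proof.
move=> /andP[e0 e1] /andP[l0 lk] kn.
have l1 : 1 <= l%:R :> R by rewrite ler1n.
have lk' : l%:R <= k%:R :> R by rewrite ler_nat.
have ll : l%:R * l%:R <= k%:R ^+ 2 :> R.
  by rewrite expr2; apply: ler_pM; rewrite ?ler0n.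
have lll : l%:R <= l%:R * l%:R :> R by rewrite ler_peMr // ler0n.
have en : 1000 * 1000 * (l%:R * l%:R) <= e * n%:R :> R.
  move: kn ll; move: (k%:R ^+ 2) (l%:R * l%:R) (e * n%:R) => A B D kn ll; lra.
have nn : e * n%:R <= n%:R by rewrite ler_piMl // ler0n.
have mn : (1000 * 1000 * l <= n)%N.
  rewrite -(ler_nat R) !natrM; move: en nn lll; move: (n%:R) (l%:R) (l%:R * l%:R) (e * n%:R) => A B C D; lra.
have n0 : (0 < n)%N by apply: leq_trans mn; rewrite muln_gt0.
have n0' : 0 < n%:R :> R by rewrite ltr0n.
have l0' : 0 < 2 * l%:R :> R by rewrite mulr_gt0 ?ltr0n.
split.
  apply: le_trans (EE_simple_ge R l0 n0).
  rewrite ler_wpM2l ?invr_ge0 ?(ltW l0') // lerD2l lerN2 ler_pdivrMr // natrX expr2.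
  apply: le_trans en; rewrite ler_peMl ?mulr_ge0 ?ler0n //; lra.
apply: le_trans (EE_size_upper R l0 mn) _.
rewrite [leRHS]mulrDr mulr1 lerD2l ler_pdivrMr // -[leRHS]mulrA ler_pdivlMl //.
apply: le_trans en; move: lll; move: (l%:R) l1 (l%:R * l%:R) => A ? B; lra.
Qed.

Lemma EE_window_near (k : nat -> nat) (eps : R) :
  (fun n => (k n)%:R : R) =o_\oo (fun n => Num.sqrt (n%:R : R)) -> 0 < eps ->
  \forall n \near \oo, forall l, (0 < l <= k n)%N ->
    (2 * l%:R)^-1 * (1 - eps) <= EE_simple R n l /\
    EE_size R n l <= (2 * l%:R)^-1 * (1 + eps).
Proof.
move=> ko eps0; have [e [e0 e1 ee]] := exists_le1 eps0.
have [c c0 ce] := exists_scaled million_gt0 e0.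
have c1 : c <= 1 by move: c0 ce; move: c => c; lra.
apply: filterS (littleo_near ko c0) => n kn l l0.
have kn2 : 1000 * 1000 * (k n)%:R ^+ 2 <= e * n%:R.
  rewrite -ce -[leRHS]mulrA (ler_pM2l million_gt0).
  apply: (@le_trans _ _ ((c * Num.sqrt n%:R) ^+ 2)).
    by apply: lerXn2r; rewrite ?nnegrE ?ler0n //; move: kn; rewrite ger0_norm // => /(le_trans (ler0n _ _)).
  rewrite exprMn sqr_sqrtr ?ler0n // ler_wpM2r ?ler0n // expr2 ler_piMl //; exact: ltW.
have [h1 h2] := EE_window (introT andP (conj e0 e1)) l0 kn2.
have l0' : 0 <= (2 * l%:R : R)^-1 by rewrite invr_ge0 mulr_ge0 ?ler0n.
split.
  by apply: le_trans h1; rewrite ler_wpM2l // lerD2l lerN2.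
by apply: le_trans h2 _; rewrite ler_wpM2l // lerD2l.
Qed.

Lemma EE_pairs_near (K L : nat -> nat) (eps : R) :
  (fun n => (K n)%:R : R) =o_\oo (fun n => (n%:R : R) `^ 3^-1) ->
  (fun n => (L n)%:R : R) =o_\oo (fun n => (n%:R : R) `^ 3^-1) -> 0 < eps ->
  \forall n \near \oo, EE_pairs R n (K n) (L n) <= eps.
Proof.
move=> Ko Lo eps0.
have [C [C0 HC]] : exists C : R, 1 <= C /\ forall n m K L, (0 < m)%N ->
    (1000 * 1000 * m <= n)%N -> (m * m <= n)%N -> (K <= m)%N -> (L <= m)%N ->
    EE_pairs R n K L <= C * (m%:R ^+ 3 / n%:R).
  exists (1200 * (12 * 4032 * 2 * (625 + 96 * 16 * 25))); split; last first.
    by move=> *; apply: EE_pairs_upper.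
  lra.
have [e [e0 e1 ee]] := exists_le1 eps0.
have C0' : 0 < C by apply: lt_le_trans C0.
have CC0 : 0 < 1000 * 1000 * C by rewrite mulr_gt0 ?million_gt0.
(* This [c] serves twice: [C * c <= eps] bounds the result, and [1000 * 1000 * c <= 1] admits the
   size [m] chosen below. *)
have [c c0 cM] := exists_scaled CC0 e0.
have cC : c <= C * c by rewrite ler_peMl // ltW.
have Cc : C * c <= eps.
  apply: le_trans ee; move: cM c0 cC; rewrite -mulrA; move: (C * c) => A; lra.
have c6 : 1000 * 1000 * c <= 1.
  move: cM c0 cC; rewrite -[_ * C * c]mulrA; move: (C * c) => A; lra.
have c1 : c <= 1 by clear - c0 c6; lra.
have Kn := littleo_near Ko c0; have Ln := littleo_near Lo c0.
near=> n.
pose x := n%:R `^ 3^-1 : R.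
have x3 : x ^+ 3 = n%:R by rewrite -powR_mulrn ?powR_ge0 // /x -powRrM mulVf ?powRr1.
have x0 : 0 <= x by rewrite powR_ge0.
(* The 1 covers the case that [K n] and [L n] vanish. *)
pose m := maxn 1 (maxn (K n) (L n)).
have cn : 1 <= c ^+ 3 * n%:R.
  rewrite mulrC -ler_pdivrMr ?exprn_gt0 // div1r.
  by near: n; exact: nbhs_infty_ger.
have ax k : k%:R <= c * `|n%:R `^ 3^-1| -> k%:R <= c * x by rewrite ger0_norm.
have Kx : (K n)%:R <= c * x by apply: ax; near: n; exact: Kn.
have Lx : (L n)%:R <= c * x by apply: ax; near: n; exact: Ln.
have x1 : 1 <= c * x.
  rewrite leNgt; apply/negP => h.
  have : (c * x) ^+ 3 < 1 by rewrite exprn_ilt1 // mulr_ge0 // ltW.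
  by rewrite exprMn x3 ltNge cn.
have mx : m%:R <= c * x by rewrite /m /maxn; do 3![case: ifP => _ //].
have m0 : (0 < m)%N by rewrite leq_max.
have m1 : 1 <= m%:R :> R by rewrite ler1n.
have m3 : m%:R ^+ 3 <= c * n%:R.
  apply: (@le_trans _ _ ((c * x) ^+ 3)).
    by apply: lerXn2r => //; rewrite nnegrE ?ler0n ?mulr_ge0 // ltW.
  rewrite exprMn x3 ler_wpM2r ?ler0n // -[leRHS]expr1 ler_wiXn2l // ltW //.
have n0 : 0 < n%:R :> R.
  by rewrite -(@pmulr_rgt0 _ c) //; apply: lt_le_trans m3; rewrite exprn_gt0 // ltr0n.
have mm : m%:R * m%:R <= m%:R ^+ 3 :> R by rewrite -expr2 ler_weXn2l.
have m13 : m%:R <= m%:R ^+ 3 :> R by rewrite -[leLHS]expr1 ler_weXn2l.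
have h6 : 1000 * 1000 * m%:R <= n%:R :> R.
  apply: (@le_trans _ _ (1000 * 1000 * (c * n%:R))).
    by rewrite (ler_pM2l million_gt0) (le_trans m13).
  by rewrite [leLHS]mulrA ler_piMl // ltW.
have h2 : m%:R * m%:R <= n%:R :> R.
  by apply: le_trans mm _; apply: le_trans m3 _; rewrite ler_piMl // ltW.
apply: le_trans (HC _ m _ _ m0 _ _ _ _) _.
- by rewrite -(ler_nat R) !natrM.
- by rewrite -(ler_nat R) natrM.
- by rewrite /m !leq_max leqnn orbT.
- by rewrite /m !leq_max leqnn !orbT.
apply: le_trans Cc; rewrite ler_wpM2l ?(le_trans _ C0) // ler_pdivrMr //.
Unshelve. all: by end_near. Qed.

End Asymptotics.

(** * Relative errors and limits *)

Section Conclusion.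
Variable R : realType.

Lemma divn_half_le (d n : nat) : (0 < d <= n)%N ->
  exists m, [/\ (0 < m)%N, (d * m <= n)%N & (n <= 2 * (d * m))%N].
Proof.
move=> /andP[d0 dn]; exists (n %/ d)%N.
have m0 : (0 < n %/ d)%N by rewrite divn_gt0.
split=> //; first by rewrite mulnC leq_divM.
apply: leq_trans (ltnW (ltn_ceil n d0)) _.
rewrite mulSn mulnC mul2n -addnn leq_add2r; exact: leq_pmulr.
Qed.

Lemma EE_ln_bounded : exists C : R,
  \forall n \near \oo, `|EE R n - 2^-1 * ln n%:R| <= C.
Proof.
exists (20 * 1000 + 1 + 12 * 1000 * 1000).
apply: filterS (nbhs_infty_ge (1000 * 1000)%N) => n nM.
have dn : (0 < 1000 * 1000 <= n)%N by rewrite muln_gt0 nM.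
have [m [m0 mn nm]] := divn_half_le dn.
have n0 : (0 < n)%N by apply: leq_trans nM; rewrite muln_gt0.
have := EE_lower R n0; have := EE_upper R m0 mn nm.
rewrite ler_norml; move: (EE R n) (2^-1 * ln _) => A B h1 h2; apply/andP; split; lra.
Qed.

Lemma littleo_million (k : nat -> nat) :
  (fun n => (k n)%:R : R) =o_\oo (fun n => n%:R : R) ->
  \forall n \near \oo, (1000 * 1000 * k n <= n)%N.
Proof.
move=> ko; have [c c0 cM] := exists_scaled (million_gt0 R) ltr01.
apply: filterS (littleo_near ko c0) => n; rewrite ger0_norm ?ler0n // => kn.
have ne : n%:R = 1000 * 1000 * (c * n%:R) by rewrite mulrA cM mul1r.
by rewrite -(ler_nat R) !natrM [leRHS]ne (ler_pM2l (million_gt0 R)).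
Qed.

Lemma EE_range_near (k k1 k2 : nat -> nat) (eps : R) :
  (fun n => (k n)%:R : R) =o_\oo (fun n => Num.sqrt (n%:R : R)) ->
  (forall n, (0 < k1 n <= k2 n)%N /\ (k2 n <= k n)%N) ->
  (fun n => (k2 n - k1 n)%N) @ \oo --> \oo -> 0 < eps ->
  \forall n \near \oo, let L := ln ((k2 n)%:R / (k1 n)%:R) in
    [/\ 0 < L, 2^-1 * L * (1 - eps) <= EE_range R n (k1 n) (k2 n) &
      EE_range R n (k1 n) (k2 n) <= 2^-1 * L * (1 + eps)].
Proof.
move=> ko kk D eps0.
(* The errors of the window and of the harmonic sum multiply, and [(1 + e)^2 <= 1 + 3 * e]. *)
have eps30 : 0 < eps / 3 by rewrite divr_gt0.
have [e [e0 e1 ee]] := exists_le1 eps30.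
have win := EE_window_near ko e0.
have big := D _ (nbhs_infty_ger (expR e^-1)).
apply: filterS2 win big => n win big.
have [k12 k2k] := kk n; have /andP[k10 k12'] := k12.
set L := ln _; set H := harmonic_sum R (k1 n) (k2 n).
(* By Bernoulli, [k1 * L] is at least the logarithm of [k2 - k1 + 1], which tends to infinity. So
   the error [1 / k1] of the harmonic sum is small against [L], even if [L] tends to 0. *)
have L1 : e^-1 <= (k1 n)%:R * L.
  apply: le_trans (ln_ratio_ge R k12).
  rewrite -(expRK e^-1) ler_ln ?posrE ?expR_gt0 ?ltr0n //.
  by apply: le_trans big _; rewrite ler_nat.
have k10' : 0 < (k1 n)%:R :> R by rewrite ltr0n.
have L2 : (k1 n)%:R^-1 <= e * L.
  rewrite -(ler_pM2l k10') mulfV ?gt_eqF // -(ler_pM2l (_ : 0 < e^-1)) ?invr_gt0 //.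
  by rewrite mulr1 mulrCA mulKf ?gt_eqF.
have L0 : 0 < L.
  by rewrite -(pmulr_rgt0 _ e0); apply: lt_le_trans L2; rewrite invr_gt0.
have HL : L <= H by apply: harmonic_ge.
have HU : H <= L + e * L by apply: le_trans (harmonic_le R k12) _; rewrite addrC lerD2l.
have lo : 2^-1 * (1 - e) * H <= EE_range R n (k1 n) (k2 n).
  rewrite EE_rangeE mulr_sumr; apply: ler_sum_nat => l /andP[al lb].
  have [|h1 _] := win l; first by rewrite (leq_trans k10 al) (leq_trans _ k2k).
  by apply: le_trans (EE_simple_le R n l); rewrite mulrAC -invfM.
have hi : EE_range R n (k1 n) (k2 n) <= 2^-1 * (1 + e) * H.
  rewrite EE_rangeE mulr_sumr; apply: ler_sum_nat => l /andP[al lb].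
  have [|_ h1] := win l; first by rewrite (leq_trans k10 al) (leq_trans _ k2k).
  by rewrite mulrAC -invfM.
split=> //.
  apply: le_trans lo; rewrite mulrAC.
  apply: (@le_trans _ _ (2^-1 * (1 - e) * L)).
    by rewrite ler_wpM2r ?(ltW L0) // ler_wpM2l ?invr_ge0 //; lra.
  by rewrite ler_wpM2l // mulr_ge0 ?invr_ge0 //; lra.
apply: le_trans hi _.
apply: (@le_trans _ _ (2^-1 * (1 + e) * (L + e * L))).
  by rewrite ler_wpM2l // mulr_ge0 ?invr_ge0 //; lra.
have -> : 2^-1 * (1 + e) * (L + e * L) = 2^-1 * L * (1 + e * (2 + e)) by field.
rewrite ler_wpM2l ?mulr_ge0 ?invr_ge0 ?(ltW L0) // lerD2l.
apply: (@le_trans _ _ (e * 3)); last by move: ee; lra.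
by rewrite ler_wpM2l ?(ltW e0) //; lra.
Qed.

Lemma relative_error_cvg (X Y : nat -> R) :
  (forall eps, 0 < eps -> \forall n \near \oo,
     [/\ 0 < Y n, Y n * (1 - eps) <= X n & X n <= Y n * (1 + eps)]) ->
  exists2 d : nat -> R, d @ \oo --> (0 : R) &
    \forall n \near \oo, X n = Y n * (1 + d n).
Proof.
move=> H; exists (fun n => X n / Y n - 1).
  apply/cvgrPdist_le => eps eps0; apply: filterS (H _ eps0) => n [Y0 lo hi].
  rewrite sub0r normrN ler_norml lerBrDr lerBlDr ler_pdivlMr // ler_pdivrMr //.
  by rewrite mulrC [- _ + 1]addrC lo mulrC addrC.
apply: filterS (H _ ltr01) => n [Y0 _ _].
by rewrite addrC subrK mulrC divfK // gt_eqF.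
Qed.

End Conclusion.

Theorem theorem2p4 (R : realType) :
  (* (a) *)
  (fun n : nat => EE R n) = (fun n : nat => 2^-1 * ln (n%:R : R)) +O_\oo
    (fun=> 1 : R)
  /\
  (* (b), followed by the uniformity of the error *)
  (forall k : nat -> nat,
     (forall n, (0 < k n)%N) ->
     (fun n => (k n)%:R : R) =o_\oo (fun n => Num.sqrt (n%:R : R)) ->
     exists2 d : nat -> R, d @ \oo --> (0 : R) &
       \forall n \near \oo,
         EE_simple R n (k n) = (2 * (k n)%:R)^-1 * (1 + d n))
  /\
  (forall k : nat -> nat,
     (fun n => (k n)%:R : R) =o_\oo (fun n => Num.sqrt (n%:R : R)) ->
     forall eps : R, 0 < eps ->
     \forall n \near \oo, forall l : nat, (0 < l <= k n)%N ->
       `|EE_simple R n l - (2 * l%:R)^-1| <= eps * (2 * l%:R)^-1)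
  /\
  (* (c), upper bounds *)
  (forall k k1 k2 : nat -> nat,
     (fun n => (k n)%:R : R) =o_\oo (fun n => n%:R : R) ->
     (forall n, (0 < k1 n <= k2 n)%N /\ (k2 n <= k n)%N) ->
     (exists C : R, \forall n \near \oo,
        EE_size R n (k n) <= (2 * (k n)%:R)^-1 + C * n%:R^-1)
     /\
     (exists C : R, \forall n \near \oo,
        EE_range R n (k1 n) (k2 n) <=
          2^-1 * ln ((k2 n)%:R / (k1 n)%:R) + C))
  /\
  (* (c), asymptotics.  For bounded k2 - k1 the second one fails: if k1 = k2
     then ln (k2 / k1) = 0 while EE_range is positive. *)
  (forall k k1 k2 : nat -> nat,
     (fun n => (k n)%:R : R) =o_\oo (fun n => Num.sqrt (n%:R : R)) ->
     (forall n, (0 < k1 n <= k2 n)%N /\ (k2 n <= k n)%N) ->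
     [/\ exists2 d : nat -> R, d @ \oo --> (0 : R) &
           \forall n \near \oo,
             EE_size R n (k n) = (2 * (k n)%:R)^-1 * (1 + d n),
         (fun n => (k2 n - k1 n)%N) @ \oo --> \oo ->
         exists2 d : nat -> R, d @ \oo --> (0 : R) &
           \forall n \near \oo,
             EE_range R n (k1 n) (k2 n) =
               2^-1 * ln ((k2 n)%:R / (k1 n)%:R) * (1 + d n)
       & (fun n => EE_nonsimple R n (k n)) @ \oo --> (0 : R)])
  /\
  (* (d) *)
  (forall K L : nat -> nat,
     (fun n => (K n)%:R : R) =o_\oo (fun n => (n%:R : R) `^ 3^-1) ->
     (fun n => (L n)%:R : R) =o_\oo (fun n => (n%:R : R) `^ 3^-1) ->
     (fun n => EE_pairs R n (K n) (L n)) @ \oo --> (0 : R)).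
Proof.
have inv_gt0 l : (0 < l)%N -> 0 < (2 * l%:R)^-1 :> R by move=> l0; rewrite invr_gt0 mulr_gt0 ?ltr0n.
have le_k (k k1 k2 : nat -> nat) n :
    (forall n, (0 < k1 n <= k2 n)%N /\ (k2 n <= k n)%N) -> (0 < k n)%N.
  by case/(_ n) => /andP[k10 k12] k2k; apply: leq_trans k10 (leq_trans k12 k2k).
split.
  apply/eqaddOP; have [C HC] := EE_ln_bounded R.
  near=> c; apply: filterS HC => n h; rewrite normr1 mulr1; apply: le_trans h _.
  near: c; exact: nbhs_pinfty_ge (num_real _).
split.
  move=> k k0 ko; apply: relative_error_cvg => eps eps0.
  apply: filterS (EE_window_near ko eps0) => n win.
  have [|lo hi] := win (k n); first by rewrite k0 leqnn.
  split=> //; first exact: inv_gt0.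
  exact: le_trans (EE_simple_le R n (k n)) hi.
split.
  move=> k ko eps eps0; apply: filterS (EE_window_near ko eps0) => n win l lk.
  have [lo hi] := win l lk; rewrite ler_norml.
  have := EE_simple_le R n l; move: lo hi.
  move: ((2 * l%:R)^-1) (EE_simple R n l) (EE_size R n l) => A B D *.
  by apply/andP; split; lra.
split.
  move=> k k1 k2 ko kk; have kn := littleo_million ko; split.
    exists (20 * 1000); apply: filterS kn => n; apply: EE_size_upper; exact: le_k kk.
  exists (2^-1 + 20 * 1000); apply: filterS kn => n kn.
  have [k12 k2k] := kk n; have /andP[k10 _] := k12.
  have k2n : (1000 * 1000 * k2 n <= n)%N by apply: leq_trans kn; rewrite leq_mul2l k2k orbT.
  apply: le_trans (EE_range_upper R k12 k2n) _; rewrite addrA lerD2r.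
  have h := harmonic_le R k12.
  have i1 : (k1 n)%:R^-1 <= 1 :> R by rewrite invf_le1 ?ltr0n // ler1n.
  move: h i1; move: ((k1 n)%:R^-1) (ln _) (harmonic_sum _ _ _) => A B D; lra.
split.
  move=> k k1 k2 ko kk; split.
  - apply: relative_error_cvg => eps eps0.
    have k0 n := le_k k k1 k2 n kk.
    apply: filterS (EE_window_near ko eps0) => n win.
    have [|lo hi] := win (k n); first by rewrite k0 leqnn.
    split=> //; first exact: inv_gt0.
    exact: le_trans lo (EE_simple_le R n (k n)).
  - move=> D; apply: relative_error_cvg => eps eps0.
    apply: filterS (EE_range_near ko kk D eps0) => n [L0 lo hi]; split=> //.
    by rewrite mulr_gt0 ?invr_gt0.
  - apply/cvgrPdist_le => eps eps0.
    have k0 n := le_k k k1 k2 n kk.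
    apply: filterS (EE_window_near ko eps0) => n win.
    have [|lo hi] := win (k n); first by rewrite k0 leqnn.
    rewrite EE_nonsimpleE sub0r normrN ger0_norm ?subr_ge0 ?EE_simple_le //.
    (* Both expectations lie within a factor [1 - eps] to [1 + eps] of [1 / (2 * k)], and as
       [k >= 1] this window has length at most [eps]. *)
    have : (2 * (k n)%:R)^-1 * eps <= 2^-1 * eps.
      rewrite ler_wpM2r ?(ltW eps0) // lef_pV2 ?posrE ?mulr_gt0 ?ltr0n //.
      by rewrite ler_peMr // ler1n.
    move: lo hi.
    move: ((2 * (k n)%:R)^-1) (EE_simple R n _) (EE_size R n _) => A B D; lra.
move=> K L Ko Lo; apply/cvgrPdist_le => eps eps0.
apply: filterS (EE_pairs_near Ko Lo eps0) => n h.
by rewrite sub0r normrN ger0_norm // /EE_pairs /mean divr_ge0 ?sumr_ge0.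
Unshelve. all: by end_near. Qed.
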